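(* Let $L\in\mathbf{Gr}^0$ and let $\Sigma_L$ be the set of all semi-infinite subspaces $K\in\mathbf{Gr}^0$ such that $$\dim L/(L\cap K)=1,\qquad \dim K/(L\cap K)=1.$$ Then there is a unique probability measure $\nu_L$ on $\Sigma_L$ invariant with respect to the stabilizer of $L$ in $\mathbf{GL}^0(\ell\oplus\ell^\diamond)$.
   Context: Spaces and group. $\mathbb{F}_q$ is a finite field. $\ell$ is the direct sum of countably many copies of $\mathbb{F}_q$ (basis $e_1,e_2,\dots$), with the discrete topology; $\ell^\diamond$ is the direct product of countably many copies of $\mathbb{F}_q$ (coordinate vectors $f_1,f_2,\dots$; elements are formal infinite combinations $\sum w_j f_j$), with the product topology (compact). $\ell\oplus\ell^\diamond$ has the product topology. Elements are written as row vectors and operators act on the right: $v\mapsto vg$. $\mathbf{GL}(\ell\oplus\ell^\diamond)$ is the group of all continuous linear operators $g=\begin{pmatrix}a&b\\c&d\end{pmatrix}$ in $\ell\oplus\ell^\diamond$ having a continuous inverse. For such $g$, the block $a:\ell\to\ell$ has finite-dimensional kernel and an image of finite codimension, and $\theta(g):=\dim(\ell/\ell a)-\dim\ker a$ is a homomorphism $\mathbf{GL}(\ell\oplus\ell^\diamond)\to\mathbb{Z}$; $\mathbf{GL}^0(\ell\oplus\ell^\diamond)$ is its kernel. Grassmannian. For any infinite matrix $T$ over $\mathbb{F}_q$ let $\mathrm{graph}(T)=\{v\oplus vT: v\in\ell\}$; $\mathcal{M}$ is the set of all such subspaces of $\ell\oplus\ell^\diamond$. A subspace $M\subset\ell\oplus\ell^\diamond$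 is semi-infinite if there is $L\in\mathcal{M}$ with $\dim L/(L\cap M)<\infty$ and $\dim M/(L\cap M)<\infty$; it has relative dimension $0$ if these two dimensions are equal (this does not depend on $L$). $\mathbf{Gr}^0$ is the set of semi-infinite subspaces of relative dimension $0$; $\mathbf{GL}^0(\ell\oplus\ell^\diamond)$ acts on it by $L\mapsto Lg$. Borel structure. For finite subsets $\Omega,\Xi\subset\mathbb{N}$ let $V[\Omega,\Xi]$ be spanned by the $e_i$, $i\notin\Omega$, and the $f_j$, $j\in\Xi$, and let $W[\Omega,\Xi]$ be the topological direct sum of the lines $\mathbb{F}_q e_i$, $i\in\Omega$, and $\mathbb{F}_q f_j$, $j\notin\Xi$ (infinite combinations of the $f_j$ allowed). The chart $\mathcal{M}[\Omega,\Xi]$ is the set of graphs of linear operators $V[\Omega,\Xi]\to W[\Omega,\Xi]$; it is identified via matrix entries with a countable product of copies of $\mathbb{F}_q$. The charts with $\#\Omega=\#\Xi$ cover $\mathbf{Gr}^0$. A subset of $\mathbf{Gr}^0$ is Borel if its intersection with each chart is Borel for the product topology of that chart. Measures on $\Sigma_L$ are Borel measures for the structure induced from $\mathbf{Gr}^0$. *)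

(* Defs.v *)
From HB Require Import structures.
From mathcomp Require Import all_boot all_order all_algebra.
From mathcomp Require Import finmap.
From mathcomp Require Import all_classical all_reals all_analysis.

Set Implicit Arguments.
Unset Strict Implicit.
Unset Printing Implicit Defensive.

Import GRing.Theory.
Local Open Scope classical_set_scope.
Local Open Scope ring_scope.

Definition lsubspace (F : fieldType) (V : lmodType F) (M : set V) : Prop :=
  M 0 /\ forall (a : F) (x y : V), M x -> M y -> M (a *: x + y).

(* [dim A / B = n]: some [n] vectors of [A] form a basis of [A] modulo [B].
   It is used for subspaces [B `<=` A]; when [A / B] is infinite-dimensional it
   holds for no [n]. *)
Definition dim_quot (F : fieldType) (V : lmodType F) (A B : set V) (n : nat) :
    Prop :=
  exists e : 'I_n -> V, (forall i, A (e i)) /\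
    forall x, A x -> exists! c : {ffun 'I_n -> F},
      B (x - \sum_(i < n) c i *: e i).

(* Finitely supported sequences are polynomials, with [e_i] being ['X^i]; only
   the [F]-module structure of [{poly F}] is used. *)
Definition ell (F : finFieldType) : Type := {poly F}.
HB.instance Definition _ (F : finFieldType) := GRing.Lmodule.on (ell F).
HB.instance Definition _ (F : finFieldType) :=
  Topological.copy (ell F) (discrete_topology {poly F}).

Definition ell_dual (F : finFieldType) : Type := nat -> F^o.
HB.instance Definition _ (F : finFieldType) := GRing.Lmodule.on (ell_dual F).
HB.instance Definition _ (F : finFieldType) :=
  Topological.copy (ell_dual F) {ptws nat -> discrete_topology F}.

Notation hspace F := (ell F * ell_dual F)%type.

(* The row vector [v] times [g] is written [g v]. *)
Definition GL (F : finFieldType) : set {linear hspace F -> hspace F} :=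
  [set g | continuous g /\
     exists h : hspace F -> hspace F, [/\ continuous h, cancel g h & cancel h g]].

(* The block [a] of [g = (a b; c d)]. *)
Definition block_a (F : finFieldType) (g : hspace F -> hspace F) :
    ell F -> ell F :=
  fun v => (g (v, 0)).1.

(* [theta(g) = z], both dimensions being finite. *)
Definition theta_is (F : finFieldType) (g : hspace F -> hspace F) (z : int) :
    Prop :=
  exists m n : nat,
    [/\ dim_quot [set: ell F] (range (block_a g)) m,
        dim_quot [set v | block_a g v = 0] [set 0] n
      & z = m%:Z - n%:Z].

Definition GL0 (F : finFieldType) : set {linear hspace F -> hspace F} :=
  [set g | GL g /\ theta_is g 0].

Definition mulvT (F : finFieldType) (v : ell F) (T : nat -> nat -> F) :
    ell_dual F :=
  fun j => \sum_(i < size (v : {poly F})) (v : {poly F})`_i * T i j.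

Definition graph (F : finFieldType) (T : nat -> nat -> F) : set (hspace F) :=
  [set (v, mulvT v T) | v in [set: ell F]].

Definition semi_infinite (F : finFieldType) (M : set (hspace F)) : Prop :=
  lsubspace M /\ exists T : nat -> nat -> F,
    (exists m, dim_quot (graph T) (graph T `&` M) m) /\
    (exists n, dim_quot M (graph T `&` M) n).

Definition relative_dim0 (F : finFieldType) (M : set (hspace F)) : Prop :=
  exists (T : nat -> nat -> F) (n : nat),
    dim_quot (graph T) (graph T `&` M) n /\ dim_quot M (graph T `&` M) n.

Definition is_Gr0 (F : finFieldType) (M : set (hspace F)) : Prop :=
  semi_infinite M /\ relative_dim0 M.

Definition Gr0 (F : finFieldType) : Type := {M : set (hspace F) | is_Gr0 M}.
HB.instance Definition _ (F : finFieldType) := gen_eqMixin (Gr0 F).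
HB.instance Definition _ (F : finFieldType) := gen_choiceMixin (Gr0 F).

Definition Gr0_set (F : finFieldType) (K : Gr0 F) : set (hspace F) := sval K.
Coercion Gr0_set : Gr0 >-> set.

Definition adjacent_Gr0 (F : finFieldType) (L K : Gr0 F) : Prop :=
  dim_quot (L : set _) (L `&` K) 1 /\ dim_quot (K : set _) (L `&` K) 1.

Definition Sigma_set (F : finFieldType) (L : Gr0 F) : Type :=
  {K : Gr0 F | adjacent_Gr0 L K}.
HB.instance Definition _ (F : finFieldType) (L : Gr0 F) :=
  gen_eqMixin (Sigma_set L).
HB.instance Definition _ (F : finFieldType) (L : Gr0 F) :=
  gen_choiceMixin (Sigma_set L).

(* [inl i] stands for [e_i] and [inr j] for [f_j]. *)
Definition hcoord (F : finFieldType) (x : hspace F) (s : nat + nat) : F :=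
  match s with inl i => (x.1 : {poly F})`_i | inr j => x.2 j end.

Section charts.
Variables (F : finFieldType) (Omega Xi : {fset nat}).

Definition chart_index (s : nat + nat) : bool :=
  match s with inl i => i \notin Omega | inr j => j \in Xi end.

Definition chart_row : Type := {s : nat + nat | chart_index s}.
Definition chart_col : Type := {s : nat + nat | ~~ chart_index s}.
HB.instance Definition _ := Choice.on chart_row.
HB.instance Definition _ := Choice.on chart_col.

(* As [Xi] is finite, vectors of [chart_V] have finitely many nonzero
   coordinates, so [chart_V] is the linear span of its basis vectors. *)
Definition chart_V : set (hspace F) :=
  [set x | forall s, ~~ chart_index s -> hcoord x s = 0].

Definition chart_W : set (hspace F) :=
  [set x | forall s, chart_index s -> hcoord x s = 0].

Definition chart_matrix : Type :=
  {ptws chart_row * chart_col -> discrete_topology F}.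
HB.instance Definition _ := Topological.on chart_matrix.

(* The graph of the operator [chart_V -> chart_W] with matrix [T]; the sum has
   finitely many nonzero terms. *)
Definition chart_graph (T : chart_matrix) : set (hspace F) :=
  [set x | exists v w : hspace F,
     [/\ chart_V v, chart_W w,
         forall j : chart_col, hcoord w (val j) =
           \sum_(i \in [set: chart_row]) hcoord v (val i) * (T (i, j) : F)
       & x = v + w]].

End charts.

Definition borel_Gr0 (F : finFieldType) : set (set (Gr0 F)) :=
  [set A | forall Omega Xi : {fset nat}, #|` Omega| = #|` Xi| ->
     <<s [set U : set (chart_matrix F Omega Xi) | open U] >>
       [set T | exists2 K : Gr0 F, A K & (K : set _) = chart_graph T]].

(* Measurable types are pointed in this library, hence the nonemptiness proofs. *)

Section dim_quot_lemmas.
Variables (F : fieldType) (V : lmodType F).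
Implicit Types (A B C : set V).

Lemma lsubspaceD A x y : lsubspace A -> A x -> A y -> A (x + y).
Proof. by move=> [_ sA] Ax Ay; rewrite -[x]scale1r; exact: sA. Qed.

Lemma lsubspaceZ A a x : lsubspace A -> A x -> A (a *: x).
Proof. by move=> [A0 sA] Ax; rewrite -[_ *: _]addr0; exact: sA. Qed.

Lemma lsubspaceB A x y : lsubspace A -> A x -> A y -> A (x - y).
Proof.
by move=> sA Ax Ay; rewrite -scaleN1r; apply: lsubspaceD => //; exact: lsubspaceZ.
Qed.

Lemma lsubspace_sum A n (c : 'I_n -> F) (e : 'I_n -> V) :
  lsubspace A -> (forall i, A (e i)) -> A (\sum_(i < n) c i *: e i).
Proof.
move=> sA Ae; elim/big_rec: _ => [|i x _ Ax]; first by case: sA.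
by apply: lsubspaceD => //; exact: lsubspaceZ.
Qed.

Lemma lsubspaceI A B : lsubspace A -> lsubspace B -> lsubspace (A `&` B).
Proof.
move=> [A0 sA] [B0 sB]; split=> // a x y [Ax Bx] [Ay By].
by split; [exact: sA|exact: sB].
Qed.

Lemma dim_quot_refl A : dim_quot A A 0.
Proof.
exists (fun=> 0); split=> [[]//|x Ax].
exists [ffun=> 0]; split; first by rewrite big_ord0 subr0.
by move=> c _; apply/ffunP => -[].
Qed.

Lemma dim_quotD A B C m n : B `<=` A -> lsubspace B -> C `<=` B ->
  dim_quot A B m -> dim_quot B C n -> dim_quot A C (m + n).
Proof.
move=> BA sB CB [e [Ae He]] [f [Bf Hf]].
pose h (i : 'I_(m + n)) :=
  match fintype.split i with inl j => e j | inr k => f k end.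
have hl j : h (lshift n j) = e j by rewrite /h (unsplitK (inl j)).
have hr k : h (rshift m k) = f k by rewrite /h (unsplitK (inr k)).
have hsum (c : {ffun 'I_(m + n) -> F}) x : x - \sum_i c i *: h i =
    (x - \sum_(j < m) [ffun j => c (lshift n j)] j *: e j) -
    \sum_(k < n) [ffun k => c (rshift m k)] k *: f k.
  rewrite big_split_ord /= opprD addrA; congr (_ - _ - _).
    by apply: eq_bigr => j _; rewrite hl ffunE.
  by apply: eq_bigr => k _; rewrite hr ffunE.
exists h; split.
  move=> i; rewrite /h; case: (fintype.split i) => [j|k]; first exact: Ae.
  exact/BA/Bf.
move=> x Ax; have [c [Bc uc]] := He _ Ax; have [d [Cd ud]] := Hf _ Bc.
exists [ffun i => match fintype.split i with inl j => c j | inr k => d k end].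
split.
  rewrite hsum.
  suff [-> ->] : [ffun j => [ffun i => match fintype.split i with
      inl j => c j | inr k => d k end] (lshift n j)] = c /\
     [ffun k => [ffun i => match fintype.split i with
      inl j => c j | inr k => d k end] (rshift m k)] = d by [].
  split; apply/ffunP => j; rewrite !ffunE.
    by rewrite (unsplitK (inl j)).
  by rewrite (unsplitK (inr j)).
move=> c'; rewrite hsum => Cc'.
have Bc' : B (x - \sum_(j < m) [ffun j => c' (lshift n j)] j *: e j).
  rewrite -[X in B X](subrK
    (\sum_(k < n) [ffun k => c' (rshift m k)] k *: f k)).
  apply: lsubspaceD => //; first exact: CB.
  exact: lsubspace_sum.
have ec := uc _ Bc'; rewrite -ec in Cc'; have ed := ud _ Cc'.
apply/ffunP => i; rewrite ffunE; case: split_ordP => j ->.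
  by rewrite ec ffunE.
by rewrite ed ffunE.
Qed.

Lemma dim_quot_pigeonhole A B n (w : 'I_n.+1 -> V) : lsubspace B ->
  dim_quot A B n -> (forall j, A (w j)) ->
  exists2 a : 'rV[F]_n.+1, a != 0 & B (\sum_(j < n.+1) a 0 j *: w j).
Proof.
move=> sB [e [Ae He]] Aw.
have /choice [c Hc] : forall j, exists c : {ffun 'I_n -> F},
    B (w j - \sum_(i < n) c i *: e i).
  by move=> j; have [c [? _]] := He _ (Aw j); exists c.
pose M := \matrix_(j < n.+1, i < n) c j i.
have : kermx M != 0.
  rewrite kermx_eq0 /row_free neq_ltn; apply/orP; left.
  exact: leq_ltn_trans (rank_leq_col M) _.
move=> /rowV0Pn[a /sub_kermxP aM a0]; exists a => //.
have -> : \sum_j a 0 j *: w j =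
    \sum_j a 0 j *: (w j - \sum_(i < n) c j i *: e i).
  under [RHS]eq_bigr do rewrite scalerBr.
  rewrite sumrB [X in _ - X](_ : _ = 0) ?subr0//.
  under eq_bigr do rewrite scaler_sumr.
  rewrite exchange_big big1//= => i _.
  under eq_bigr do rewrite scalerA.
  rewrite -scaler_suml.
  have := congr1 (fun N : 'rV_n => N 0 i) aM; rewrite !mxE.
  by under eq_bigr do rewrite mxE; move=> ->; rewrite scale0r.
exact: lsubspace_sum.
Qed.

Lemma dim_quot1 A B (u : V) (phi : V -> F) : A u ->
  (forall x, A x -> B (x - phi x *: u)) ->
  (forall x c, A x -> B (x - c *: u) -> c = phi x) ->
  dim_quot A B 1.
Proof.
move=> Au ex un; exists (fun=> u); split=> // x Ax.
exists [ffun=> phi x]; split; first by rewrite big_ord1 ffunE; exact: ex.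
move=> c; rewrite big_ord1 => /un -/(_ Ax) e; apply/ffunP => i.
by rewrite ffunE ord1.
Qed.

End dim_quot_lemmas.

Section nonempty.
Variable F : finFieldType.

Lemma mulvT_coef (v : {poly F}) (T : nat -> nat -> F) (n : nat) :
  (size v <= n)%N ->
  mulvT (v : ell F) T = fun j => \sum_(i < n) v`_i * T i j.
Proof.
move=> vn; apply/funext => j; rewrite /mulvT.
rewrite -(big_mkord xpredT (fun i => v`_i * T i j)).
rewrite -(big_mkord xpredT (fun i => v`_i * T i j)).
rewrite [RHS](big_cat_nat (n := size v))//= [X in _ + X]big_nat_cond.
rewrite [X in _ + X]big1 ?addr0// => i /andP[/andP[si _] _].
by rewrite nth_default ?mul0r.
Qed.

Lemma mulvT_linear (T : nat -> nat -> F) (a : F) (u v : ell F) :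
  mulvT (a *: u + v) T = a *: mulvT u T + mulvT v T.
Proof.
pose n := maxn (size (a *: (u : {poly F}) + (v : {poly F})))
  (maxn (size (u : {poly F})) (size (v : {poly F}))).
rewrite (@mulvT_coef (a *: (u : {poly F}) + (v : {poly F})) _ n) ?leq_maxl//.
rewrite (@mulvT_coef u _ n); last by rewrite /n !leq_max leqnn !orbT.
rewrite (@mulvT_coef v _ n); last by rewrite /n !leq_max leqnn !orbT.
apply/funext => j; transitivity (a * (\sum_(i < n) (u : {poly F})`_i * T i j) +
  \sum_(i < n) (v : {poly F})`_i * T i j) => //.
rewrite mulr_sumr -big_split/=; apply: eq_bigr => i _.
by rewrite coefD coefZ mulrDl mulrA.
Qed.

Lemma mulvT0 (T : nat -> nat -> F) : mulvT (0 : ell F) T = 0.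
Proof.
by rewrite (@mulvT_coef 0 _ 0) ?size_poly0//; apply/funext => j; rewrite big_ord0.
Qed.

Lemma lsubspace_graph (T : nat -> nat -> F) : lsubspace (graph T).
Proof.
split; first by exists 0 => //; rewrite mulvT0.
move=> a _ _ [u _ <-] [v _ <-].
by exists (a *: u + v) => //; rewrite mulvT_linear.
Qed.

Lemma Gr0_graph0 : is_Gr0 (@graph F (fun _ _ => 0)).
Proof.
split; last first.
  by exists (fun _ _ => 0), 0%N; rewrite setIid; split; exact: dim_quot_refl.
split; first exact: lsubspace_graph.
by exists (fun _ _ => 0); rewrite setIid; split; exists 0%N; exact: dim_quot_refl.
Qed.

End nonempty.

HB.instance Definition _ (F : finFieldType) :=
  isPointed.Build (Gr0 F) (exist _ _ (Gr0_graph0 F)).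

Section exchange.
Variables (F : fieldType) (V : lmodType F) (M L : set V) (phi : V -> F).
Variables (u x : V) (n : nat).
Hypotheses (sM : lsubspace M) (sL : lsubspace L).
Hypothesis phi_lin : forall (a : F) (y z : V), phi (a *: y + z) = a * phi y + phi z.
Hypotheses (Mu : M u) (Lu : L u) (phiu : phi u != 0).
Hypothesis Hx : forall c l m, L l -> M m -> c *: x = l + m -> c = 0.
Hypotheses (dM : dim_quot M (M `&` L) n) (dL : dim_quot L (M `&` L) n).

Let phi0 : phi 0 = 0.
Proof. by have := phi_lin (-1) 0 0; rewrite scaler0 addr0 mulN1r addNr. Qed.

Let phiZ a y : phi (a *: y) = a * phi y.
Proof. by have := phi_lin a y 0; rewrite !addr0 phi0 addr0. Qed.

Let phiB y z : phi (y - z) = phi y - phi z.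
Proof. by rewrite addrC -scaleN1r phi_lin mulN1r addrC. Qed.

Let phi_sum m (c : 'I_m -> F) (e : 'I_m -> V) :
  phi (\sum_(i < m) c i *: e i) = \sum_(i < m) c i * phi (e i).
Proof.
rewrite (big_morph phi (id1 := 0) (op1 := +%R))//.
  by apply: eq_bigr => i _; exact: phiZ.
by move=> y z; rewrite -[y]scale1r phi_lin mul1r scale1r.
Qed.

Definition exchange_set : set V :=
  [set z | exists y c, [/\ L y, phi y = 0 & z = y + c *: x]].
Local Notation K := exchange_set.

Let LxE c y : L y -> L (y + c *: x) -> c = 0.
Proof.
move=> Ly Lyx; apply: (Hx (l := (y + c *: x) - y) (m := 0)).
- exact: lsubspaceB.
- by case: sM.
- by rewrite addr0 addrAC subrr add0r.
Qed.

Let LK z : L z -> K z -> phi z = 0.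
Proof.
move=> Lz [y [c [Ly py e]]]; move: Lz; rewrite e => Lz.
by rewrite (LxE Ly Lz) scale0r addr0.
Qed.

Let KL z : L z -> phi z = 0 -> K z.
Proof. by move=> Lz pz; exists z, 0; rewrite scale0r addr0. Qed.

Let MK z : M z -> K z -> L z.
Proof.
move=> Mz [y [c [Ly py e]]]; move: Mz; rewrite e => Mz.
suff -> : c = 0 by rewrite scale0r addr0.
apply: (Hx (l := - y) (m := y + c *: x)) => //.
  by rewrite -[- y]add0r; apply: lsubspaceB => //; case: sL.
by rewrite addrA addNr add0r.
Qed.

Lemma lsubspace_exchange : lsubspace K.
Proof.
split; first by apply: KL => //; case: sL.
move=> a _ _ [y [c [Ly py ->]]] [z [d [Lz pz ->]]].
exists (a *: y + z), (a * c + d); split.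
- by case: sL => _; apply.
- by rewrite phi_lin py pz mulr0 addr0.
- by rewrite scalerDr scalerA addrACA -scalerDl.
Qed.

Let proju y : phi (y - (phi y / phi u) *: u) = 0.
Proof. by rewrite phiB phiZ divfK// subrr. Qed.

Let projuE y c : phi (y - c *: u) = 0 -> c = phi y / phi u.
Proof.
by rewrite phiB phiZ => /eqP; rewrite subr_eq0 => /eqP ->; rewrite mulfK.
Qed.

Lemma dim_exchange_l : dim_quot L (L `&` K) 1.
Proof.
apply: (dim_quot1 (u := u) (phi := fun y => phi y / phi u)) => //.
  move=> y Ly; have Lz : L (y - (phi y / phi u) *: u).
    by apply: lsubspaceB => //; exact: lsubspaceZ.
  by split => //; exact: KL.
by move=> y c Ly [Lz Kz]; apply: projuE; exact: LK.
Qed.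

Lemma dim_exchange_r : dim_quot K (L `&` K) 1.
Proof.
exists (fun=> x); split.
  by move=> _; exists 0, 1; rewrite scale1r add0r; split=> //; case: sL.
move=> _ [y [c [Ly py ->]]]; exists [ffun=> c]; split.
  by rewrite big_ord1 ffunE addrK; split=> //; exact: KL.
move=> d; rewrite big_ord1 => -[+ _]; rewrite -addrA -scalerBl => /(LxE Ly).
by move/subr0_eq => e; apply/ffunP => i; rewrite ord1 ffunE e.
Qed.

Lemma dim_exchangeM : dim_quot M (M `&` K) (n + 1).
Proof.
apply: (dim_quotD (B := M `&` L)) => //.
- exact: lsubspaceI.
- by move=> z [Mz Kz]; split=> //; exact: MK.
apply: (dim_quot1 (u := u) (phi := fun y => phi y / phi u)) => //.
  move=> y [My Ly]; split; first by apply: lsubspaceB => //; exact: lsubspaceZ.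
  by apply: KL => //; apply: lsubspaceB => //; exact: lsubspaceZ.
by move=> y c _ [Mz Kz]; apply: projuE; apply: LK => //; exact: MK.
Qed.

Lemma dim_exchangeK : dim_quot K (M `&` K) (1 + n).
Proof.
apply: (dim_quotD (B := L `&` K)) => //.
- by apply: lsubspaceI => //; exact: lsubspace_exchange.
- by move=> z [Mz Kz]; split=> //; exact: MK.
- exact: dim_exchange_r.
have [f [Lf Hf]] := dL.
pose f' i := f i - (phi (f i) / phi u) *: u.
have Lf' i : L (f' i) by apply: lsubspaceB => //; exact: lsubspaceZ.
have pf' i : phi (f' i) = 0 by exact: proju.
have sumE (c : 'I_n -> F) : \sum_i c i *: f i =
    \sum_i c i *: f' i + \sum_i c i *: ((phi (f i) / phi u) *: u).
  by rewrite -big_split/=; apply: eq_bigr => i _; rewrite -scalerDr subrK.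
have MLu (c : 'I_n -> F) :
    (M `&` L) (\sum_i c i *: ((phi (f i) / phi u) *: u)).
  apply: lsubspace_sum; first exact: lsubspaceI.
  by move=> i; split; exact: lsubspaceZ.
exists f'; split; first by move=> i; split=> //; exact: KL.
move=> y [Ly Ky]; have py := LK Ly Ky; have [c [Mc uc]] := Hf _ Ly.
exists c; split.
  have [Mz Lz] : (M `&` L) (y - \sum_i c i *: f' i).
    rewrite (_ : y - _ = y - \sum_i c i *: f i +
      \sum_i c i *: ((phi (f i) / phi u) *: u)).
      by apply: lsubspaceD => //; exact: lsubspaceI.
    by rewrite sumE opprD addrA subrK.
  split=> //; apply: KL => //; rewrite phiB py phi_sum big1 ?subrr// => i _.
  by rewrite pf' mulr0.
move=> d [Mz Kz]; apply: uc.
rewrite sumE opprD addrA; apply: lsubspaceB => //; first exact: lsubspaceI.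
by split=> //; exact: MK.
Qed.

End exchange.

Section sigma_nonempty.
Variable F : finFieldType.

Lemma Sigma_nonempty (L : Gr0 F) : exists K : Gr0 F, adjacent_Gr0 L K.
Proof.
have [[sL _] [T [n [dM dL]]]] := svalP L.
rewrite -/(Gr0_set L) in sL dM dL.
have sM := lsubspace_graph T; set M := graph T in dM dL sM.
have sML := lsubspaceI sM sL.
pose w (j : 'I_n.+1) : hspace F := (('X^j : {poly F}) : ell F, mulvT ('X^j : {poly F}) T).
have Mw j : M (w j) by exists ('X^j : {poly F}).
have [a a0 [Mu Lu]] := dim_quot_pigeonhole sML dM Mw.
set u := \sum_(j < _) _ in Mu Lu.
have u1 : u.1 = rVpoly a :> {poly F}.
  rewrite /u (big_morph (fun z : hspace F => (z.1 : {poly F})) (id1 := 0)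
    (op1 := +%R))//.
  apply/polyP => i; rewrite coef_rVpoly coef_sum.
  case: insubP => [j _ <-|ni].
    rewrite (bigD1 j)//= [X in X + _](_ : _ = a 0 j); last first.
      by rewrite coefZ coefXn eqxx mulr1.
    rewrite big1 ?addr0// => k kj; rewrite coefZ coefXn.
    by rewrite (_ : _ == _ = false) ?mulr0// eq_sym; exact/negbTE.
  rewrite big1// => k _; rewrite coefZ coefXn.
  rewrite (_ : _ == _ = false) ?mulr0//; apply: contraNF ni => /eqP ->.
  by rewrite ltn_ord.
have [i ui] : exists i, (u.1 : {poly F})`_i != 0.
  apply: contrapT => /forallNP ui; move/eqP: a0; apply.
  apply: (can_inj rVpolyK); rewrite -u1 linear0; apply/polyP => i.
  by rewrite coef0; apply/eqP/negPn/negP/ui.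
pose phi (z : hspace F) : F := (z.1 : {poly F})`_i.
have phi_lin (c : F) (y z : hspace F) : phi (c *: y + z) = c * phi y + phi z.
  by rewrite /phi [LHS](coefD (c *: (y.1 : {poly F}))) coefZ.
have [x Hx] : exists x : hspace F,
    forall c l m, (L : set _) l -> M m -> c *: x = l + m -> c = 0.
  apply: contrapT => /forallNP nx.
  pose v (j : 'I_n.+1) : hspace F :=
    (0, (fun k => (k == j)%:R) : ell_dual F).
  have /choice[l Hl] j : exists l, (L : set _) l /\ M (v j - l).
    apply: contrapT => nl; apply: (nx (v j)) => c l m Ll Mm e.
    apply: contrapT => /eqP c0; apply: nl; exists (c^-1 *: l).
    split; first exact: lsubspaceZ.
    rewrite -[v j](scalerK c0) e scalerDr addrAC subrr add0r.
    exact: lsubspaceZ.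
  have [b b0 [Mb _]] := dim_quot_pigeonhole sML dL (fun j => (Hl j).1).
  have : M (\sum_j b 0 j *: v j).
    have -> : \sum_j b 0 j *: v j =
        \sum_j b 0 j *: l j + \sum_j b 0 j *: (v j - l j).
      rewrite -big_split/=; apply: eq_bigr => j _.
      by rewrite -scalerDr addrC subrK.
    apply: lsubspaceD => //; apply: lsubspace_sum => // j.
    exact: (Hl j).2.
  have v1 : (\sum_j b 0 j *: v j).1 = 0.
    rewrite (big_morph (fun z : hspace F => z.1) (id1 := 0) (op1 := +%R))//.
    by rewrite big1// => j _; rewrite /= scaler0.
  move=> [p _ e]; have p0 : p = 0 by rewrite -v1 -e.
  move: e; rewrite p0 mulvT0 => /(congr1 snd)/= e.
  move/eqP: b0; apply; apply/rowP => j; rewrite mxE.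
  have -> : b 0 j = (\sum_k b 0 k *: v k).2 j; last by rewrite -e.
  transitivity (\sum_k b 0 k * (val j == val k)%:R : F).
    rewrite (bigD1 j)//= eqxx mulr1 big1 ?addr0// => k kj.
    by rewrite (_ : _ == _ = false) ?mulr0// eq_sym; exact/negbTE.
  by rewrite (big_morph (fun z : hspace F => (z.2 : ell_dual F) j) (id1 := 0)
    (op1 := +%R)).
have sK := lsubspace_exchange x sL phi_lin.
have dMK := dim_exchangeM sM sL phi_lin Mu Lu ui Hx dM.
have dKM := dim_exchangeK sM sL phi_lin Mu Lu ui Hx dL.
have gK : is_Gr0 (exchange_set L phi x).
  split; last by exists T, (n + 1)%N; split=> //; rewrite addnC.
  by split=> //; exists T; split; [exists (n + 1)%N|exists (1 + n)%N].
exists (exist _ _ gK); split.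
  exact: (dim_exchange_l sM sL phi_lin Lu ui Hx).
exact: (dim_exchange_r sM sL phi_lin Hx).
Qed.

End sigma_nonempty.

Definition Sigma_point (F : finFieldType) (L : Gr0 F) : Sigma_set L :=
  let K := cid (Sigma_nonempty L) in exist _ (sval K) (svalP K).
HB.instance Definition _ (F : finFieldType) (L : Gr0 F) :=
  isPointed.Build (Sigma_set L) (Sigma_point L).

(* The charts with [#|` Omega| = #|` Xi|] lie in [Gr0], so [borel_Gr0] is already
   a sigma-algebra and is not enlarged by [g_sigma_algebraType]. *)
Definition Sigma_incl (F : finFieldType) (L : Gr0 F) (K : Sigma_set L) :
    g_sigma_algebraType (@borel_Gr0 F) :=
  sval K.

Notation Sigma L := (g_sigma_algebra_preimageType (@Sigma_incl _ L)).

Definition stabilizer (F : finFieldType) (L : Gr0 F) :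
    set {linear hspace F -> hspace F} :=
  [set g | GL0 g /\ [set g v | v in (L : set _)] = L].

(* [{K g | K in A}]; an element [g] of the stabilizer of [L] permutes
   [Sigma L]. *)
Definition translate (F : finFieldType) (L : Gr0 F)
    (g : hspace F -> hspace F) (A : set (Sigma L)) : set (Sigma L) :=
  [set K' : Sigma_set L | exists2 K : Sigma_set L, A K &
     Gr0_set (sval K') = [set g v | v in Gr0_set (sval K)]].

Definition stabilizer_invariant (F : finFieldType) (R : realType) (L : Gr0 F)
    (nu : probability (Sigma L) R) : Prop :=
  forall g : {linear hspace F -> hspace F}, stabilizer L g ->
  forall A : set (Sigma L), measurable A -> nu (translate g A) = nu A.

(* Main.v *)
From HB Require Import structures.
From mathcomp Require Import all_boot all_order all_algebra.
From mathcomp Require Import finmap.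
From mathcomp Require Import all_classical all_reals all_analysis.
From mathcomp Require Import ring zify.
Require Import Defs.

Set Implicit Arguments.
Unset Strict Implicit.
Unset Printing Implicit Defensive.

Import Order.TTheory GRing.Theory Num.Theory.
Import numFieldNormedType.Exports.
Local Open Scope classical_set_scope.
Local Open Scope ring_scope.

(** Let V be the direct sum of ell and its topological dual. A neighbour K of L is
    given by the hyperplane K `&` L of L, the line (K + L) / L of V / L, and one
    more parameter in the finite field F. After a bicontinuous change of
    coordinates L is ell (lemma [straighten_Gr0]), and then the neighbours are the
    subspaces
      K(phi, w, c) = {v | v.2 = t w and phi (v.1) = t c for some t in F},
    where phi is a nonzero functional on ell, w a nonzero vector of the dual and c
    a scalar; rescaling (phi, c) or (w, c) does not change K ([neighbour],
    [neighbour_adjacent]).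

    The proof concentrates on the transvections v |-> v + psi(v) y that fix L: those
    with psi(y) = 0 for which y is in L or psi vanishes on L. They belong to the
    stabilizer of L, since their block on ell is a rank one perturbation of the
    identity and has index zero ([transvection_in_stabilizer]).

    Existence. Let the values of phi, the coordinates of w and the scalar c be
    independent and uniform in F. A transvection changes (phi, w, c) by a
    translation that depends only on phi(y) and psi(w), and it preserves these two
    numbers. As the uniform measure is invariant under translations, the law of
    K(phi, w, c) is invariant under transvections ([random_neighbour_invariant]).

    Uniqueness. Let V_m be spanned by e_i for i < m and all the f_j, and U_m by the
    f_j with j >= m, so that V_m / U_m is finite. Neighbours are in the same class of
    level m when their images in V / U_m have the same intersection with V_m / U_m.
    Among the neighbours whose difference with L is seen at level m, transvections
    act transitively on classes, so that an invariant measure gives the same mass to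
    all of them ([measure_by_counting]). The ratios of the masses of sets of finite
    level are thus found by counting; letting m tend to infinity determines the
    measure on a pi-system that generates the Borel sets
    ([transvection_invariant_unique]).

    The whole stabilizer normalises this set of transvections. Hence the translate
    of an invariant measure by an element of the stabilizer is again invariant under
    transvections, and uniqueness shows that it is the same measure
    ([transvection_invariant_stabilizer]).

    Borel sets are handled without charts: the Borel structure is generated by the
    sets of the K that meet a given open set ([Sigma_measurableE]). This makes it
    clear that homeomorphisms act measurably, and reduces the measurability of the
    random neighbour to finitely many coordinates at a time. *)

(** * Codimension and relative dimension *)

Section relative_dimension.
Variables (F : fieldType) (V : lmodType F).
Implicit Types (A B C N : set V).

Definition indep_mod A B n (w : 'I_n -> V) :=
  (forall i, A (w i)) /\
  forall c : 'I_n -> F, B (\sum_(i < n) c i *: w i) -> forall i, c i = 0.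

Definition fin_codim A B := exists n, dim_quot A B n.

Lemma dim_quot_basis A B n : lsubspace A -> lsubspace B -> dim_quot A B n ->
  exists w : 'I_n -> V, indep_mod A B w.
Proof.
move=> sA sB [e [Ae He]]; exists e; split=> // c Bc i.
have [d [_ ud]] := He 0 (proj1 sA).
have d0 : d = [ffun=> 0].
  apply: ud; rewrite big1 ?subr0; first by case: sB.
  by move=> j _; rewrite ffunE scale0r.
have dc : d = [ffun i => - c i].
  apply: ud; rewrite sub0r -sumrN.
  by under eq_bigr => j _ do rewrite ffunE scaleNr opprK.
have := congr1 (fun f : {ffun _ -> _} => f i) (etrans (esym d0) dc).
by rewrite !ffunE => /eqP; rewrite eq_sym oppr_eq0 => /eqP.
Qed.

(** Were there more independent vectors than the dimension, the pigeonhole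
    principle would yield a nontrivial relation between the first [n.+1]. *)
Lemma indep_mod_le A B m n (w : 'I_m -> V) :
  lsubspace B -> dim_quot A B n -> indep_mod A B w -> (m <= n)%N.
Proof.
move=> sB dAB [Aw iw]; rewrite leqNgt; apply/negP => nm.
have [|a a0 Ba] := dim_quot_pigeonhole sB dAB (w := w \o widen_ord nm).
  by move=> j; exact: Aw.
pose c (i : 'I_m) : F :=
  if @insub nat (fun k => (k < n.+1)%N) 'I_n.+1 i is Some j then a 0 j else 0.
have cw j : c (widen_ord nm j) = a 0 j.
  by rewrite /c /= valK.
have : forall i, c i = 0.
  apply: iw; suff -> : \sum_(i < m) c i *: w i =
    \sum_(j < n.+1) a 0 j *: (w \o widen_ord nm) j by [].
  rewrite [LHS](bigID (fun i : 'I_m => (i < n.+1)%N))/= [X in _ + X]big1.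
    rewrite addr0 (big_ord_narrow (F := fun i => c i *: w i) nm)/=.
    by apply: eq_bigr => j _; rewrite cw.
  by move=> i ni; rewrite /c insubN ?scale0r.
move=> c0; move/eqP: a0; apply; apply/rowP => j.
by rewrite -cw c0 mxE.
Qed.

Lemma dim_quot_uniq A B m n : lsubspace A -> lsubspace B ->
  dim_quot A B m -> dim_quot A B n -> m = n.
Proof.
move=> sA sB dm dn; apply/eqP; rewrite eqn_leq.
have [w iw] := dim_quot_basis sA sB dm; have [w' iw'] := dim_quot_basis sA sB dn.
by rewrite (indep_mod_le sB dn iw) (indep_mod_le sB dm iw').
Qed.

(** A maximal independent family is a basis; maximal ones exist as soon as the
    size of independent families is bounded. *)
Lemma fin_codim_bounded A B (bound : nat) : lsubspace A -> lsubspace B ->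
  (forall n (w : 'I_n -> V), indep_mod A B w -> (n <= bound)%N) -> fin_codim A B.
Proof.
move=> sA sB bnd.
pose P n := `[< exists w : 'I_n -> V, indep_mod A B w >].
have exP : exists n, P n.
  exists 0%N; apply/asboolP; exists (fun=> 0); split; first by case.
  by move=> c _ [].
have leP n : P n -> (n <= bound)%N by move=> /asboolP[w /bnd].
case: (ex_maxnP exP leP) => n /asboolP[w [Aw iw]] maxn; exists n, w; split=> //.
move=> x Ax.
have [c Bc] : exists c : {ffun 'I_n -> F}, B (x - \sum_(i < n) c i *: w i).
  apply: contrapT => /forallNP nB.
  suff /maxn : P n.+1 by rewrite ltnn.
  apply/asboolP; exists (fun i => if unlift ord0 i is Some j then w j else x).
  split; first by move=> i; case: unlift.
  move=> c; rewrite big_ord_recl/= unlift_none.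
  under eq_bigr do rewrite liftK.
  move=> Bs.
  have c0 : c ord0 = 0.
    apply/eqP/negPn/negP => c0; apply: (nB [ffun i => - (c ord0)^-1 * c (lift ord0 i)]).
    rewrite [X in B X](_ : _ = (c ord0)^-1 *:
      (c ord0 *: x + \sum_(i < n) c (lift ord0 i) *: w i)).
      exact: lsubspaceZ.
    rewrite scalerDr scalerA mulVf// scale1r scaler_sumr -sumrN; congr (_ + _).
    by apply: eq_bigr => i _; rewrite ffunE mulNr scaleNr opprK scalerA.
  move: Bs; rewrite c0 scale0r add0r => /(iw (c \o lift ord0)) ci i.
  by case: (unliftP ord0 i) => [j ->|->//]; exact: ci.
exists c; split=> // d Bd; apply/ffunP => i.
apply/eqP; rewrite -subr_eq0; apply/eqP; apply: (iw (fun i => c i - d i)).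
rewrite (_ : \sum_(i < n) _ = (x - \sum_(i < n) d i *: w i) -
   (x - \sum_(i < n) c i *: w i)); first exact: lsubspaceB.
under eq_bigr do rewrite scalerBl.
by rewrite sumrB opprB [RHS]addrC addrA subrK.
Qed.

Lemma fin_codim_subl A B C : lsubspace A -> lsubspace B -> lsubspace C ->
  B `<=` A -> fin_codim A C -> fin_codim B C.
Proof.
move=> sA sB sC BA [n dn]; apply: (fin_codim_bounded (bound := n)) => // m w [Bw iw].
by apply: (indep_mod_le sC dn); split; [move=> i; exact/BA/Bw|exact: iw].
Qed.

Lemma fin_codim_subr A B C : lsubspace A -> lsubspace B -> lsubspace C ->
  C `<=` B -> fin_codim A C -> fin_codim A B.
Proof.
move=> sA sB sC CB [n dn]; apply: (fin_codim_bounded (bound := n)) => // m w [Aw iw].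
by apply: (indep_mod_le sC dn); split=> // c /CB; exact: iw.
Qed.

(** Independence in [B] modulo [B `&` C] is independence in [A] modulo [C]. *)
Lemma fin_codimI A B C : lsubspace A -> lsubspace B -> lsubspace C ->
  B `<=` A -> fin_codim A C -> fin_codim B (B `&` C).
Proof.
move=> sA sB sC BA [n dn]; have sBC := lsubspaceI sB sC.
apply: (fin_codim_bounded (bound := n)) => // m w [Bw iw].
apply: (indep_mod_le sC dn); split; first by move=> i; exact/BA/Bw.
by move=> c Cc; apply: iw; split=> //; exact: lsubspace_sum.
Qed.

(** The relative dimension of [A] and [B] is zero. Allowing any common subspace
    [N], and not only the intersection, is what makes chains of comparisons
    easy. *)
Definition same_index A B := exists N n,
  [/\ lsubspace N, N `<=` A, N `<=` B, dim_quot A N n & dim_quot B N n].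

(** The intersection of the two common subspaces has finite codimension in
    [B], and computing that codimension along both of them gives the equality. *)
Lemma same_index_trans A B C : lsubspace A -> lsubspace B -> lsubspace C ->
  same_index A B -> same_index B C -> same_index A C.
Proof.
move=> sA sB sC [N1 [n1 [sN1 N1A N1B dA1 dB1]]] [N2 [n2 [sN2 N2B N2C dB2 dC2]]].
have sN := lsubspaceI sN1 sN2.
have [k1 dk1] := fin_codimI sB sN1 sN2 N1B (ex_intro _ _ dB2).
have [k2 dk2] := fin_codimI sB sN2 sN1 N2B (ex_intro _ _ dB1).
rewrite setIC in dk2.
have N12 : N1 `&` N2 `<=` N1 by move=> ? [].
have N21 : N1 `&` N2 `<=` N2 by move=> ? [].
have e : (n1 + k1 = n2 + k2)%N.
  apply: (dim_quot_uniq sB sN); first exact: dim_quotD dk1.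
  exact: dim_quotD dk2.
exists (N1 `&` N2), (n1 + k1)%N; split=> //.
- by move=> x /N12/N1A.
- by move=> x /N21/N2C.
- exact: dim_quotD dk1.
- by rewrite e; exact: dim_quotD dk2.
Qed.

Lemma same_indexI A B : lsubspace A -> lsubspace B -> same_index A B ->
  exists n, dim_quot A (A `&` B) n /\ dim_quot B (A `&` B) n.
Proof.
move=> sA sB [N [n [sN NA NB dA dB]]]; have sAB := lsubspaceI sA sB.
have NAB : N `<=` A `&` B by move=> x Nx; split; [exact: NA|exact: NB].
have ABA : A `&` B `<=` A by move=> ? [].
have ABB : A `&` B `<=` B by move=> ? [].
have [k dk] := fin_codim_subl sA sAB sN ABA (ex_intro _ _ dA).
have [a da] := fin_codim_subr sA sAB sN NAB (ex_intro _ _ dA).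
have [b db] := fin_codim_subr sB sAB sN NAB (ex_intro _ _ dB).
have ea := dim_quot_uniq sA sN dA (dim_quotD ABA sAB NAB da dk).
have eb := dim_quot_uniq sB sN dB (dim_quotD ABB sAB NAB db dk).
exists a; split=> //; suff -> : a = b by [].
by move: eb; rewrite ea => /addIn.
Qed.

(** Bases modulo [B] often come indexed by a finite set of naturals, with explicit
    coordinate functionals [phi]. *)
Lemma dim_quot_seq A B (s : seq nat) (e : nat -> V) (phi : V -> nat -> F) :
  uniq s -> (forall k, k \in s -> A (e k)) ->
  (forall x c, A x -> B (x - \sum_(k <- s) c k *: e k) <->
     forall k, k \in s -> c k = phi x k) ->
  dim_quot A B (size s).
Proof.
move=> us Ae He; exists (fun i => e (nth 0%N s i)).
split=> [i|x Ax]; first by apply: Ae; exact: mem_nth.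
have sumE (c : nat -> F) : \sum_(k <- s) c k *: e k =
    \sum_(i < size s) c (nth 0%N s i) *: e (nth 0%N s i).
  by rewrite (big_nth 0%N) big_mkord.
exists [ffun i : 'I_(size s) => phi x (nth 0%N s i)]; split.
  under eq_bigr do rewrite ffunE.
  by rewrite -(sumE (phi x)); apply/He.
move=> d Bd; apply/ffunP => i; rewrite ffunE.
pose c k := if insub (index k s) is Some j then d j else 0.
have ci (j : 'I_(size s)) : c (nth 0%N s j) = d j.
  by rewrite /c index_uniq// valK.
rewrite -ci; symmetry; apply: (proj1 (He x c Ax)); last exact: mem_nth.
by rewrite sumE; under eq_bigr do rewrite ci.
Qed.

End relative_dimension.

(** [f] induces an isomorphism from [A / B] to [f A / B']. *)
Lemma dim_quot_image (F : fieldType) (V V' : lmodType F) (f : V -> V')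
    (A B : set V) (B' : set V') n :
  (forall a x y, f (a *: x + y) = a *: f x + f y) -> lsubspace A ->
  (forall x, A x -> B x <-> B' (f x)) ->
  dim_quot A B n -> dim_quot (f @` A) B' n.
Proof.
move=> fL sA BB' [e [Ae He]].
have f0 : f 0 = 0 by have := fL (-1) 0 0; rewrite scaler0 add0r scaleN1r addNr.
have fsum (c : 'I_n -> F) : f (\sum_i c i *: e i) = \sum_i c i *: f (e i).
  rewrite (big_morph f (id1 := 0) (op1 := +%R))//.
    by apply: eq_bigr => i _; have := fL (c i) (e i) 0; rewrite f0 !addr0.
  by move=> x y; have := fL 1 x y; rewrite !scale1r.
have fB x (c : 'I_n -> F) : A x -> B (x - \sum_i c i *: e i) <->
    B' (f x - \sum_i c i *: f (e i)).
  move=> Ax; rewrite BB'; last by apply: lsubspaceB => //; exact: lsubspace_sum.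
  suff -> : f (x - \sum_i c i *: e i) = f x - \sum_i c i *: f (e i) by [].
  by rewrite -fsum addrC -scaleN1r fL scaleN1r addrC.
exists (f \o e); split; first by move=> i; exists (e i).
move=> _ [x Ax <-]; have [c [Bc uc]] := He _ Ax.
by exists c; split=> [|d Bd]; [exact/fB|apply: uc; exact/fB].
Qed.
(** * Charts of the Grassmannian *)

Lemma fset_bound n (A : {fset nat}) :
  exists2 N, (n <= N)%N & forall i, i \in A -> (i < N)%N.
Proof.
exists (foldr maxn n (map S (enum_fset A))) => [|i].
  by elim: (enum_fset A) => //= k l IH; rewrite leq_max IH orbT.
rewrite -[i \in A]/(i \in enum_fset A); elim: (enum_fset A) => //= k l IH.
rewrite inE => /orP[/eqP ->|/IH h]; first exact: leq_maxl.
by rewrite leq_max h orbT.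
Qed.

Section charts.
Variable F : finFieldType.
Implicit Types (x y : hspace F) (Om Xi : {fset nat}).

Lemma hcoord_lin (a : F) x y s : hcoord (a *: x + y) s = a * hcoord x s + hcoord y s.
Proof.
case: s => [i|j] //=.
by rewrite [LHS](coefD (a *: (x.1 : {poly F}))) coefZ.
Qed.

Lemma hcoordD x y s : hcoord (x + y) s = hcoord x s + hcoord y s.
Proof. by rewrite -[x]scale1r hcoord_lin mul1r scale1r. Qed.

Lemma hcoord0 s : hcoord (0 : hspace F) s = 0.
Proof. by case: s => [i|j] //=; rewrite coef0. Qed.

Lemma hcoordZ (a : F) x s : hcoord (a *: x) s = a * hcoord x s.
Proof. by rewrite -[a *: x]addr0 hcoord_lin hcoord0 addr0. Qed.

Lemma hcoordN x s : hcoord (- x) s = - hcoord x s.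
Proof. by rewrite -scaleN1r hcoordZ mulN1r. Qed.

Lemma hcoordB x y s : hcoord (x - y) s = hcoord x s - hcoord y s.
Proof. by rewrite hcoordD hcoordN. Qed.

Lemma hcoord_sum I (r : seq I) (f : I -> hspace F) s :
  hcoord (\sum_(i <- r) f i) s = \sum_(i <- r) hcoord (f i) s.
Proof.
by apply: (big_morph (fun x => hcoord x s)) => [x y|]; [exact: hcoordD|exact: hcoord0].
Qed.

Lemma hcoord_inj x y : hcoord x =1 hcoord y -> x = y.
Proof.
case: x y => [p u] [q v] e; congr (_, _).
  by apply/polyP => i; have := e (inl i).
by apply/funext => j; have := e (inr j).
Qed.

(** The coordinates [c (inl i)] with [N <= i] are cut off, as elements of [ell]
   are finitely supported. *)
Definition hvec N (c : nat + nat -> F) : hspace F :=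
  ((\poly_(i < N) c (inl i) : {poly F}) : ell F, (fun j => c (inr j)) : ell_dual F).

Lemma hcoord_hvec N c s : (forall i, (N <= i)%N -> c (inl i) = 0) ->
  hcoord (hvec N c) s = c s.
Proof.
by case: s => [i|j] //= c0; rewrite coef_poly; case: ltnP => // /c0.
Qed.

Definition hunit (s : nat + nat) : hspace F :=
  hvec (if s is inl i then i.+1 else 0%N) (fun s' => (s' == s)%:R).

Lemma hcoord_hunit s s' : hcoord (hunit s) s' = (s' == s)%:R.
Proof.
rewrite /hunit hcoord_hvec//; case: s => [i|j] k // ik.
by rewrite (_ : _ == _ = false)//; apply/eqP => -[ki]; rewrite ki ltnn in ik.
Qed.

Section one_chart.
Variables (Om Xi : {fset nat}).
Implicit Types (T : chart_matrix F Om Xi).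

Lemma lsubspace_chart_W : lsubspace (@chart_W F Om Xi).
Proof.
split=> [s _|a x y Wx Wy s cs]; first by rewrite hcoord0.
by rewrite hcoord_lin Wx// Wy// mulr0 addr0.
Qed.

Definition chart_part x : hspace F :=
  hvec (size (x.1 : {poly F}))
    (fun s => if chart_index Om Xi s then hcoord x s else 0).

Lemma hcoord_chart_part x s :
  hcoord (chart_part x) s = if chart_index Om Xi s then hcoord x s else 0.
Proof.
rewrite /chart_part hcoord_hvec// => i si; case: ifP => // _ /=.
by rewrite nth_default.
Qed.

(** Extending the entries of [T] by zero to all pairs of indices turns the sums
    over the index types of the chart into sums over initial segments of [nat]. *)
Definition chart_coef T (r s : nat + nat) : F :=
  match insub r, insub s with
  | Some r', Some s' => T (r', s')
  | _, _ => 0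
  end.

Lemma chart_coefE T r s : chart_coef T (val r) (val s) = T (r, s).
Proof. by rewrite /chart_coef !valK. Qed.

Lemma chart_coef_row0 T r s : ~~ chart_index Om Xi r -> chart_coef T r s = 0.
Proof. by move=> cr; rewrite /chart_coef insubN. Qed.

Definition chart_rowsum T N x s : F :=
  \sum_(i < N) (x.1 : {poly F})`_i * chart_coef T (inl (val i)) s +
  \sum_(j <- Xi) x.2 j * chart_coef T (inr j) s.

Lemma fsbig_chart_row T N x (j : chart_col Om Xi) :
  (size (x.1 : {poly F}) <= N)%N ->
  \sum_(i \in [set: chart_row Om Xi]) hcoord x (val i) * (T (i, j) : F) =
  chart_rowsum T N x (val j).
Proof.
move=> xN.
pose l : seq (nat + nat) := [seq inl i | i <- iota 0 N] ++ [seq inr i | i <- enum_fset Xi].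
have ul : uniq l.
  rewrite cat_uniq map_inj_uniq ?iota_uniq ?map_inj_uniq ?fset_uniq/= ?andbT; last 2 first.
  - by move=> ? ? [].
  - by move=> ? ? [].
  by apply/hasPn => _ /mapP[k _ ->]; apply/negP => /mapP[].
pose r : seq (chart_row Om Xi) := pmap insub l.
pose G s := hcoord x s * chart_coef T s (val j).
have -> : \sum_(i \in [set: chart_row Om Xi]) hcoord x (val i) * (T (i, j) : F) =
    \sum_(i <- r) G (val i).
  rewrite -(fsbig_widen [set` r] setT)//=; last first.
    move=> [s cs] [_ /= nr]; apply: contra_notP nr => /eqP.
    rewrite mulf_eq0 => /norP[xs _]; rewrite /r mem_pmap_sub/= /l mem_cat.
    case: s cs xs => [i|k] cs /= xs; apply/orP; [left|right].
      apply: map_f; rewrite mem_iota/= add0n ltnNge.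
      by apply: contra xs => Ni; rewrite nth_default// (leq_trans xN).
    exact: map_f.
  rewrite -fsbig_seq ?pmap_sub_uniq//; apply: eq_bigr => i _.
  by rewrite /G chart_coefE.
rewrite -(big_map val xpredT G) /r.
rewrite (_ : map _ _ = [seq s <- l | chart_index Om Xi s]); last first.
  by rewrite (pmap_filter (insubK _)); apply: seq.eq_filter => s; rewrite isSome_insub.
rewrite big_filter big_mkcond/= (eq_bigr G); last first.
  by move=> s _; case: ifPn => // cs; rewrite /G chart_coef_row0 ?mulr0.
rewrite /l big_cat/= !big_map /chart_rowsum; congr (_ + _).
by rewrite -[N in LHS]subn0 -/(index_iota 0 N) big_mkord.
Qed.

Lemma chart_rowsum_lin T N (a : F) x y s :
  chart_rowsum T N (a *: x + y) s =
  a * chart_rowsum T N x s + chart_rowsum T N y s.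
Proof.
rewrite /chart_rowsum mulrDr addrACA !mulr_sumr -!big_split/=; congr (_ + _).
  apply: eq_bigr => i _.
  by rewrite [X in X * _ = _](hcoord_lin a x y (inl (val i))) /= mulrDl mulrA.
by apply: eq_bigr => i _; rewrite [X in X * _ = _](hcoord_lin a x y (inr i)) /= mulrDl mulrA.
Qed.

(** A graph over [chart_V] is cut out by linear equations between coordinates,
    one for each index of [chart_W]. *)
Lemma chart_graphP T N x : (size (x.1 : {poly F}) <= N)%N ->
  chart_graph T x <-> forall s, ~~ chart_index Om Xi s ->
    hcoord x s = chart_rowsum T N x s.
Proof.
move=> xN; split.
  move=> [v [w [Vv Ww Hw xvw]]] s cs.
  have rowE r : chart_index Om Xi r -> hcoord x r = hcoord v r.
    by move=> cr; rewrite xvw hcoordD Ww// addr0.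
  have -> : hcoord x s = hcoord w (val (exist _ s cs : chart_col Om Xi)).
    by rewrite xvw hcoordD Vv// add0r.
  rewrite Hw -(@fsbig_chart_row T N x (exist _ s cs))//.
  by apply: eq_fsbigr => -[r cr] _ /=; rewrite rowE.
move=> Hx; exists (chart_part x), (x - chart_part x); split.
- by move=> s cs; rewrite hcoord_chart_part (negbTE cs).
- by move=> s cs; rewrite hcoordB hcoord_chart_part cs subrr.
- move=> [s cs] /=; rewrite hcoordB hcoord_chart_part (negbTE cs) subr0 Hx//.
  rewrite -(@fsbig_chart_row T N x (exist _ s cs))//.
  by apply: eq_fsbigr => -[r cr] _ /=; rewrite hcoord_chart_part cr.
- by rewrite addrC subrK.
Qed.

Lemma lsubspace_chart_graph T : lsubspace (chart_graph T).
Proof.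
split.
  apply/(@chart_graphP T 0); first by rewrite size_poly0.
  move=> s _; rewrite hcoord0 /chart_rowsum big_ord0 add0r big1// => j _.
  by rewrite [X in X * _](hcoord0 (inr j)) mul0r.
move=> a x y Kx Ky; pose N := maxn (size ((a *: x + y).1 : {poly F}))
  (maxn (size (x.1 : {poly F})) (size (y.1 : {poly F}))).
have h1 : (size (x.1 : {poly F}) <= N)%N by rewrite /N !leq_max leqnn !orbT.
have h2 : (size (y.1 : {poly F}) <= N)%N by rewrite /N !leq_max leqnn !orbT.
apply/(@chart_graphP T N); first exact: leq_maxl.
move=> s cs; rewrite chart_rowsum_lin hcoord_lin.
by rewrite (proj1 (chart_graphP T h1) Kx)// (proj1 (chart_graphP T h2) Ky).
Qed.

Definition transversal (K : set (hspace F)) :=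
  (forall x, K x -> chart_W Om Xi x -> x = 0) /\
  (forall x, exists2 k, K k & chart_W Om Xi (x - k)).

Lemma chart_graph_rep T x : exists2 k, chart_graph T k & chart_W Om Xi (x - k).
Proof.
pose v := chart_part x.
have sv : (size (v.1 : {poly F}) <= size (x.1 : {poly F}))%N by exact: size_poly.
have [N Nx NO] := fset_bound (size (x.1 : {poly F})) Om.
pose k := hvec N (fun s => if chart_index Om Xi s then hcoord x s
  else chart_rowsum T N x s).
have kE s : hcoord k s = if chart_index Om Xi s then hcoord x s
  else chart_rowsum T N x s.
  rewrite hcoord_hvec//= => i Ni; case: ifPn => [_|/negPn/NO].
    by rewrite nth_default// (leq_trans Nx).
  by rewrite ltnNge Ni.
exists k; last by move=> s cs; rewrite hcoordB kE cs subrr.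
apply/(@chart_graphP T N); first exact: size_poly.
move=> s cs; rewrite kE (negbTE cs) /chart_rowsum; congr (_ + _).
  apply: eq_bigr => i _; rewrite [_`_i in RHS](kE (inl (val i))).
  by case: ifPn => // ci; rewrite chart_coef_row0 ?mulr0.
by apply: eq_big_seq => j jX; rewrite [k.2 j](kE (inr j)) ifT.
Qed.

Lemma chart_graph_transversal T : transversal (chart_graph T).
Proof.
split; last exact: chart_graph_rep.
move=> x Kx Wx; apply: hcoord_inj => s; rewrite hcoord0.
have [cs|cs] := boolP (chart_index Om Xi s); first exact: Wx.
rewrite (proj1 (chart_graphP T (leqnn _)) Kx)//.
rewrite /chart_rowsum !big1 ?addr0//.
  by move=> j _; have [cj|cj] := boolP (chart_index Om Xi (inr j));
    [rewrite [X in X * _](Wx _ cj) mul0r|rewrite chart_coef_row0 ?mulr0].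
by move=> j _; have [cj|cj] := boolP (chart_index Om Xi (inl (val j)));
    [rewrite [X in X * _](Wx _ cj) mul0r|rewrite chart_coef_row0 ?mulr0].
Qed.

(** The entries of [T] can be read off the vectors of the graph that project to
    the basis vectors of [chart_V]. *)
Lemma chart_graph_row T (r : chart_row Om Xi) k :
  chart_graph T k -> chart_W Om Xi (hunit (val r) - k) ->
  forall j : chart_col Om Xi, hcoord k (val j) = T (r, j).
Proof.
move=> Kk Wk j; have kE s : chart_index Om Xi s -> hcoord k s = (s == val r)%:R.
  move=> /Wk; rewrite hcoordB hcoord_hunit => /eqP; rewrite subr_eq0.
  by move=> /eqP ->.
rewrite (proj1 (chart_graphP T (leqnn _)) Kk); last exact: (valP j).
rewrite -fsbig_chart_row//.
rewrite -(fsbig_widen [set r] setT)//=; last first.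
  move=> r' [_ /= nr]; rewrite kE ?(valP r')// (inj_eq val_inj).
  by rewrite (_ : _ == _ = false) ?mul0r//; apply/eqP.
by rewrite fsbig_set1 kE ?(valP r)// eqxx mul1r.
Qed.

(** The projection to [chart_V] along [chart_W] is invertible on [K], and the
    images of the basis vectors under its inverse give the rows of the matrix. *)
Lemma transversal_chart_graph K : lsubspace K -> transversal K ->
  exists T : chart_matrix F Om Xi, K = chart_graph T.
Proof.
move=> sK [K0 KW].
have /choice[k Hk] (r : chart_row Om Xi) : exists k, K k /\ chart_W Om Xi (hunit (val r) - k).
  by have [k ? ?] := KW (hunit (val r)); exists k.
have kE r s : chart_index Om Xi s -> hcoord (k r) s = (s == val r)%:R.
  move=> /(proj2 (Hk r)); rewrite hcoordB hcoord_hunit => /eqP; rewrite subr_eq0.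
  by move=> /eqP ->.
pose T : chart_matrix F Om Xi := fun rs => hcoord (k rs.1) (val rs.2).
exists T.
have [/= G0 GW] := chart_graph_transversal T; have sG := lsubspace_chart_graph T.
pose kk s := if insub s is Some r then k r else 0.
have Kkk s : K (kk s).
  by rewrite /kk; case: insubP => [r _ _|_]; [case: (Hk r)|case: sK].
pose comb x : hspace F := \sum_(i < size (x.1 : {poly F})) (x.1 : {poly F})`_i *: kk (inl (val i)) +
   \sum_(j <- Xi) x.2 j *: kk (inr j).
have Kcomb x : K (comb x).
  apply: lsubspaceD => //; first by exact: lsubspace_sum.
  by elim/big_rec: _ => [|j y _ Ky]; [case: sK|have [_ h] := sK; apply: h].
have kkE r s : ~~ chart_index Om Xi s -> hcoord (kk r) s = chart_coef T r s.
  move=> cs; rewrite /kk /chart_coef; case: insubP => [r' _ _|_].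
    by rewrite insubT.
  by rewrite hcoord0.
have kkV r s : chart_index Om Xi s -> hcoord (kk r) s =
    if chart_index Om Xi r then (s == r)%:R else 0.
  move=> cs; rewrite /kk; case: insubP => [r' -> <-|/negbTE ->]; first by rewrite kE.
  by rewrite hcoord0.
have combE x s : ~~ chart_index Om Xi s ->
    hcoord (comb x) s = chart_rowsum T (size (x.1 : {poly F})) x s.
  move=> cs; rewrite /comb hcoordD !hcoord_sum /chart_rowsum.
  by congr (_ + _); apply: eq_bigr => i _; rewrite hcoordZ kkE.
have combV x s : chart_index Om Xi s -> hcoord (comb x) s = hcoord x s.
  move=> cs; rewrite /comb hcoordD !hcoord_sum.
  case: s cs => [i|j] cs.
    rewrite [X in _ + X]big1 ?addr0; last first.
      by move=> j _; rewrite hcoordZ kkV//; case: ifP; rewrite mulr0.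
    have [ix|xi] := ltnP i (size (x.1 : {poly F})).
      rewrite (big_only1 (Ordinal ix))// => [|k' k'i _].
        by rewrite hcoordZ kkV// -[val (Ordinal ix)]/i cs eqxx mulr1.
      rewrite hcoordZ kkV// (_ : _ == _ = false) ?if_same ?mulr0//.
      by apply: contraNF k'i => /eqP[e]; apply/eqP/val_inj; rewrite /= -e.
    rewrite big1 => [|k' _]; first by rewrite /= nth_default.
    rewrite hcoordZ kkV// (_ : _ == _ = false) ?if_same ?mulr0//.
    by apply/eqP => -[e]; move: (ltn_ord k'); rewrite -e ltnNge xi.
  rewrite big1 ?add0r; last first.
    by move=> i _; rewrite hcoordZ kkV//; case: ifP; rewrite mulr0.
  rewrite (bigD1_seq j cs (fset_uniq Xi)) big1 => [|k' k'i].
    by rewrite Monoid.mulm1 hcoordZ kkV// cs eqxx mulr1.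
  rewrite hcoordZ kkV// (_ : _ == _ = false) ?if_same ?mulr0//.
  by apply: contraNF k'i => /eqP[->].
apply/seteqP; split=> x.
  move=> Kx; apply/(chart_graphP T (leqnn _)) => s cs; rewrite -combE//.
  congr (hcoord _ s); apply/eqP; rewrite -subr_eq0; apply/eqP; apply: K0.
    exact: lsubspaceB.
  by move=> r cr; rewrite hcoordB combV// subrr.
move=> /(chart_graphP T (leqnn _)) Hx.
suff -> : x = comb x by [].
apply: hcoord_inj => s; have [cs|cs] := boolP (chart_index Om Xi s).
  by rewrite combV.
by rewrite combE// Hx.
Qed.

Lemma chart_graph_inj T T' : chart_graph T = chart_graph T' -> T = T'.
Proof.
move=> TT'; apply/funext => -[r j].
have [k Kk Wk] := chart_graph_rep T (hunit (val r)).
by rewrite -(chart_graph_row Kk Wk) -(chart_graph_row (T := T') _ Wk)// -TT'.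
Qed.

End one_chart.
End charts.
(** * Membership in the Grassmannian *)

Section Gr0_criteria.
Variable F : finFieldType.
Implicit Types (K L : set (hspace F)) (Om Xi : {fset nat}).

Lemma is_Gr0P K : is_Gr0 K <->
  lsubspace K /\ exists T : nat -> nat -> F, same_index (graph T) K.
Proof.
split.
  move=> [[sK _] [T [n [dT dK]]]]; split=> //; exists T, (graph T `&` K), n.
  by split=> //; apply: lsubspaceI => //; exact: lsubspace_graph.
move=> [sK [T ind]]; have [n [dT dK]] := same_indexI (lsubspace_graph T) sK ind.
split; last by exists T, n.
by split=> //; exists T; split; exists n.
Qed.

Lemma adjacent_same_index K L : lsubspace K -> lsubspace L ->
  dim_quot L (L `&` K) 1 -> dim_quot K (L `&` K) 1 -> same_index L K.
Proof.
move=> sK sL dL dK; exists (L `&` K), 1%N.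
by split=> //; exact: lsubspaceI.
Qed.

Lemma is_Gr0_adjacent K L : is_Gr0 L -> lsubspace K ->
  dim_quot L (L `&` K) 1 -> dim_quot K (L `&` K) 1 -> is_Gr0 K.
Proof.
move=> /is_Gr0P[sL [T ind]] sK dL dK; apply/is_Gr0P; split=> //; exists T.
apply: (same_index_trans (lsubspace_graph T) sL sK) => //.
exact: adjacent_same_index.
Qed.

(** Zeroing the entries of [T] outside the rows [e_i] and the columns [f_j]
    gives an element of the big cell; it shares with the chart element the
    vectors without [f_j]-coordinates for [j] in [Xi], a subspace of
    codimension [#|Xi|] in one of them and [#|Omega|] in the other. *)
Lemma is_Gr0_chart_graph Om Xi (T : chart_matrix F Om Xi) :
  #|` Om| = #|` Xi| -> is_Gr0 (chart_graph T).
Proof.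
move=> OX; apply/is_Gr0P; split; first exact: lsubspace_chart_graph.
pose T' i j := chart_coef T (inl i) (inr j); exists T'.
have sK := lsubspace_chart_graph T.
pose N := chart_graph T `&` [set x : hspace F | forall j, j \in Xi -> x.2 j = 0].
have sN : lsubspace N.
  apply: lsubspaceI => //; split=> // a x y Hx Hy j jX.
  by rewrite [LHS](hcoord_lin a x y (inr j))/= Hx// Hy// mulr0 addr0.
have colP j : (j \notin Xi) = ~~ chart_index Om Xi (inr j) by [].
have graphE (x : hspace F) n : (size (x.1 : {poly F}) <= n)%N -> graph T' x <->
    forall j, x.2 j = \sum_(i < n) (x.1 : {poly F})`_i * T' (val i) j.
  move=> xn; split; first by move=> [v _ xv] j; move: xn; rewrite -xv /= => /mulvT_coef ->.
  by case: x xn => p u /= xn xE; exists p => //=; rewrite (mulvT_coef _ xn); congr (_, _);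
    apply/funext => j; rewrite xE.
have T'0 i j : j \in Xi -> T' i j = 0.
  by move=> jX; rewrite /T' /chart_coef (insubN _ (x := inr j)) /= ?jX//; case: insub.
have rowN (x : hspace F) n s : (forall j, j \in Xi -> x.2 j = 0) -> chart_rowsum T n x s =
    \sum_(i < n) (x.1 : {poly F})`_i * chart_coef T (inl (val i)) s.
  move=> x0; rewrite /chart_rowsum [X in _ + X]big_seq [X in _ + X]big1 ?addr0// => j jX.
  by rewrite x0 ?mul0r.
have N1 : N `<=` graph T'.
  move=> x [Kx x0]; apply/(graphE x _ (leqnn _)) => j.
  have [jX|jX] := boolP (j \in Xi).
    by rewrite x0// big1// => i _; rewrite T'0 ?mulr0.
  by rewrite -rowN//; apply: (proj1 (chart_graphP T (leqnn _)) Kx (inr j)); rewrite -colP.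
exists N, (size (enum_fset Xi)); split=> //; first by move=> ? [].
- rewrite (_ : size _ = size (enum_fset Om)); last by exact: esym OX.
  pose e i : hspace F := hunit F (inl i).
  have e1 i k : ((e i).1 : {poly F})`_k = (k == i)%:R.
    by rewrite [LHS](hcoord_hunit F (inl i) (inl k)).
  have e2 i j : (e i).2 j = 0 by rewrite [LHS](hcoord_hunit F (inl i) (inr j)).
  pose phi (x : hspace F) k : F := (x.1 : {poly F})`_k - \sum_(i < size (x.1 : {poly F}))
     (x.1 : {poly F})`_i * chart_coef T (inl (val i)) (inl k).
  have T'row i j : i \in Om -> T' i j = 0.
    by move=> iO; rewrite /T' chart_coef_row0//= iO.
  apply: (@dim_quot_seq _ _ _ _ _ e phi) => //.
  + exact: fset_uniq.
  + move=> i iO; apply/(graphE _ _ (leqnn _)) => j; rewrite e2 big1// => k _.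
    rewrite e1; case: eqP => [ki|_]; last by rewrite mul0r.
    by rewrite (_ : \val k = i)// T'row// mulr0.
  + move=> x c Gx; set y := x - _.
    have y2 j : y.2 j = x.2 j.
      rewrite [LHS](hcoordB x _ (inr j)) hcoord_sum big1 ?subr0// => k _.
      by rewrite hcoordZ hcoord_hunit mulr0.
    have y1 i : (y.1 : {poly F})`_i = (x.1 : {poly F})`_i - if i \in Om then c i else 0.
      rewrite [LHS](hcoordB x _ (inl i)) hcoord_sum; congr (_ - _).
      under eq_bigr do rewrite hcoordZ hcoord_hunit.
      case: ifPn => iO.
        rewrite (bigD1_seq i iO (fset_uniq Om)) big1 => [|k ki].
          by rewrite Monoid.mulm1 eqxx mulr1.
        by rewrite (_ : _ == _ = false) ?mulr0//; apply: contraNF ki => /eqP[->].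
      rewrite big_seq big1// => k kO.
      rewrite (_ : _ == _ = false) ?mulr0//; apply: contraNF iO => /eqP[->].
      exact: kO.
    have x0 j : j \in Xi -> x.2 j = 0.
      move=> jX; rewrite (proj1 (graphE _ _ (leqnn _)) Gx) big1// => i _.
      by rewrite T'0 ?mulr0.
    pose n := maxn (size (y.1 : {poly F})) (size (x.1 : {poly F})).
    have yn : (size (y.1 : {poly F}) <= n)%N by exact: leq_maxl.
    have xn : (size (x.1 : {poly F}) <= n)%N by exact: leq_maxr.
    have rowE s : chart_rowsum T n y s = \sum_(i < size (x.1 : {poly F}))
       (x.1 : {poly F})`_i * chart_coef T (inl (val i)) s.
      rewrite rowN; last by move=> j jX; rewrite y2 x0.
      have -> : \sum_(i < n) (y.1 : {poly F})`_i * chart_coef T (inl (val i)) s =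
         \sum_(i < n) (x.1 : {poly F})`_i * chart_coef T (inl (val i)) s.
        apply: eq_bigr => i _; rewrite y1; case: ifPn => iO; last by rewrite subr0.
        by rewrite chart_coef_row0 ?mulr0//= iO.
      rewrite (big_ord_widen_cond n xpredT (fun i => (x.1 : {poly F})`_i * chart_coef T (inl i) s) xn).
      rewrite [LHS](bigID (fun i : 'I_n => (i < size (x.1 : {poly F}))%N))/=.
      rewrite [X in _ + X]big1 ?addr0// => i; rewrite -leqNgt => xi.
      by rewrite nth_default ?mul0r.
    split.
      move=> [Ky _] k kO; have cs : ~~ chart_index Om Xi (inl k) by rewrite /= kO.
      have := proj1 (chart_graphP T yn) Ky _ cs; rewrite rowE /= y1 kO => e'.
      by rewrite /phi -e' subKr.
    move=> cE; split; last by move=> j jX; rewrite [LHS]y2 x0.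
    apply/(chart_graphP T yn) => -[k|j] cs; rewrite rowE /=.
      rewrite y1; have kO : k \in Om by move: cs => /=; rewrite negbK.
      by rewrite kO cE// /phi subKr.
    by rewrite [LHS]y2 (proj1 (graphE _ _ (leqnn _)) Gx).
- have /choice[e He] (s : nat + nat) : exists k, chart_graph T k /\ chart_W Om Xi (hunit F s - k).
    by have [k ? ?] := chart_graph_rep T (hunit F s); exists k.
  have eV s r : chart_index Om Xi r -> hcoord (e s) r = (r == s)%:R.
    move=> /(proj2 (He s)); rewrite hcoordB hcoord_hunit => /eqP.
    by rewrite subr_eq0 => /eqP ->.
  apply: (@dim_quot_seq _ _ _ _ _ (fun j => e (inr j)) (fun x j => x.2 j)) => //.
  + exact: fset_uniq.
  + by move=> j _; case: (He (inr j)).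
  + move=> x c Kx; set y := x - _.
    have Ky : chart_graph T y.
      apply: lsubspaceB => //; elim/big_rec: _ => [|k z _ Kz]; first by case: sK.
      by apply: lsubspaceD => //; apply: lsubspaceZ => //; case: (He (inr k)).
    have y2 j : j \in Xi -> y.2 j = x.2 j - c j.
      move=> jX; rewrite [LHS](hcoordB x _ (inr j)) hcoord_sum; congr (_ - _).
      under eq_bigr do rewrite hcoordZ eV//.
      rewrite (bigD1_seq j jX (fset_uniq Xi)) big1 => [|k ki].
        by rewrite Monoid.mulm1 eqxx mulr1.
      by rewrite (_ : _ == _ = false) ?mulr0//; apply: contraNF ki => /eqP[->].
    split=> [[_ y0] j jX|cE].
      by apply/esym/eqP; rewrite -subr_eq0 -y2//; apply/eqP/y0.
    by split=> // j jX; rewrite [LHS]y2// cE// subrr.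
Qed.

End Gr0_criteria.

Section pivots.
Variables (F : fieldType) (V : lmodType F).
Implicit Types (D P : set V).

(** Gaussian elimination: a [d]-dimensional space separated by coordinates [f]
    is parametrised by [d] of them. *)
Lemma coordinate_pivots (f : nat -> V -> F) D d :
  (forall j a x y, f j (a *: x + y) = a * f j x + f j y) ->
  lsubspace D -> (forall x, D x -> (forall j, f j x = 0) -> x = 0) ->
  dim_quot D [set 0] d ->
  exists2 S : {fset nat}, #|` S| = d &
    (forall x, D x -> (forall j, j \in S -> f j x = 0) -> x = 0) /\
    (forall a : nat -> F, exists2 x, D x & forall j, j \in S -> f j x = a j).
Proof.
move=> fL.
have s0 : lsubspace [set (0 : V)] by split=> // a _ _ -> ->; rewrite scaler0 addr0.
have f0 j : f j 0 = 0 by have := fL j (-1) 0 0; rewrite scaler0 addr0 mulN1r addNr.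
elim: d D => [|d IH] D sD sep dD.
  exists fset0; rewrite ?cardfs0//; split=> [x Dx _|a]; last first.
    by exists 0 => //; case: sD.
  by have [e [_ He]] := dD; have [c [+ _]] := He _ Dx; rewrite big_ord0 subr0.
have [x Dx [j fx]] : exists2 x, D x & exists j, f j x != 0.
  have [w [Dw iw]] := dim_quot_basis sD s0 dD; exists (w ord0) => //.
  apply: contrapT => /forallNP nf.
  have w0 : w ord0 = 0 by apply: sep => // j; apply/eqP/negPn/negP/nf.
  have : forall i, (i == ord0 :> 'I_d.+1)%:R = 0 :> F.
    apply: iw; rewrite /= big1// => i _.
    by case: eqP => [->|_]; rewrite ?w0 ?scaler0 ?scale0r.
  by move=> /(_ ord0)/eqP; rewrite eqxx oner_eq0.
pose D' := D `&` [set y | f j y = 0].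
have sD' : lsubspace D'.
  by apply: lsubspaceI => //; split=> [|a y z /= fy fz]; rewrite /= ?fL ?fy ?fz ?mulr0 ?addr0.
have D'D : D' `<=` D by move=> ? [].
have fZ a y z : f j (y - a *: z) = f j y - a * f j z.
  by rewrite addrC -scaleNr fL mulNr addrC.
have dD1 : dim_quot D D' 1.
  apply: (dim_quot1 (u := x) (phi := fun y => f j y / f j x)) => //.
    move=> y Dy; split; first by apply: lsubspaceB => //; exact: lsubspaceZ.
    by rewrite /= fZ divfK// subrr.
  move=> y c Dy [_ /= /eqP]; rewrite fZ subr_eq0 => /eqP ->.
  by rewrite mulfK.
have zD' : [set 0] `<=` D' by move=> _ ->; case: sD'.
have [d' dD'] := fin_codim_subl sD sD' s0 D'D (ex_intro _ _ dD).
have := dim_quot_uniq sD s0 dD (dim_quotD D'D sD' zD' dD1 dD').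
rewrite add1n => -[dd']; rewrite -dd' in dD'.
have [S cS [S0 Sa]] := IH D' sD' (fun y D'y => sep y (D'D y D'y)) dD'.
have jS : j \notin S.
  apply/negP => jS; have [y [_ /= fy] /(_ _ jS)] := Sa (fun=> 1).
  by rewrite fy => /eqP; rewrite eq_sym oner_eq0.
exists (j |` S)%fset; first by rewrite cardfsU1 jS cS.
split=> [y Dy fy|a].
  have D'y : D' y by split=> //; rewrite /= fy// fset1U1.
  by apply: S0 => // k kS; rewrite fy// fset1Ur.
pose t := a j / f j x.
have [y [Dy /= fy] ya] := Sa (fun k => a k - t * f k x).
exists (t *: x + y).
  by apply: lsubspaceD => //; exact: lsubspaceZ.
move=> k; rewrite fL !inE => /orP[/eqP ->|kS].
  by rewrite fy addr0 /t divfK.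
by rewrite ya// addrC subrK.
Qed.

(** Steinitz exchange: a subspace of codimension [d] is complemented by [d]
    members of a spanning family [e]. *)
Lemma complement_pivots (e : nat -> V) P d :
  (forall M, lsubspace M -> (forall i, M (e i)) -> M = setT) ->
  lsubspace P -> dim_quot setT P d ->
  exists2 S : {fset nat}, #|` S| = d &
    (forall x, exists2 a : nat -> F, True & P (x - \sum_(i <- S) a i *: e i)) /\
    (forall a : nat -> F, P (\sum_(i <- S) a i *: e i) ->
       forall i, i \in S -> a i = 0).
Proof.
move=> span.
have sT : lsubspace [set: V] by [].
elim: d P => [|d IH] P sP dP.
  exists fset0; rewrite ?cardfs0//; split=> [x|a _ i //].
  have [e' [_ He]] := dP; have [c [+ _]] := He x I; rewrite big_ord0 => Px.
  by exists (fun=> 0) => //; rewrite big_seq_fset0.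
have [i Pi] : exists i, ~ P (e i).
  apply: contrapT => /forallNP nP.
  have PT : P = setT by apply: span => // i; apply: contrapT; exact: nP.
  have d0 := dim_quot_refl P; rewrite {1}PT in d0.
  by have := dim_quot_uniq sT sP dP d0.
pose P' := [set x | exists a, P (x - a *: e i)].
have PP' : P `<=` P' by move=> x Px; exists 0; rewrite scale0r subr0.
have sP' : lsubspace P'.
  split; first by apply: PP'; case: sP.
  move=> a x y [b Pb] [c Pc]; exists (a * b + c).
  rewrite scalerDl opprD addrACA -scalerA -scalerBr.
  by case: sP => _; apply.
have nz a : P (a *: e i) -> a = 0.
  move=> Pa; apply: contrapT => /eqP a0; apply: Pi.
  by rewrite -[e i](scalerK a0); exact: lsubspaceZ.
have dP1 : dim_quot P' P 1.
  have /choice[phi Hphi] : forall x, exists a, P' x -> P (x - a *: e i).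
    by move=> x; have [[a Pa]|nP] := pselect (P' x); [exists a|exists 0].
  apply: (dim_quot1 (u := e i) (phi := phi)) => //.
    by exists 1; rewrite scale1r subrr; case: sP.
  move=> x c P'x Pc; apply/eqP; rewrite -subr_eq0; apply/eqP/nz.
  rewrite (_ : _ *: _ = (x - phi x *: e i) - (x - c *: e i)).
    by apply: lsubspaceB => //; exact: Hphi.
  by rewrite scalerBl opprB [RHS]addrC addrA subrK.
have [d' dP'] := fin_codim_subr sT sP' sP PP' (ex_intro _ _ dP).
have P'T : P' `<=` setT by [].
have := dim_quot_uniq sT sP dP (dim_quotD P'T sP' PP' dP' dP1).
rewrite addn1 => -[dd']; rewrite -dd' in dP'.
have [S cS [Sx Sa]] := IH P' sP' dP'.
have P'i : P' (e i) by exists 1; rewrite scale1r subrr; case: sP.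
have iS : i \notin S.
  apply/negP => iS; suff /(_ _ iS)/eqP : forall k, k \in S -> (k == i)%:R = 0 :> F.
    by rewrite eqxx oner_eq0.
  apply: Sa; rewrite (bigD1_seq i iS (fset_uniq S)) big1 => [|k /negbTE ->].
    by rewrite Monoid.mulm1 eqxx scale1r.
  by rewrite scale0r.
exists (i |` S)%fset; first by rewrite cardfsU1 iS cS.
have bigE (a : nat -> F) : \sum_(k <- (i |` S)%fset) a k *: e k =
    a i *: e i + \sum_(k <- S) a k *: e k.
  by rewrite big_fsetU1.
split=> [x|a].
  have [a _ [b Pb]] := Sx x.
  exists (fun k => if k == i then b else a k) => //.
  rewrite bigE eqxx opprD addrA addrAC.
  rewrite (_ : \sum_(k <- S) _ = \sum_(k <- S) a k *: e k)//.
  apply: eq_big_seq => k kS; case: eqP => // ki.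
  by rewrite -ki kS in iS.
rewrite bigE => Pa.
have aS k : k \in S -> a k = 0.
  apply: Sa; exists (- a i); rewrite scaleNr opprK addrC; exact: Pa.
have ai : a i = 0.
  apply: nz; move: Pa; rewrite [X in _ + X]big_seq [X in _ + X]big1 ?addr0//.
  by move=> k kS; rewrite aS ?scale0r.
by move=> k; rewrite !inE => /orP[/eqP ->//|/aS].
Qed.

End pivots.
Section covering.
Variable F : finFieldType.
Implicit Types (K L : set (hspace F)) (Om Xi : {fset nat}).

(** Let [K] have relative dimension zero with respect to a graph. Then the kernel
    of the projection of [K] to [ell] and the cokernel have the same dimension;
    [Xi] is given by pivots of the kernel, [Om] by a complement of the image. *)
Lemma Gr0_transversal K : is_Gr0 K ->
  exists Om Xi : {fset nat}, #|` Om| = #|` Xi| /\ transversal Om Xi K.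
Proof.
move=> /is_Gr0P[sK [T [N [n [sN NT NK dT dK]]]]].
have sG := lsubspace_graph T.
pose PN : set (ell F) := fst @` N; pose PK : set (ell F) := fst @` K.
have fstL (a : F) (x y : hspace F) : (a *: x + y).1 = a *: x.1 + y.1 by [].
have s_image (A : set (hspace F)) : lsubspace A -> lsubspace (fst @` A : set (ell F)).
  move=> sA; split; first by exists 0 => //; case: sA.
  move=> a _ _ [x Ax <-] [y Ay <-]; exists (a *: x + y) => //.
  by case: sA => _; apply.
have sPN := s_image _ sN; have sPK := s_image _ sK.
have graph1 x y : graph T x -> graph T y -> x.1 = y.1 -> x = y.
  by move=> [p _ <-] [q _ <-] /= ->.
have s1 (A : set (ell F)) : lsubspace A -> lsubspace [set x : hspace F | A x.1].
  by move=> sA; split=> [|a x y Ax Ay]; [case: sA|case: sA => _; apply].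
pose N' := K `&` [set x : hspace F | PN x.1].
have sN' : lsubspace N' by apply: lsubspaceI => //; exact: s1.
have N'K : N' `<=` K by move=> ? [].
have NN' : N `<=` N' by move=> x Nx; split; [exact: NK|exists x].
pose D := K `&` [set x : hspace F | x.1 = 0].
have s0e : lsubspace [set (0 : ell F)].
  by split=> // a _ _ -> ->; rewrite scaler0 addr0.
have sD : lsubspace D by apply: lsubspaceI => //; exact: (s1 [set 0]).
have DK : D `<=` K by move=> ? [].
have DN0 x : D x -> N x -> x = 0.
  move=> [_ /= x1] Nx; apply: (graph1 _ _ (NT _ Nx)); first by case: sG.
  by rewrite x1.
have DN : D `&` N = [set 0].
  apply/seteqP; split=> [x [Dx Nx]|_ ->]; first exact: DN0.
  by split; [case: sD|case: sN].
have [d dD] := fin_codimI sK sD sN DK (ex_intro _ _ dK); rewrite DN in dD.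
have dN'N : dim_quot N' N d.
  have [e [De He]] := dD; exists e; split.
    move=> i; have [Ke e0] := De i; split=> //=.
    by rewrite e0; case: sPN.
  move=> x [Kx [y Ny yx]].
  have Dxy : D (x - y).
    split; first by apply: lsubspaceB => //; exact: NK.
    by rewrite /= -yx subrr.
  have key (c : 'I_d -> F) : N (x - \sum_i c i *: e i) <-> x - y - \sum_i c i *: e i = 0.
    split=> [Nc|/eqP].
      apply: DN0; first by apply: lsubspaceB => //; exact: lsubspace_sum.
      by rewrite addrAC; exact: lsubspaceB.
    by rewrite addrAC subr_eq0 => /eqP ->.
  have [c [c0 uc]] := He _ Dxy.
  by exists c; split=> [|c' /key]; [exact/key|exact: uc].
have [a da] := fin_codim_subr sK sN' sN NN' (ex_intro _ _ dK).
have adn := dim_quot_uniq sK sN dK (dim_quotD N'K sN' NN' da dN'N).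
have daP : dim_quot PK PN a.
  by apply: (dim_quot_image fstL sK _ da) => x Kx; split=> [[]|].
have dTP : dim_quot setT PN n.
  have -> : [set: ell F] = fst @` graph T.
    by apply/seteqP; split=> // p _; exists (p, mulvT p T) => //; exists p.
  apply: (dim_quot_image fstL sG _ dT) => x Gx; split=> [Nx|[y Ny yx]].
    by exists x.
  by rewrite (graph1 x y)//; exact: NT.
have sT : lsubspace [set: ell F] by [].
have PNK : PN `<=` PK by move=> _ [x Nx <-]; exists x => //; exact: NK.
have PKT : PK `<=` setT by [].
have [b db] := fin_codim_subr sT sPK sPN PNK (ex_intro _ _ dTP).
have ban := dim_quot_uniq sT sPN dTP (dim_quotD PKT sPK PNK db daP).
have bd : b = d by lia.
rewrite {}bd in db.
have [Xi cXi [Xi0 Xia]] : exists2 S : {fset nat}, #|` S| = d &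
    (forall x, D x -> (forall j, j \in S -> x.2 j = 0) -> x = 0) /\
    (forall a : nat -> F, exists2 x, D x & forall j, j \in S -> x.2 j = a j).
  apply: (coordinate_pivots (f := fun j x => hcoord x (inr j))) => //.
  move=> [p u] [_ /= ->] u0; congr (_, _); apply/funext => j; exact: u0.
have [Om cOm [Omx Oma]] : exists2 S : {fset nat}, #|` S| = d &
    (forall x, exists2 a : nat -> F, True &
       PK (x - \sum_(i <- S) a i *: ('X^i : {poly F}))) /\
    (forall a : nat -> F, PK (\sum_(i <- S) a i *: ('X^i : {poly F})) ->
       forall i, i \in S -> a i = 0).
  apply: (complement_pivots (e := fun i => ('X^i : {poly F}) : ell F)) => //.
  move=> M sM MX; apply/seteqP; split=> // p _.
  rewrite -[p](coefK (p : {poly F})) poly_def.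
  by apply: lsubspace_sum => // i; exact: MX.
exists Om, Xi; split; first by rewrite cOm.
have sumX (c : nat -> F) i :
    (\sum_(k <- Om) c k *: ('X^k : {poly F}))`_i = if i \in Om then c i else 0.
  rewrite coef_sum; under eq_bigr do rewrite coefZ coefXn.
  case: ifPn => iO.
    rewrite (bigD1_seq i iO (fset_uniq Om)) big1 => [|k ki].
      by rewrite Monoid.mulm1 eqxx mulr1.
    by rewrite eq_sym (negbTE ki) mulr0.
  rewrite big_seq big1// => k kO; rewrite (_ : _ == _ = false) ?mulr0//.
  by apply: contraNF iO => /eqP ->.
split=> [x Kx Wx|x].
  have x1E : x.1 = \sum_(k <- Om) (x.1 : {poly F})`_k *: ('X^k : {poly F}).
    apply/polyP => i; rewrite sumX; case: ifPn => // iO.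
    exact: (Wx (inl i)).
  have x1 : x.1 = 0.
    have x0 : forall i, i \in Om -> (x.1 : {poly F})`_i = 0.
      by apply: Oma; rewrite -x1E; exists x.
    apply/polyP => i; rewrite coef0; have [iO|iO] := boolP (i \in Om).
      exact: x0.
    exact: (Wx (inl i)).
  by apply: Xi0 => // j jX; exact: (Wx (inr j)).
have [c _ [k Kk kE]] := Omx x.1.
have [z [Kz /= z1] zE] := Xia (fun j => x.2 j - k.2 j).
exists (k + z); first exact: lsubspaceD.
move=> [i|j] /= cs.
  rewrite [LHS](hcoordB x (k + z) (inl i)) hcoordD /= z1 coef0 addr0 kE.
  by rewrite coefB sumX (negbTE cs) subr0 subrr.
rewrite [LHS](hcoordB x (k + z) (inr j)) hcoordD /= zE//.
by rewrite [k.2 j + _]addrC subrK subrr.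
Qed.

(** * Straightening a point of the Grassmannian *)

(** These subspaces form a basis of neighbourhoods of zero. *)
Definition tail n : set (hspace F) :=
  [set x | x.1 = 0 /\ forall j, (j < n)%N -> x.2 j = 0].

Definition lin (f : hspace F -> hspace F) :=
  forall a x y, f (a *: x + y) = a *: f x + f y.

(** For linear maps, continuity at zero is continuity. *)
Definition contin0 (f : hspace F -> hspace F) :=
  forall n, exists m, forall x, tail m x -> tail n (f x).

Definition bicontinuous (f h : hspace F -> hspace F) :=
  [/\ lin f, cancel f h, cancel h f, contin0 f & contin0 h].

Lemma tailP n x : tail n x <->
  (forall i, hcoord x (inl i) = 0) /\ (forall j, (j < n)%N -> hcoord x (inr j) = 0).
Proof.
split=> [[x1 x2]|[x1 x2]]; split=> //; first by move=> i /=; rewrite x1 coef0.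
by apply/polyP => i; rewrite coef0; exact: x1.
Qed.

Lemma tailS m n x : (m <= n)%N -> tail n x -> tail m x.
Proof. by move=> mn [x1 x2]; split=> // j jm; rewrite x2// (leq_trans jm). Qed.

Lemma lsubspace_tail n : lsubspace (tail n).
Proof.
split; first by apply/tailP; split=> *; rewrite hcoord0.
move=> a x y /tailP[x1 x2] /tailP[y1 y2]; apply/tailP.
by split=> k => [|kn]; rewrite hcoord_lin ?x1 ?y1 ?x2 ?y2// mulr0 addr0.
Qed.

(** Exchanging one [e_omega] with one [f_xi] moves the subspace to a chart with
    smaller index sets; in the big cell a shear concludes. *)
Lemma straighten_transversal n Om Xi L : #|` Om| = n -> #|` Xi| = n ->
  lsubspace L -> transversal Om Xi L ->
  exists f h, bicontinuous f h /\ forall x, L x <-> (f x).2 = 0.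
Proof.
elim: n Om Xi L => [|n IH] Om Xi L.
  move=> /cardfs0_eq -> /cardfs0_eq -> sL /(transversal_chart_graph sL)[T ->].
  pose c i j := chart_coef T (inl i) (inr j).
  exists (fun x => (x.1, x.2 - mulvT x.1 c)), (fun x => (x.1, x.2 + mulvT x.1 c)).
  split; first split.
  - move=> a x y; congr (_, _); rewrite [(a *: x + y).1]/= mulvT_linear.
    by rewrite /= opprD addrACA scalerBr.
  - by move=> [p u] /=; rewrite subrK.
  - by move=> [p u] /=; rewrite addrK.
  - by move=> m; exists m => x [x1 x2]; split=> //= j jm; rewrite x1 mulvT0 subr0 x2.
  - by move=> m; exists m => x [x1 x2]; split=> //= j jm; rewrite x1 mulvT0 addr0 x2.
  move=> x; split.
    move=> /(chart_graphP T (leqnn _)) Hx; apply/funext => j.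
    apply/eqP; rewrite subr_eq0; apply/eqP.
    have jX : ~~ chart_index fset0 fset0 (inr j) by [].
    apply: (etrans (Hx _ jX)).
    by rewrite /chart_rowsum big_seq_fset0 addr0.
  move=> /= /eqP; rewrite subr_eq0 => /eqP xE.
  apply/(chart_graphP T (leqnn _)) => -[i|j] // _.
  by rewrite /chart_rowsum big_seq_fset0 addr0 /= xE.
move=> cO cX sL tL.
have [om omO] : exists om, om \in Om by apply/fset0Pn; rewrite -cardfs_gt0 cO.
have [xi xiX] : exists xi, xi \in Xi by apply/fset0Pn; rewrite -cardfs_gt0 cX.
pose sg (t : nat + nat) : nat + nat :=
  if t == inl om then inr xi else if t == inr xi then inl om else t.
have sgK : involutive sg.
  rewrite /sg => t; case: (t =P inl om) => [->|/eqP/negbTE t1].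
    by rewrite /= eqxx.
  by case: (t =P inr xi) => [->|/eqP/negbTE t2]; rewrite ?eqxx// t1 t2.
pose s (x : hspace F) : hspace F :=
  x + (hcoord x (inl om) - hcoord x (inr xi)) *: (hunit F (inr xi) - hunit F (inl om)).
have sE x t : hcoord (s x) t = hcoord x (sg t).
  rewrite /s hcoordD hcoordZ hcoordB !hcoord_hunit /sg.
  case: (t =P inl om) => [->|/eqP/negbTE t1].
    by rewrite /= sub0r mulrN1 opprB addrC subrK.
  case: (t =P inr xi) => [->|/eqP/negbTE t2]; last by rewrite subrr mulr0 addr0.
  by rewrite subr0 mulr1 addrC subrK.
have sL' a x y : s (a *: x + y) = a *: s x + s y.
  by apply: hcoord_inj => t; rewrite sE !hcoord_lin !sE.
have sK : involutive s by move=> x; apply: hcoord_inj => t; rewrite !sE sgK.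
have s_cont : contin0 s.
  move=> m; exists (maxn m xi.+1) => x /tailP[x1 x2].
  suff -> : s x = x.
    by apply/tailP; split=> // j jm; rewrite x2// leq_max jm.
  by rewrite /s x1 x2 ?subrr ?scale0r ?addr0// leq_max leqnn orbT.
have s0 : s 0 = 0 by apply: hcoord_inj => t; rewrite sE !hcoord0.
have sB x y : s (x - y) = s x - s y.
  by apply: hcoord_inj => t; rewrite !(sE, hcoordB).
pose L1 : set (hspace F) := [set x | L (s x)].
have idx t : chart_index (Om `\ om)%fset (Xi `\ xi)%fset (sg t) = chart_index Om Xi t.
  rewrite /sg; case: (t =P inl om) => [->|/eqP t1] /=.
    by rewrite !inE eqxx omO.
  case: (t =P inr xi) => [->|/eqP t2] /=; first by rewrite !inE eqxx xiX.
  case: t t1 t2 => [i|j] /= t1 t2; rewrite !inE.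
    by rewrite (_ : i != om)//; apply: contra t1 => /eqP ->.
  by rewrite (_ : j != xi)//; apply: contra t2 => /eqP ->.
have Ws x : chart_W (Om `\ om)%fset (Xi `\ xi)%fset x <-> chart_W Om Xi (s x).
  split=> Wx t ct; last by rewrite -[t]sgK -sE Wx// -idx sgK.
  by rewrite sE Wx// idx.
have [L0 LW] := tL.
have [||||f [h [[fL fK hK fc hc] fL1]]] := IH (Om `\ om)%fset (Xi `\ xi)%fset L1.
- by move: cO; rewrite (cardfsD1 om) omO => -[].
- by move: cX; rewrite (cardfsD1 xi) xiX => -[].
- split; first by rewrite /L1 /= s0; case: sL.
  by move=> a x y Lx Ly; rewrite /L1 /= sL'; case: sL => _; apply.
- split=> [x Lx /Ws Wx|x].
    by rewrite -[x]sK (L0 _ Lx Wx) s0.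
  have [k Lk Wk] := LW (s x); exists (s k); first by rewrite /L1 /= sK.
  by apply/Ws; rewrite sB sK.
exists (f \o s), (s \o h); split; last by move=> x; rewrite -fL1 /L1 /= sK.
split.
- by move=> a x y /=; rewrite sL' fL.
- by move=> x /=; rewrite fK sK.
- by move=> x /=; rewrite sK hK.
- move=> m; have [m1 Hm1] := fc m; have [m2 Hm2] := s_cont m1.
  by exists m2 => x /Hm2/Hm1.
- move=> m; have [m1 Hm1] := s_cont m; have [m2 Hm2] := hc m1.
  by exists m2 => x /Hm2/Hm1.
Qed.

Lemma straighten_Gr0 L : is_Gr0 L ->
  exists f h, bicontinuous f h /\ forall x, L x <-> (f x).2 = 0.
Proof.
move=> gL; have [Om [Xi [OX tL]]] := Gr0_transversal gL.
have [sL _] := proj1 (is_Gr0P L) gL.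
exact: (straighten_transversal (n := #|` Om|) _ _ sL tL).
Qed.

End covering.
(** * The topology of the space *)

Section pointwise_topology.
Variables (I : choiceType) (F : finFieldType).

(** The filter generated by the sets on the right converges pointwise to [f], so
    it is finer than the filter of neighbourhoods of [f]. *)
Lemma ptws_discrete_nbhs (f : {ptws I -> discrete_topology F})
    (O : set {ptws I -> discrete_topology F}) :
  nbhs f O <-> exists s : seq I, forall g : {ptws I -> discrete_topology F},
    (forall i, i \in s -> g i = f i) -> O g.
Proof.
pose near_f (s : seq I) := [set g : {ptws I -> discrete_topology F} |
  forall i, i \in s -> g i = f i].
have ev i : nbhs f [set g : {ptws I -> discrete_topology F} | g i = f i].
  by apply: (@proj_continuous _ (fun=> discrete_topology F) i f [set f i]);
    exact: discrete_set1.
split; last first.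
  move=> [s sO]; suff : nbhs f (near_f s) by apply: filterS.
  rewrite /near_f; elim: s {sO} => [|i s IH].
    by apply: filterS filterT => g _ i.
  apply: filterS (filterI (ev i) IH) => g [gi gs] k.
  by rewrite inE => /orP[/eqP ->//|]; exact: gs.
pose Phi := filter_from setT near_f.
have FPhi : Filter Phi.
  apply: filter_from_filter; first by exists [::].
  move=> s t _ _; exists (s ++ t) => // g gst.
  by split=> i it; apply: gst; rewrite mem_cat it ?orbT.
suff : Phi --> f by move=> /(_ O) /[apply] -[s _ sO]; exists s.
apply/cvg_sup => i; rewrite cvg_image; last first.
  by rewrite eqEsubset; split=> v // _; exists (fun=> v).
move=> B /nbhs_singleton Bf; exists (@proj I (fun=> discrete_topology F) i @^-1` B).
  by exists [:: i] => // g /(_ i (mem_head _ _)) gi; rewrite /= /proj gi.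
rewrite eqEsubset; split=> [_ [g Bg <-]//|v Bv].
by exists (fun=> v).
Qed.

End pointwise_topology.

Section hspace_topology.
Variable F : finFieldType.
Implicit Types (O : set (hspace F)).

Lemma nbhs_hspaceP (x : hspace F) O :
  nbhs x O <-> exists n, forall y, tail n y -> O (x + y).
Proof.
split.
  move=> [[A B] /= [xA /ptws_discrete_nbhs[s sB]] AB].
  exists (foldr maxn 0 (map S s)) => -[p u] [/= p0 u0]; apply: AB; split=> /=.
    by rewrite p0 addr0; exact: nbhs_singleton xA.
  apply: sB => i iS; rewrite -[RHS]addr0 -[in RHS](u0 i)//.
  elim: s iS {u0} => //= k s IH; rewrite inE => /orP[/eqP ->|/IH h].
    exact: leq_maxl.
  by rewrite leq_max h orbT.
move=> [n nO].
exists ([set x.1], [set u : ell_dual F | forall j, (j < n)%N -> u j = x.2 j]).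
  split; first exact: discrete_set1.
  apply/ptws_discrete_nbhs; exists (iota 0 n) => g gx j jn.
  by apply: gx; rewrite mem_iota.
move=> y [/= y1 y2]; have := nO (y - x); rewrite [x + _]addrC subrK; apply.
split=> [|j jn]; first by rewrite /= y1 subrr.
by rewrite [LHS](_ : _ = y.2 j - x.2 j)// y2// subrr.
Qed.

(** Openness in terms of the basis [tail] of neighbourhoods of zero. *)
Definition lopen O := forall x, O x -> exists n, forall y, tail n y -> O (x + y).

Lemma lopen_preimage (f : hspace F -> hspace F) O :
  lin f -> contin0 f -> lopen O -> lopen (f @^-1` O).
Proof.
move=> fL cf oO x /= /oO[n nO]; have [m mf] := cf n; exists m => y /mf/nO.
by rewrite -[f x]scale1r -fL scale1r.
Qed.

Lemma contin0P (f : hspace F -> hspace F) : lin f -> contin0 f <-> continuous f.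
Proof.
move=> fL; have f0 : f 0 = 0.
  by have := fL (-1) 0 0; rewrite scaler0 addr0 scaleN1r addNr.
have fD x y : f (x + y) = f x + f y by rewrite -[x]scale1r fL !scale1r.
split=> [cf x O /nbhs_hspaceP[n nO]|cf n].
  apply/nbhs_hspaceP; have [m mf] := cf n; exists m => y /mf/nO.
  by rewrite /= fD.
have /nbhs_hspaceP[m mO] : nbhs (0 : hspace F) (f @^-1` tail n).
  apply: cf; apply/nbhs_hspaceP; exists n => y.
  by rewrite f0 add0r.
by exists m => x /mO; rewrite add0r.
Qed.

End hspace_topology.
(** * The Borel structure *)

Lemma Gr0_set_inj (F : finFieldType) : injective (@Gr0_set F).
Proof. by move=> [K gK] [K' gK'] KK'; exact: eq_exist. Qed.

Section hit_sets.
Variables (F : finFieldType) (L : Gr0 F).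

Definition space_of (K : Sigma_set L) : set (hspace F) := Gr0_set (sval K).

Lemma space_of_inj : injective space_of.
Proof. by move=> [K aK] [K' aK'] KK'; apply: eq_exist; exact: Gr0_set_inj. Qed.

(** The sets [hit O], for [O] open, generate the Borel structure. As opposed to
    the charts they make sense without coordinates, so that homeomorphisms act
    on them. *)
Definition hit (O : set (hspace F)) : set (Sigma_set L) :=
  [set K | exists x, space_of K x /\ O x].

Definition hit_sets : set (set (Sigma_set L)) := [set hit O | O in @lopen F].

Lemma chart_rowsum_congr (Om Xi : {fset nat}) (T : chart_matrix F Om Xi) N
    (x y : hspace F) s :
  (forall r, chart_index Om Xi r -> hcoord x r = hcoord y r) ->
  chart_rowsum T N x s = chart_rowsum T N y s.
Proof.
move=> xy; rewrite /chart_rowsum; congr (_ + _); apply: eq_bigr => k _.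
  have [ck|ck] := boolP (chart_index Om Xi (inl (val k))).
    by rewrite [_`_k in LHS](xy _ ck).
  by rewrite chart_coef_row0// !mulr0.
have [ck|ck] := boolP (chart_index Om Xi (inr k)).
  by rewrite [x.2 k](xy _ ck).
by rewrite chart_coef_row0// !mulr0.
Qed.

(** Whether the graph of [T] meets [x + tail n] depends on finitely many entries
    of [T]: those in the rows of the support of [x] and the columns of index
    less than [n]. *)
Lemma open_chart_hit (Om Xi : {fset nat}) (O : set (hspace F)) : lopen O ->
  open [set T : chart_matrix F Om Xi | exists x, chart_graph T x /\ O x].
Proof.
move=> oO; rewrite openE => T [x [Kx Ox]]; have [n nO] := oO x Ox.
have [N xN NO] := fset_bound (size (x.1 : {poly F})) Om.
pose lr : seq (nat + nat) := [seq inl i | i <- iota 0 N] ++ [seq inr j | j <- enum_fset Xi].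
pose lc : seq (nat + nat) := [seq inl i | i <- enum_fset Om] ++ [seq inr j | j <- iota 0 n].
pose l : seq (chart_row Om Xi * chart_col Om Xi) :=
  [seq (r, c) | r <- pmap insub lr, c <- pmap insub lc].
apply/(@ptws_discrete_nbhs (chart_row Om Xi * chart_col Om Xi)%type); exists l => T' TT'.
have coefE r c : r \in lr -> c \in lc -> chart_coef T' r c = chart_coef T r c.
  move=> rl cl; rewrite /chart_coef; case: insubP => // r' _ r'E; case: insubP => // c' _ c'E.
  by apply: TT'; apply: allpairs_f; rewrite mem_pmap_sub/= ?r'E ?c'E.
have [k Kk Wk] := chart_graph_rep T' x; exists k; split=> //.
have kx r : chart_index Om Xi r -> hcoord k r = hcoord x r.
  by move=> /Wk; rewrite hcoordB => /eqP; rewrite subr_eq0 => /eqP ->.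
have kN : (size (k.1 : {poly F}) <= N)%N.
  apply/leq_sizeP => i Ni; rewrite [LHS](kx (inl i)) /=.
    by rewrite nth_default// (leq_trans xN).
  by apply: contraTN Ni => /NO; rewrite -ltnNge.
have kxc c : c \in lc -> ~~ chart_index Om Xi c -> hcoord k c = hcoord x c.
  move=> cl cc; rewrite (proj1 (chart_graphP T' kN) Kk _ cc).
  rewrite (proj1 (chart_graphP T xN) Kx _ cc) (chart_rowsum_congr _ _ _ kx).
  rewrite /chart_rowsum; congr (_ + _); last apply: eq_big_seq => j jX.
    apply: eq_bigr => i _; rewrite coefE// /lr mem_cat map_f//.
    by rewrite mem_iota/=.
  by rewrite coefE// /lr mem_cat [X in _ || X]map_f ?orbT.
rewrite -[k](subrK x) addrC; apply: nO; apply/tailP; split=> [i|j jn].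
  rewrite hcoordB; have [iO|iO] := boolP (i \in Om); last by rewrite kx ?subrr.
  by rewrite kxc ?subrr// ?mem_cat ?map_f//= iO.
rewrite hcoordB; have [jX|jX] := boolP (j \in Xi); first by rewrite kx ?subrr.
by rewrite kxc ?subrr// mem_cat [X in _ || X]map_f ?orbT// mem_iota.
Qed.

Lemma measurable_hit (O : set (hspace F)) : lopen O ->
  measurable (hit O : set (Sigma L)).
Proof.
move=> oO; exists [set K : Gr0 F | exists x, Gr0_set K x /\ O x]; last first.
  by rewrite setTI.
apply: sub_sigma_algebra => Om Xi OX; apply: sub_sigma_algebra => /=.
rewrite (_ : [set T | _] = [set T : chart_matrix F Om Xi | exists x, chart_graph T x /\ O x]).
  exact: open_chart_hit.
apply/seteqP; split=> T /=; first by move=> [K + KT]; rewrite -KT.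
by move=> hT; exists (exist _ _ (is_Gr0_chart_graph T OX)).
Qed.

Section one_chart.
Variables (Om Xi : {fset nat}).
Local Notation W := (@chart_W F Om Xi).
Local Notation row := {s : nat + nat | chart_index Om Xi s}.
Local Notation col := {s : nat + nat | ~~ chart_index Om Xi s}.
Local Notation GT := (g_sigma_algebraType hit_sets).

Let hitm O : lopen O -> measurable (hit O : set GT).
Proof. by move=> oO; apply: sub_sigma_algebra; exists O. Qed.

Let in_chart (C : set (chart_matrix F Om Xi)) : set (Sigma_set L) :=
  [set K | exists2 T, space_of K = chart_graph T & C T].

Let sW : lsubspace W := @lsubspace_chart_W F Om Xi.

(* [Xi] is finite, so [chart_W] is open. *)
Let W_tail : exists n, forall x, tail n x -> W x.
Proof.
have [n _ nX] := fset_bound 0 Xi.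
exists n => x /tailP[x1 x2] [i|j] /= cs; first exact: x1.
by apply: x2; exact: nX.
Qed.

Let lopen_entry (r : row) (c : col) (a : F) :
  lopen [set x | W (x - hunit F (val r)) /\ hcoord x (val c) = a].
Proof.
have [n Wn] := W_tail.
move=> x [Wx xa]; exists (maxn n (if val c is inr j then j.+1 else 0%N)) => y ty.
split.
  rewrite addrAC; apply: (lsubspaceD sW) => //.
  by apply: Wn; apply: tailS ty; exact: leq_maxl.
rewrite hcoordD xa; move/tailP: ty => [y1 y2]; case: (val c) y2 => [i _|j y2].
  by rewrite y1 addr0.
by rewrite y2 ?addr0// leq_max ltnSn orbT.
Qed.

Let lopen_W (v : hspace F) : lopen [set x | W (x - v)].
Proof.
have [n Wn] := W_tail.
move=> x /= Wx; exists n => y ty /=.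
rewrite addrAC; apply: (lsubspaceD sW) => //.
exact: Wn.
Qed.

Let lopen_W0 : lopen [set x | W x /\ x <> 0].
Proof.
move=> x [Wx /eqP x0].
have [n Wn] := W_tail.
have [s xs] : exists s, hcoord x s != 0.
  apply: contrapT => /forallNP nx; move/eqP: x0; apply; apply: hcoord_inj => s.
  by rewrite hcoord0; apply/eqP/negPn/negP/nx.
exists (maxn n (if s is inr j then j.+1 else 0%N)) => y ty; split.
  apply: (lsubspaceD sW) => //.
  by apply: Wn; apply: tailS ty; exact: leq_maxl.
move=> /(congr1 (fun z => hcoord z s)); rewrite hcoord0 hcoordD => e.
move/eqP: xs; apply; rewrite -e; move/tailP: ty => [y1 y2].
case: s y2 {e} => [i _|j y2]; first by rewrite y1 addr0.
by rewrite y2 ?addr0// leq_max ltnSn orbT.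
Qed.

Let lsubspace_space_of (K : Sigma_set L) : lsubspace (space_of K).
Proof. by have [[sK _] _] := svalP (sval K). Qed.

(* Being complementary to [chart_W] is expressed by hits of open sets. *)
Let in_chartTE : in_chart setT =
  ~` (hit [set x | W x /\ x <> 0] `|`
      \bigcup_(r : row) ~` hit [set x | W (x - hunit F (val r))]).
Proof.
apply/seteqP; split=> [K [T KT _] [[x [Kx [Wx x0]]]|[r _ /=]]|K].
- by apply: x0; apply: (proj1 (chart_graph_transversal T)) => //; rewrite -KT.
- apply; have [k Kk Wk] := chart_graph_rep T (hunit F (val r)).
  exists k; split; first by rewrite KT.
  rewrite /= -opprB -[- _]add0r; apply: (lsubspaceB sW) => //.
  by case: sW.
move=> /= /not_orP[K0 KW].
have sK := lsubspace_space_of K.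
have /(transversal_chart_graph sK)[T KT] : transversal Om Xi (space_of K).
  split=> [x Kx Wx|x].
    by apply: contrapT => x0; apply: K0; exists x.
  pose KW' := [set x | exists2 k, space_of K k & W (x - k)].
  have sKW : lsubspace KW'.
    split; first by exists 0; rewrite ?subr0; [case: sK|case: sW].
    move=> a y z [k Kk Wk] [k' Kk' Wk']; exists (a *: k + k').
      by case: sK => _; apply.
    by rewrite opprD addrACA -scalerBr; case: sW => _; apply.
  have KWr r : chart_index Om Xi r -> KW' (hunit F r).
    move=> cr; apply: contrapT => nr; apply: KW; exists (exist _ r cr) => //=.
    move=> [k [Kk /= Wk]]; apply: nr; exists k => //.
    by rewrite -opprB -[- _]add0r; apply: (lsubspaceB sW) => //; case: sW.
  suff Hc : KW' (chart_part Om Xi x).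
    have -> : x = chart_part Om Xi x + (x - chart_part Om Xi x) by rewrite addrC subrK.
    apply: (lsubspaceD sKW) => //; exists 0; first by case: sK.
    by rewrite subr0 => s cs; rewrite hcoordB hcoord_chart_part cs subrr.
  have -> : chart_part Om Xi x =
      \sum_(i < size (x.1 : {poly F})) hcoord (chart_part Om Xi x) (inl (val i)) *: hunit F (inl (val i)) +
      \sum_(j <- Xi) hcoord x (inr j) *: hunit F (inr j).
    apply: hcoord_inj => s; rewrite hcoordD !hcoord_sum.
    under eq_bigr do rewrite hcoordZ hcoord_hunit.
    under [X in _ = _ + X]eq_bigr do rewrite hcoordZ hcoord_hunit.
    case: s => [i|j].
      rewrite [X in _ = _ + X]big1 ?addr0 => [|j _]; last by rewrite mulr0.
      have [ix|xi] := ltnP i (size (x.1 : {poly F})).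
        rewrite (big_only1 (Ordinal ix))// => [|k ki _]; first by rewrite eqxx mulr1.
        rewrite (_ : _ == _ = false) ?mulr0//; apply: contraNF ki => /eqP[e].
        by apply/eqP/val_inj; rewrite /= -e.
      rewrite big1 => [|k _].
        by rewrite hcoord_chart_part; case: ifP => // _; rewrite /= nth_default.
      rewrite (_ : _ == _ = false) ?mulr0//; apply/eqP => -[e].
      by move: (ltn_ord k); rewrite -e ltnNge xi.
    rewrite big1 ?add0r => [|i _]; last by rewrite mulr0.
    rewrite hcoord_chart_part; case: ifPn => jX.
      rewrite (bigD1_seq j jX (fset_uniq Xi)) big1 => [|k kj].
        by rewrite Monoid.mulm1 eqxx mulr1.
      by rewrite (_ : _ == _ = false) ?mulr0//; apply: contraNF kj => /eqP[->].
    rewrite big_seq big1// => k kX; rewrite (_ : _ == _ = false) ?mulr0//.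
    by apply: contraNF jX => /eqP[->].
  apply: (lsubspaceD sKW).
    elim/big_rec: _ => [|i y _ Ky]; first by case: sKW.
    apply: (lsubspaceD sKW) => //; have [ci|ci] := boolP (chart_index Om Xi (inl (val i))).
      by apply: lsubspaceZ => //; exact: KWr.
    by rewrite hcoord_chart_part (negbTE ci) scale0r; case: sKW.
  rewrite big_seq; elim/big_rec: _ => [|j y jX Ky]; first by case: sKW.
  by apply: (lsubspaceD sKW) => //; apply: lsubspaceZ => //; exact: KWr.
by exists T.
Qed.

Let measurable_in_chartT : measurable (in_chart setT : set GT).
Proof.
rewrite in_chartTE; apply: measurableC; apply: measurableU.
  by apply: hitm; exact: lopen_W0.
apply: (@countable_bigcupT_measurable _ GT row); first exact: countableP.
by move=> r; apply: measurableC; apply: hitm; exact: lopen_W.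
Qed.

Let cyl (l : seq (row * col * F)) : set (chart_matrix F Om Xi) :=
  [set T | forall e, e \in l -> T (e.1.1, e.1.2) = e.2].

Let measurable_in_chart_cyl l : measurable (in_chart (cyl l) : set GT).
Proof.
elim: l => [|[[r c] a] l IH].
  rewrite (_ : in_chart _ = in_chart setT); last first.
    by apply/seteqP; split=> K [T KT _]; exists T.
  exact: measurable_in_chartT.
rewrite (_ : in_chart _ = in_chart (cyl l) `&`
  hit [set x | W (x - hunit F (val r)) /\ hcoord x (val c) = a]).
  apply: measurableI => //; apply: hitm; exact: lopen_entry.
have rowE K T k : space_of K = chart_graph T -> space_of K k ->
    W (k - hunit F (val r)) -> hcoord k (val c) = T (r, c).
  move=> KT Kk Wk; apply: (@chart_graph_row _ _ _ T r) => //; first by rewrite -KT.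
  rewrite -opprB -[- _]add0r.
  by apply: (lsubspaceB sW) => //; case: sW.
apply/seteqP; split=> [K [T KT Tl]|K [[T KT Tl] [k [Kk [/= Wk kc]]]]].
  split; first by exists T => // e el; apply: Tl; rewrite inE el orbT.
  have [k Kk Wk] := chart_graph_rep T (hunit F (val r)).
  have Wk' : W (k - hunit F (val r)).
    rewrite -opprB -[- _]add0r.
    by apply: (lsubspaceB sW) => //; case: sW.
  rewrite -KT in Kk.
  by exists k; split=> //; split=> //; rewrite (rowE K T)// (Tl (r, c, a))// mem_head.
exists T => // e; rewrite inE => /orP[/eqP ->|]; last exact: Tl.
by rewrite /= -(rowE K T k).
Qed.

(** A basic open set of matrices prescribes finitely many entries, and prescribing
    the entry [(r, c)] amounts to hitting the open set of the vectors that are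
    congruent to the basis vector [r] modulo [chart_W] and have coordinate [a]
    at [c]. *)
Lemma measurable_chart (C : set (chart_matrix F Om Xi)) :
  <<s [set U : set (chart_matrix F Om Xi) | open U] >> C ->
  measurable ([set K | exists2 T, space_of K = chart_graph T & C T] : set GT).
Proof.
rewrite -[X in _ -> measurable X]/(in_chart C); move: C.
pose S : set (set (chart_matrix F Om Xi)) := [set C | measurable (in_chart C : set GT)].
suff sub : <<s [set U : set (chart_matrix F Om Xi) | open U] >> `<=` S by move=> C /sub.
apply: smallest_sub; last first.
  move=> U oU; rewrite /S /=.
  rewrite (_ : in_chart U = \bigcup_(l : seq (row * col * F))
    (if `[< cyl l `<=` U >] then in_chart (cyl l) else set0)).
    apply: (@countable_bigcupT_measurable _ GT); first exact: countableP.
    by move=> l; case: ifP => _ //; exact: measurable_in_chart_cyl.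
  apply/seteqP; split=> [K [T KT UT]|K [l _]]; last first.
    by case: asboolP => // lU [T KT /lU UT]; exists T.
  move: oU; rewrite openE => /(_ T UT).
  move=> /(@ptws_discrete_nbhs (chart_row Om Xi * chart_col Om Xi)%type)[s sU].
  exists [seq (e.1, e.2, T e) | e <- s] => //; case: asboolP => [_|].
    by exists T => // _ /mapP[[r c] _ ->].
  case=> T' T'l; apply: sU => -[r c] rcs.
  by rewrite (T'l (r, c, T (r, c)))//; apply/mapP; exists (r, c).
split.
- by rewrite /S /= (_ : in_chart set0 = set0)//; apply/seteqP; split=> K // [].
- move=> C; rewrite /S /= => mC.
  rewrite (_ : in_chart _ = in_chart setT `\` in_chart C); first exact: measurableD.
  apply/seteqP; split=> [K [T KT [_ CT]]|K [[T KT _] CT]].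
    split; first by exists T.
    by move=> [T' KT' CT']; apply: CT; rewrite (chart_graph_inj (T := T) (T' := T')) -?KT.
  by exists T => //; split=> // T'; apply: CT; exists T.
- move=> C mC; rewrite /S /= (_ : in_chart _ = \bigcup_k in_chart (C k)).
    exact: bigcupT_measurable.
  apply/seteqP; split=> [K [T KT [k _ CT]]|K [k _ [T KT CT]]]; first by exists k => //; exists T.
  by exists T => //; exists k.
Qed.

End one_chart.

(** Countably many charts cover the Grassmannian, so a set is Borel as soon as its
    parts in the charts are generated by the sets [hit O]. *)
Lemma Sigma_measurableE : @measurable _ (Sigma L) = <<s hit_sets >>.
Proof.
apply/seteqP; split; last first.
  apply: smallest_sub; first exact: sigma_algebra_measurable.
  by move=> _ [U oU <-]; exact: measurable_hit.
move=> _ [B mB <-]; rewrite setTI.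
pose GT := g_sigma_algebraType hit_sets.
pose S : set (set (Gr0 F)) := [set B | measurable ((@Sigma_incl F L) @^-1` B : set GT)].
suff : <<s @borel_Gr0 F >> `<=` S by move=> /(_ _ mB).
apply: smallest_sub.
  split; first by rewrite /S /= preimage_set0.
    by move=> A; rewrite /S /= setTD -preimage_setC => mA; exact: measurableC.
  by move=> A mA; rewrite /S /= preimage_bigcup; exact: bigcupT_measurable.
move=> A bA; rewrite /S /=.
rewrite (_ : _ @^-1` A = \bigcup_(p : {fset nat} * {fset nat})
  (if #|` p.1| == #|` p.2| then
     [set K | exists2 T : chart_matrix F p.1 p.2, space_of K = chart_graph T &
        exists2 K : Gr0 F, A K & (K : set _) = chart_graph T] else set0)).
  apply: (@countable_bigcupT_measurable _ GT); first exact: countableP.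
  move=> [Om Xi]; case: eqP => // OX.
  exact: (measurable_chart (bA Om Xi OX)).
apply/seteqP; split=> [K AK|K [[Om Xi] _]].
  have gK := svalP (sval K); have [Om [Xi [OX tK]]] := Gr0_transversal gK.
  have [sK _] := proj1 (is_Gr0P _) gK.
  have [T KT] := transversal_chart_graph sK tK.
  exists (Om, Xi) => //; rewrite OX eqxx; exists T => //.
  by exists (sval K).
case: eqP => // OX [T KT [K' AK' K'T]].
by rewrite /= /Sigma_incl (@Gr0_set_inj _ (sval K) K')//; rewrite K'T -KT.
Qed.

End hit_sets.
(** * The uniform measure on sequences *)

Lemma pushforward_probability d d' (T : measurableType d) (T' : measurableType d')
    (R : realType) (P : probability T R) (f : T -> T') :
  measurable_fun setT f ->
  exists Q : probability T' R, forall A, Q A = P (f @^-1` A).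
Proof.
move=> mf; pose X : {mfun T >-> T'} := mfun_Sub (mem_set mf).
by exists (distribution P X).
Qed.

Section uniform_sequences.
Variable F : finFieldType.

(** A separate name keeps the generated sigma-algebra apart from other structures
    on functions. *)
Definition fseq : Type := nat -> F.
HB.instance Definition _ := gen_eqMixin fseq.
HB.instance Definition _ := gen_choiceMixin fseq.
HB.instance Definition _ := isPointed.Build fseq (fun=> 0).
Implicit Types (om eta : fseq).

Definition cylinder n eta : set fseq :=
  [set om | forall i, (i < n)%N -> om i = eta i].

Definition cylinders : set (set fseq) :=
  [set A | A = set0 \/ exists n eta, A = cylinder n eta].

Notation fseq_space := (g_sigma_algebraType cylinders).

Lemma measurable_cylinder n eta : measurable (cylinder n eta : set fseq_space).
Proof. by apply: sub_sigma_algebra; right; exists n, eta. Qed.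

Lemma cylinders_setI : setI_closed cylinders.
Proof.
move=> A B [->|[m [eta ->]]]; first by left; rewrite set0I.
move=> [->|[n [eta' ->]]]; first by left; rewrite setI0.
have [[om [om1 om2]]|no] := pselect (exists om, (cylinder m eta `&` cylinder n eta') om).
  right; exists (maxn m n), om; apply/seteqP; split=> om'.
    move=> [h1 h2] i; rewrite leq_max => /orP[im|i_n].
      by rewrite h1// om1.
    by rewrite h2// om2.
  move=> h; split=> i im; rewrite h ?leq_max ?im ?orbT//; [exact: om1|exact: om2].
by left; apply/seteqP; split=> // om h; apply: no; exists om.
Qed.

(** A set that is determined by finitely many terms is a finite union of
    cylinders. *)
Lemma measurable_finite_type n (A : set fseq) :
  (forall om om', cylinder n om om' -> A om -> A om') ->
  measurable (A : set fseq_space).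
Proof.
move=> nA.
rewrite (_ : A = \bigcup_(l : seq F)
    (if `[< A (nth 0 l) >] then cylinder n (nth 0 l) else set0)).
  apply: (@countable_bigcupT_measurable _ fseq_space); first exact: countableP.
  by move=> l; case: ifP => _ //; exact: measurable_cylinder.
apply/seteqP; split=> [om Aom|om [l _]]; last by case: asboolP => // Al /nA; apply.
have e i : (i < n)%N -> nth 0 (mkseq om n) i = om i by move=> i_n; rewrite nth_mkseq.
exists (mkseq om n) => //; case: asboolP => [_ i /e ->//|].
by case; apply: nA Aom => i /e.
Qed.

Variable R : realType.
Local Notation q := #|F|.

Let q_gt0 : (0 < q)%N. Proof. by apply/card_gt0P; exists 0. Qed.

(* The terms of the base-[q] expansion of a uniform real number in [0, 1[ are
   independent and uniform. *)
Let digits (x : R) : fseq := fun n =>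
  enum_val (Ordinal (ltn_pmod (Num.truncn (x * q%:R ^+ n.+1)) q_gt0)).

(* The integer whose base-[q] digits are the first [n] terms of [eta]. *)
Let code eta : nat -> nat :=
  fix code n := if n is m.+1 then (code m * q + enum_rank (eta m))%N else 0%N.

Let code_lt eta n : (code eta n < q ^ n)%N.
Proof.
elim: n => //= n IH; rewrite expnSr.
apply: (@leq_trans ((code eta n).+1 * q)); last by rewrite leq_pmul2r.
by rewrite mulSn addnC ltn_add2r.
Qed.

Let truncn_mul (y : R) : 0 <= y -> (Num.truncn (y * q%:R) %/ q = Num.truncn y)%N.
Proof.
move=> y0; have /andP[y1 y2] := truncn_itv y0.
have yq0 : 0 <= y * q%:R by rewrite mulr_ge0.
apply/eqP; rewrite eqn_leq; apply/andP; split.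
  rewrite -ltnS ltn_divLR// truncn_lt_nat// natrM.
  by rewrite ltr_pM2r// ltr0n.
by rewrite leq_divRL// truncn_ge_nat// natrM ler_pM2r// ltr0n.
Qed.

Let digitsP (x : R) n eta : 0 <= x < 1 ->
  cylinder n eta (digits x) <-> Num.truncn (x * q%:R ^+ n) = code eta n.
Proof.
move=> /andP[x0 x1]; elim: n => [|n IH].
  split=> // _; rewrite expr0 mulr1 /=; apply/eqP.
  by rewrite -leqn0 -ltnS truncn_lt_nat.
have cE : cylinder n.+1 eta (digits x) <->
    cylinder n eta (digits x) /\ digits x n = eta n.
  split=> [h|[h1 h2] i].
    by split=> [i i_n|]; apply: h => //; exact: ltnW.
  by rewrite ltnS leq_eqVlt => /orP[/eqP ->|/h1].
rewrite cE IH.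
have -> : (digits x n = eta n) <->
    (Num.truncn (x * q%:R ^+ n.+1) %% q = enum_rank (eta n))%N.
  rewrite /digits; split=> [<-|e]; first by rewrite enum_valK.
  apply: (can_inj enum_rankK); rewrite enum_valK; exact: val_inj.
rewrite -(truncn_mul (y := x * q%:R ^+ n)); last by rewrite mulr_ge0.
rewrite -mulrA -exprSr /=; set t := Num.truncn _.
split=> [[t1 t2]|te]; first by rewrite (divn_eq t q) t1 t2.
by rewrite te divnMDl// modnMDl divn_small ?modn_small// addn0.
Qed.

Let digits01 (x : R) : fseq_space := digits (if 0 <= x < 1 then x else 0).

Let cell n (eta : fseq) : interval R :=
  `[(code eta n)%:R / q%:R ^+ n, (code eta n).+1%:R / q%:R ^+ n[.

Let qn_gt0 n : 0 < q%:R ^+ n :> R. Proof. by rewrite exprn_gt0// ltr0n. Qed.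

Let preimage_cylinder n eta :
  digits01 @^-1` cylinder n eta `&` `[0, 1[ = [set` cell n eta].
Proof.
have cellE (x : R) : 0 <= x -> (Num.truncn (x * q%:R ^+ n) = code eta n) <-> (x \in cell n eta).
  move=> x0; rewrite in_itv/= ler_pdivrMr// ltr_pdivlMr// -truncn_eq ?mulr_ge0//.
  by split=> /eqP.
apply/seteqP; split=> x /=.
  rewrite in_itv/= /digits01 => -[+ x01]; rewrite x01 => /(digitsP _ _ x01).
  by move/cellE; apply; case/andP: x01.
move=> xc; have x01 : 0 <= x < 1.
  move: (xc); rewrite in_itv/= => /andP[h1 h2]; rewrite (le_trans _ h1) ?divr_ge0//.
  rewrite (lt_le_trans h2)// ler_pdivrMr// mul1r -natrX ler_nat.
  exact: code_lt.
rewrite in_itv/= x01; split=> //; rewrite /digits01 x01.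
by apply/(digitsP _ _ x01)/cellE => //; case/andP: x01.
Qed.

Let measurable_digits01 :
  measurable_fun [set: measurableTypeR R] (digits01 : measurableTypeR R -> fseq_space).
Proof.
apply: (@measurability _ _ (measurableTypeR R) fseq_space setT digits01 cylinders erefl) => _ [B [->|[n [eta ->]]] <-].
  by rewrite preimage_set0 setI0.
rewrite setTI (_ : _ @^-1` _ = [set` cell n eta] `|`
  (if `[< cylinder n eta (digits 0) >] then ~` [set` (`[0, 1[ : interval R)] else set0)).
  apply: measurableU; first exact: measurable_itv.
  by case: ifP => _ //; apply: measurableC; exact: measurable_itv.
rewrite -preimage_cylinder; apply/seteqP; split=> x.
  move=> xc; have [x01|x01] := boolP (x \in (`[0, 1[ : interval R)); first by left.
  right; case: asboolP => [_|]; first exact/negP.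
  by case; move: xc; rewrite /= /digits01; move: x01; rewrite in_itv/= => /negbTE ->.
move=> [[]//|]; case: asboolP => // xc /negP; rewrite in_itv/= => /negbTE x01.
by rewrite /= /digits01 x01.
Qed.

Let unit_measure : set (measurableTypeR R) -> \bar R :=
  mrestr (@lebesgue_measure R) (measurable_itv (`[0, 1[ : interval R)).

HB.instance Definition _ := Measure.on unit_measure.

Let unit_measureT : unit_measure setT = 1%E.
Proof.
by rewrite /unit_measure /mrestr setTI lebesgue_measure_itv/= lte_fin ltr01 sube0.
Qed.

HB.instance Definition _ :=
  Measure_isProbability.Build _ _ _ unit_measure unit_measureT.

(** The preimage of a cylinder under the digit expansion is an interval of length
    [q ^- n]. *)
Lemma exists_uniform_sequences : exists mu : probability fseq_space R,
  forall n eta, mu (cylinder n eta) = ((q%:R ^+ n)^-1)%:E.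
Proof.
have [mu muE] := pushforward_probability unit_measure measurable_digits01.
exists mu => n eta; rewrite muE /= /unit_measure /mrestr preimage_cylinder.
rewrite lebesgue_measure_itv/= lte_fin ltr_pM2r ?invr_gt0// ltr_nat ltnSn.
by rewrite -EFinB -mulrBl -natrB// subSnn mul1r.
Qed.

(** The cylinders form a pi-system, and a translation permutes the cylinders of
    given length. *)
Lemma uniform_translation (mu : probability fseq_space R) :
  (forall n eta, mu (cylinder n eta) = ((q%:R ^+ n)^-1)%:E) ->
  forall (tau : fseq) (A : set fseq_space), measurable A ->
  measurable [set om : fseq_space | A (fun n => om n + tau n)] /\
  mu [set om : fseq_space | A (fun n => om n + tau n)] = mu A.
Proof.
move=> mu_cyl tau.
pose f (om : fseq_space) : fseq_space := fun n => om n + tau n.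
have f_cyl n eta : f @^-1` cylinder n eta = cylinder n (fun k => eta k - tau k).
  apply/seteqP; split=> om h i i_n; first by rewrite -(h i i_n) addrK.
  by rewrite /f h// subrK.
have mf : measurable_fun setT f.
  apply: (@measurability _ _ fseq_space fseq_space setT f cylinders erefl) => _ [B [->|[n [eta ->]]] <-].
    by rewrite preimage_set0 setI0.
  by rewrite setTI f_cyl; exact: measurable_cylinder.
have [mu' mu'E] := pushforward_probability mu mf.
move=> A mA; split; first by rewrite -[X in measurable X]setTI; exact: mf.
rewrite -[LHS](mu'E A); apply: (@measure_unique _ R fseq_space cylinders (fun=> setT) erefl cylinders_setI _ _ mu' mu) => //.
- by move=> _; right; exists 0%N, (fun=> 0); apply/seteqP; split.
- by rewrite bigcup_const//; exists 0%N.
- move=> B [->|[n [eta ->]]]; first by rewrite !measure0.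
  apply: (etrans (mu'E _)); rewrite f_cyl.
  by apply: (etrans (mu_cyl _ _)); rewrite -(mu_cyl n eta).
- by move=> _; apply: (le_lt_trans (probability_le1 mu' measurableT)); exact: ltry.
Qed.

End uniform_sequences.
Lemma measure_finite_partition d (T : measurableType d) (R : realType)
    (mu : {measure set T -> \bar R}) (I : finType) (k : T -> I) (A : set T) :
  (forall i, measurable [set x | k x = i]) -> measurable A ->
  mu A = (\sum_(i : I) mu (A `&` [set x | k x = i]))%E.
Proof.
move=> mk mA.
have -> : (\sum_(i : I) mu (A `&` [set x | k x = i]) =
    \sum_(i \in [set: I]) mu (A `&` [set x | k x = i]))%E.
  rewrite -big_enum /= fsbig_seq ?enum_uniq//; congr (\sum_(i \in _) _)%E.
  by apply/seteqP; split=> // i _; rewrite /= mem_enum.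
rewrite -measure_fin_bigcup//; last 3 first.
- exact: finite_finset.
- by move=> i j _ _ [x [[_ <-] [_ <-]]].
- by move=> i _; exact: measurableI.
congr (mu _); apply/seteqP; split=> [x Ax|x [i _ []]//]; by exists (k x).
Qed.

Section translation_invariance.
Variables (F : finFieldType) (R : realType).
Notation fseq_space := (g_sigma_algebraType (@cylinders F)).
Variable mu : probability fseq_space R.

Definition shift (tau om : fseq F) : fseq F := fun n => om n + tau n.

Hypothesis mu_shift : forall (tau : fseq F) (A : set fseq_space), measurable A ->
  measurable (shift tau @^-1` A : set fseq_space) /\ mu (shift tau @^-1` A) = mu A.

(** A map that on each piece of a finite partition is a translation preserving
    that piece preserves the measure. *)
Lemma measure_piecewise_shift (I : finType) (k : fseq F -> I) (tau : I -> fseq F)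
    (A : set fseq_space) :
  (forall i, measurable ([set om | k om = i] : set fseq_space)) ->
  (forall i om, k (shift (tau i) om) = k om) -> measurable A ->
  mu [set om | A (shift (tau (k om)) om)] = mu A.
Proof.
move=> mk ktau mA.
have pieceE i : [set om | A (shift (tau (k om)) om)] `&` [set om | k om = i] =
    shift (tau i) @^-1` (A `&` [set om | k om = i]).
  apply/seteqP; split=> om /=; first by move=> [Aom ki]; rewrite ktau -ki.
  by rewrite ktau => -[Aom ki]; split=> //; rewrite ki.
have mAk i : measurable (A `&` [set om | k om = i] : set fseq_space).
  exact: (@measurableI _ fseq_space _ _ mA (mk i)).
rewrite (@measure_finite_partition _ fseq_space R mu I k) => //; last first.
  rewrite (_ : [set om | _] = \bigcup_i shift (tau i) @^-1` (A `&` [set om | k om = i])).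
    by apply: fin_bigcup_measurable => // i _; case: (mu_shift (tau i) (mAk i)).
  apply/seteqP; split=> [om Aom|om [i _]]; last by rewrite -pieceE => -[].
  by exists (k om) => //; rewrite -pieceE.
rewrite [RHS](@measure_finite_partition _ fseq_space R mu I k)//.
apply: eq_bigr => i _.
by rewrite pieceE; case: (mu_shift (tau i) (mAk i)).
Qed.

(** Infinitely many pairwise disjoint translates of this set have the same
    measure. *)
Lemma measure_vanishing_terms (s : nat -> nat) : injective s ->
  measurable ([set om : fseq F | forall i, om (s i) = 0] : set fseq_space) /\
  mu [set om : fseq F | forall i, om (s i) = 0] = 0%E.
Proof.
move=> s_inj; set N := [set om | _].
have mN : measurable (N : set fseq_space).
  rewrite (_ : N = \bigcap_i [set om : fseq F | om (s i) = 0]); last first.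
    by apply/seteqP; split=> [om h i _|om h i]; exact: h.
  apply: bigcapT_measurable => i; apply: (@measurable_finite_type _ (s i).+1) => om om' h /=.
  by rewrite h.
split=> //.
pose tau i : fseq F := fun n => (n == s i)%:R.
pose f i : set fseq_space := shift (- tau i) @^-1` N.
have mf i : measurable (f i) by case: (mu_shift (- tau i) mN).
have muf i : mu (f i) = mu N by case: (mu_shift (- tau i) mN).
have disj : trivIset setT f.
  move=> i j _ _ [om [fi fj]]; apply: s_inj.
  have := fi i; have := fj i; rewrite /shift /= /tau !fctE eqxx => /eqP.
  rewrite subr_eq0 => /eqP ->; case: eqP => // _ /eqP.
  by rewrite sub0r oppr_eq0 oner_eq0.
have muN_fin : mu N \is a fin_num by apply: fin_num_measure.
have bnd n : n%:R * fine (mu N) <= 1.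
  rewrite -lee_fin EFinM fineK//.
  apply: (@le_trans _ _ (mu (\bigcup_(i in `I_n) f i))); last first.
    by apply: probability_le1; apply: bigcup_measurable => i _; exact: mf.
  rewrite measure_fin_bigcup => [|//|i j _ _|i _]; [|exact: disj|exact: mf].
  rewrite -(fsbig_ord _ _ (fun i => mu (f i)))/= (eq_bigr (fun=> mu N)) => [|i _]; last exact: muf.
  by rewrite sumr_const card_ord mule_natl -(fineK muN_fin).
rewrite -(fineK muN_fin); congr (_%:E); apply/eqP; rewrite eq_le fine_ge0 ?andbT//.
rewrite leNgt; apply/negP => N0.
have := bnd (Num.truncn (fine (mu N))^-1).+1.
by rewrite leNgt -ltr_pdivrMr// div1r truncnS_gt.
Qed.

End translation_invariance.
(** * Neighbours of the standard subspace *)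

Section standard_neighbours.
Variable F : finFieldType.
Implicit Types (x y v : hspace F) (phi w : nat -> F) (c t : F).
Implicit Types (psi : hspace F -> F).

Definition pairing (p : ell F) phi : F :=
  \sum_(i < size (p : {poly F})) (p : {poly F})`_i * phi i.

Lemma pairing_bound n (p : ell F) phi : (size (p : {poly F}) <= n)%N ->
  pairing p phi = \sum_(i < n) (p : {poly F})`_i * phi i.
Proof.
move=> pn; have := mulvT_coef (fun i _ => phi i) pn.
by move=> /(congr1 (fun g : ell_dual F => g 0%N)).
Qed.

Lemma pairing_lin (a : F) (p q : ell F) phi :
  pairing (a *: p + q) phi = a * pairing p phi + pairing q phi.
Proof.
have := mulvT_linear (fun i _ => phi i) a p q.
by move=> /(congr1 (fun g : ell_dual F => g 0%N)).
Qed.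

Lemma pairing0 phi : pairing 0 phi = 0.
Proof. by rewrite /pairing size_poly0 big_ord0. Qed.

Lemma pairingZ (a : F) (p : ell F) phi : pairing (a *: p) phi = a * pairing p phi.
Proof. by rewrite -[a *: p]addr0 pairing_lin pairing0 addr0. Qed.

Lemma pairingXn i phi : pairing ('X^i : {poly F}) phi = phi i.
Proof.
rewrite (@pairing_bound i.+1) ?size_polyXn// (big_only1 ord_max)//= => [|j ji _].
  by rewrite coefXn eqxx mul1r.
rewrite coefXn (_ : _ == _ = false) ?mul0r//.
by apply: contraNF ji => /eqP ij; apply/eqP/val_inj.
Qed.

Lemma pairingDr (p : ell F) phi phi' (a : F) :
  pairing p (fun i => phi i + a * phi' i) = pairing p phi + a * pairing p phi'.
Proof.
rewrite /pairing mulr_sumr -big_split; apply: eq_bigr => i _ /=.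
by rewrite mulrDr mulrCA.
Qed.

Lemma pairingZr (p : ell F) phi (a : F) :
  pairing p (fun i => a * phi i) = a * pairing p phi.
Proof. by rewrite /pairing mulr_sumr; apply: eq_bigr => i _; rewrite mulrCA. Qed.

(** The neighbour [ker phi + F (w + c u)] of [ell], where [phi u = 1]; its
    intersection with [ell] is [ker phi] and its sum with [ell] is [ell + F w].
    This description avoids the choice of [u]. *)
Definition neighbour phi w c : set (hspace F) :=
  [set v | exists t, v.2 = (fun j => t * w j) /\ pairing v.1 phi = t * c].

Definition ell_space : set (hspace F) := [set v | v.2 = 0].

Definition nondegenerate phi w := (exists i, phi i != 0) /\ (exists j, w j != 0).

Lemma lsubspace_neighbour phi w c : lsubspace (neighbour phi w c).
Proof.
split.
  exists 0; rewrite /= pairing0 mul0r; split=> //.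
  by apply/funext => j; rewrite mul0r.
move=> a x y [t [x2 x1]] [s [y2 y1]]; exists (a * t + s); split.
  apply/funext => j; rewrite mulrDl -mulrA.
  have -> : t * w j = x.2 j by rewrite x2.
  by have -> : s * w j = y.2 j by rewrite y2.
by rewrite [LHS]pairing_lin x1 y1 mulrDl mulrA.
Qed.

Lemma lsubspace_ell_space : lsubspace ell_space.
Proof.
split=> // a x y x2 y2; apply/funext => j.
by rewrite [LHS](_ : _ = a * x.2 j + y.2 j)// x2 y2 mulr0 addr0.
Qed.

Lemma ell_neighbourP phi w c v : (exists j, w j != 0) ->
  (ell_space `&` neighbour phi w c) v <-> v.2 = 0 /\ pairing v.1 phi = 0.
Proof.
move=> [j wj]; split=> [[v2 [t [v2' v1]]]|[v2 v1]]; split=> //.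
  have /eqP : t * w j = 0.
    by rewrite -[LHS]/((fun j => t * w j) j) -v2' v2.
  by rewrite mulf_eq0 (negbTE wj) orbF v1 => /eqP ->; rewrite mul0r.
exists 0; rewrite v1 mul0r v2; split=> //.
by apply/funext => k; rewrite mul0r.
Qed.

Lemma pairingB (p q : ell F) (a : F) phi :
  pairing (p - a *: q) phi = pairing p phi - a * pairing q phi.
Proof. by rewrite addrC -scaleNr pairing_lin mulNr addrC. Qed.

Lemma dim_ell_neighbour phi w c : nondegenerate phi w ->
  dim_quot ell_space (ell_space `&` neighbour phi w c) 1 /\
  dim_quot (neighbour phi w c) (ell_space `&` neighbour phi w c) 1.
Proof.
move=> [[i phii] wj]; have [j wj0] := wj.
have sN := lsubspace_neighbour phi w c; have sE := lsubspace_ell_space.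
split.
  apply: (dim_quot1 (u := (('X^i : {poly F}) : ell F, 0) : hspace F)
     (phi := fun v => pairing v.1 phi / phi i)) => // v.
    move=> v2; apply/(ell_neighbourP _ _ _ wj); split.
      by rewrite /= v2 scaler0 subr0.
    by rewrite [LHS]pairingB pairingXn divfK// subrr.
  move=> a v2 /(ell_neighbourP _ _ _ wj)[_].
  rewrite [X in X = _ -> _]pairingB pairingXn => /eqP; rewrite subr_eq0 => /eqP ->.
  by rewrite mulfK.
pose u : hspace F := ((c / phi i) *: ('X^i : {poly F}) : ell F, (w : ell_dual F)).
have Nu : neighbour phi w c u.
  exists 1; rewrite mul1r; split; first by apply/funext => k; rewrite mul1r.
  by rewrite pairingZ pairingXn divfK.
have coefB v a : (v - a *: u).2 j = v.2 j - a * w j by [].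
apply: (dim_quot1 (u := u) (phi := fun v => v.2 j / w j)) => // v.
  move=> Nv; have [t [v2 v1]] := Nv.
  have tE : v.2 j / w j = t by rewrite v2 mulfK.
  have Nw : neighbour phi w c (v - (v.2 j / w j) *: u).
    by apply: lsubspaceB => //; exact: lsubspaceZ.
  split=> //; apply/funext => k; rewrite tE.
  by rewrite [LHS](_ : _ = v.2 k - t * w k)// v2 subrr.
move=> a Nv [v2 _]; have /eqP := coefB v a.
have -> : (v - a *: u).2 j = 0 by exact: (congr1 (fun g : ell_dual F => g j) v2).
by rewrite eq_sym subr_eq0 => /eqP ->; rewrite mulfK.
Qed.

(** The functional [phi] has kernel [ell `&` K]; the vector [w] and the scalar [c]
    come from an element [k] of [K] outside [ell], as [w = k.2] and
    [c = phi (k.1)]. *)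
Lemma neighbour_adjacent (K : set (hspace F)) : lsubspace K ->
  dim_quot ell_space (ell_space `&` K) 1 -> dim_quot K (ell_space `&` K) 1 ->
  exists phi w c, nondegenerate phi w /\ K = neighbour phi w c.
Proof.
move=> sK [e [Ee He]] [k [Kk Hk]].
have sE := lsubspace_ell_space; have sEK := lsubspaceI sE sK.
have proj1E x : ell_space x -> exists a, (ell_space `&` K) (x - a *: e ord0) /\
    forall b, (ell_space `&` K) (x - b *: e ord0) -> b = a.
  move=> /He[a [Ka ua]]; exists (a ord0); split; first by rewrite big_ord1 in Ka.
  move=> b Kb; have /ua -> : (ell_space `&` K) (x - \sum_i [ffun=> b] i *: e i).
    by rewrite big_ord1 ffunE.
  by rewrite ffunE.
have /choice[g Hg] x : exists a, ell_space x -> (ell_space `&` K) (x - a *: e ord0) /\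
    forall b, (ell_space `&` K) (x - b *: e ord0) -> b = a.
  by have [/proj1E[a ?]|nx] := pselect (ell_space x); [exists a|exists 0].
have g_lin (a : F) x y : ell_space x -> ell_space y -> g (a *: x + y) = a * g x + g y.
  move=> Ex Ey; symmetry; have Exy : ell_space (a *: x + y) by case: sE => _; apply.
  apply: (Hg _ Exy).2; rewrite scalerDl opprD addrACA -scalerA -scalerBr.
  by case: sEK => _; apply; [exact: (Hg _ Ex).1|exact: (Hg _ Ey).1].
have Kg x : ell_space x -> K x <-> g x = 0.
  move=> Ex; split=> [Kx|gx0]; last by have := (Hg _ Ex).1; rewrite gx0 scale0r subr0 => -[].
  by apply/esym/(Hg _ Ex).2; rewrite scale0r subr0.
have g1 : g (e ord0) = 1.
  apply/esym/(Hg _ (Ee _)).2; rewrite scale1r subrr; case: sEK => //.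
pose phi i := g ((('X^i : {poly F}) : ell F), 0).
have gE (p : ell F) : g (p, 0) = pairing p phi.
  rewrite -[p in LHS](coefK (p : {poly F})) poly_def /pairing.
  set n := size _; clearbody n; elim: n => [|n IH].
    rewrite !big_ord0; apply/esym/(Hg _ _).2 => //.
    by rewrite scale0r subr0; case: sEK.
  rewrite !big_ord_recr/= -IH addrC [RHS]addrC -g_lin//; congr (g _).
  by congr (_, _); rewrite /= scaler0 addr0.
have [k1 Kk1] : exists j, (k ord0).2 j != 0.
  apply: contrapT => /forallNP nk.
  have Ek : ell_space (k ord0).
    by apply/funext => j; apply/eqP/negPn/negP/nk.
  have [a [_ ua]] := Hk _ (Kk ord0).
  have a1 : a = [ffun=> 1].
    by apply: ua; rewrite big_ord1 ffunE scale1r subrr; case: sEK.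
  have a0 : a = [ffun=> 0] by apply: ua; rewrite big_ord1 ffunE scale0r subr0.
  have := congr1 (fun d : {ffun 'I_1 -> F} => d ord0) (etrans (esym a1) a0).
  by rewrite !ffunE => /eqP; rewrite oner_eq0.
exists phi, (k ord0).2, (pairing (k ord0).1 phi); split.
  split; last by exists k1.
  apply: contrapT => /forallNP nphi.
  have : g ((e ord0).1, 0) = 0.
    rewrite gE /pairing big1// => i _; apply/eqP; rewrite mulf_eq0; apply/orP; right.
    exact/negPn/negP/nphi.
  have -> : ((e ord0).1, 0) = e ord0.
    by have := Ee ord0; rewrite /ell_space /= => <-; case: (e ord0).
  by rewrite g1 => /eqP; rewrite oner_eq0.
have ellE x t : x.2 = (fun j => t * (k ord0).2 j) -> ell_space (x - t *: k ord0).
  move=> x2; apply/funext => j.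
  by rewrite [LHS](_ : _ = x.2 j - t * (k ord0).2 j)// x2 subrr.
have gB x t : ell_space (x - t *: k ord0) ->
    g (x - t *: k ord0) = pairing x.1 phi - t * pairing (k ord0).1 phi.
  move=> Ex; rewrite -pairingB -gE; congr (g _).
  by rewrite [LHS]surjective_pairing; congr (_, _).
apply/seteqP; split=> x.
  move=> Kx; have [a [+ _]] := Hk _ Kx; rewrite big_ord1 => -[Ea Ka].
  exists (a ord0); split.
    apply/funext => j; apply/eqP; rewrite -subr_eq0; apply/eqP.
    by rewrite -[LHS]/((x - a ord0 *: k ord0).2 j) Ea.
  by apply/eqP; rewrite -subr_eq0 -gB//; apply/eqP/(Kg _ Ea).
move=> [t [x2 x1]]; have Ex := ellE _ _ x2.
have Kxt : K (x - t *: k ord0) by apply/(Kg _ Ex); rewrite gB// x1 subrr.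
by rewrite -[x](subrK (t *: k ord0)); apply: lsubspaceD => //; exact: lsubspaceZ.
Qed.

Lemma neighbour_scale_functional phi w c (a : F) : a != 0 ->
  neighbour (fun i => a * phi i) w (a * c) = neighbour phi w c.
Proof.
move=> a0; apply/seteqP; split=> x [t [x2 x1]]; exists t; split=> //.
  by move: x1; rewrite pairingZr mulrCA => /(mulfI a0).
by rewrite pairingZr x1 mulrCA.
Qed.

Lemma neighbour_scale_vector phi w c (a : F) : a != 0 ->
  neighbour phi (fun i => a * w i) (a * c) = neighbour phi w c.
Proof.
move=> a0; apply/seteqP; split=> x [t [x2 x1]].
  exists (t * a); rewrite x1 mulrA; split=> //.
  by rewrite x2; apply/funext => j; rewrite mulrA.
exists (t / a); rewrite x1 mulrA divfK//; split=> //.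
by rewrite x2; apply/funext => j; rewrite mulrA divfK.
Qed.

(** * Transvections *)

Definition linear_form (psi : hspace F -> F) :=
  forall a x y, psi (a *: x + y) = a * psi x + psi y.

Definition transvection (psi : hspace F -> F) y v := v + psi v *: y.

Lemma linear_form0 psi : linear_form psi -> psi 0 = 0.
Proof.
by move=> psiL; have := psiL (-1) 0 0; rewrite scaler0 addr0 mulN1r addNr.
Qed.

Lemma linear_formD psi x y : linear_form psi -> psi (x + y) = psi x + psi y.
Proof. by move=> psiL; rewrite -[x]scale1r psiL mul1r scale1r. Qed.

Lemma linear_formZ psi (a : F) x : linear_form psi -> psi (a *: x) = a * psi x.
Proof.
by move=> psiL; rewrite -[a *: x]addr0 psiL linear_form0// addr0.
Qed.

Lemma transvectionK psi y : linear_form psi -> psi y = 0 ->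
  cancel (transvection psi y) (transvection (fun v => - psi v) y).
Proof.
move=> psiL py x; rewrite /transvection linear_formD// linear_formZ// py mulr0 addr0.
by rewrite scaleNr addrK.
Qed.

(** The transvection preserves [ell] by the last clause: [y] is in [ell] or [psi]
    vanishes on [ell]. In both cases [psi y = 0] splits into the two preceding
    equations. *)
Definition transvection_data (psi : hspace F -> F) y := [/\ linear_form psi,
  exists n, forall v, tail n v -> psi v = 0,
  psi (y.1, 0) = 0, psi (0, y.2) = 0 &
  y.2 = 0 \/ forall p, psi (p, 0) = 0].

(** The next three functions give the parameters of the inverse image of a
    neighbour under a transvection. *)
Definition act_functional psi y phi : nat -> F :=
  fun i => phi i + pairing y.1 phi * psi ((('X^i : {poly F}) : ell F), 0).
Definition act_vector (psi : hspace F -> F) y w : nat -> F :=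
  fun j => w j - psi (0, w : ell_dual F) * y.2 j.
Definition act_scalar (psi : hspace F -> F) y phi w c : F :=
  c - psi (0, w : ell_dual F) * pairing y.1 phi.

Lemma linear_form_ell psi (p : ell F) : linear_form psi ->
  psi (p, 0) = pairing p (fun i => psi ((('X^i : {poly F}) : ell F), 0)).
Proof.
move=> psiL; rewrite -[p in LHS](coefK (p : {poly F})) poly_def /pairing.
set n := size _; clearbody n; elim: n => [|n IH].
  by rewrite !big_ord0; exact: linear_form0.
rewrite !big_ord_recr/= -IH addrC [RHS]addrC -psiL; congr (psi _).
by congr (_, _); rewrite /= scaler0 addr0.
Qed.

Lemma linear_form_split psi v : linear_form psi -> psi v = psi (v.1, 0) + psi (0, v.2).
Proof.
move=> psiL; rewrite -linear_formD//; congr (psi _).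
by rewrite [LHS]surjective_pairing; congr (_, _); rewrite /= ?addr0 ?add0r.
Qed.

Lemma linear_form_dual psi w (t : F) : linear_form psi ->
  psi (0, (fun j => t * w j) : ell_dual F) = t * psi (0, w : ell_dual F).
Proof.
by move=> psiL; rewrite -linear_formZ//; congr (psi _); congr (_, _); rewrite scaler0.
Qed.

(** On the inverse image, [psi v] is the sum of [psi (v.1, 0)] and [t * psi (0, w)],
    so that the defining equations are again of the same form. *)
Lemma neighbour_transvection psi y phi w c v : transvection_data psi y ->
  neighbour phi w c (transvection psi y v) <->
  neighbour (act_functional psi y phi) (act_vector psi y w)
    (act_scalar psi y phi w c) v.
Proof.
move=> [psiL _ py1 py2 yp].
have pairT : pairing (transvection psi y v).1 phi = pairing v.1 phi + psi v * pairing y.1 phi.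
  have T1 : (transvection psi y v).1 = psi v *: y.1 + v.1 by exact: addrC.
  by rewrite T1 pairing_lin addrC.
have TE j : (transvection psi y v).2 j = v.2 j + psi v * y.2 j by [].
have pairA : pairing v.1 (act_functional psi y phi) =
    pairing v.1 phi + pairing y.1 phi * psi (v.1, 0).
  by rewrite pairingDr linear_form_ell.
case: yp => [y2|psi1].
  have actw : act_vector psi y w = w.
    by apply/funext => j; rewrite /act_vector y2 mulr0 subr0.
  have key t : v.2 = (fun j => t * w j) -> psi v = psi (v.1, 0) + t * psi (0, w : ell_dual F).
    by move=> v2; rewrite (linear_form_split v)// v2 linear_form_dual.
  rewrite actw; split=> -[t [v2 v1]]; exists t.
    have {}v2 : v.2 = (fun j => t * w j).
      by rewrite -v2; apply/funext => j; rewrite TE y2 mulr0 addr0.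
    split=> //; rewrite pairA /act_scalar; move: v1; rewrite pairT (key t)// => v1.
    by apply/eqP; rewrite -subr_eq0 mulrBr -v1; apply/eqP; ring.
  split; first by rewrite -v2; apply/funext => j; rewrite TE y2 mulr0 addr0.
  move: v1; rewrite pairA pairT (key t)// /act_scalar mulrBr => v1.
  have -> : t * c = pairing v.1 phi + pairing y.1 phi * psi (v.1, 0) +
     t * (psi (0, w : ell_dual F) * pairing y.1 phi) by rewrite v1 subrK.
  by ring.
have key t : v.2 = (fun j => t * act_vector psi y w j) ->
    psi v = t * psi (0, w : ell_dual F).
  move=> v2; rewrite (linear_form_split v)// psi1 add0r v2 linear_form_dual//.
  congr (_ * _); rewrite (_ : (0, act_vector psi y w : ell_dual F) =
    (- psi (0, w : ell_dual F)) *: (0, y.2) + (0, w : ell_dual F)).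
    by rewrite psiL py2 mulr0 add0r.
  congr (_, _); first by rewrite /= scaler0 addr0.
  apply/funext => j; rewrite /act_vector addrC.
  by rewrite [RHS](_ : _ = - psi (0, w : ell_dual F) * y.2 j + w j)// mulNr.
split=> -[t [v2 v1]]; exists t.
  have pv : psi v = t * psi (0, w : ell_dual F).
    rewrite -linear_form_dual// -v2.
    have -> : (0, (transvection psi y v).2) = psi v *: (0, y.2) + (0, v.2) :> hspace F.
      congr (_, _); first by rewrite /= scaler0 addr0.
      by rewrite addrC.
    by rewrite psiL py2 mulr0 add0r {1}(linear_form_split v)// psi1 add0r.
  split.
    apply/funext => j; rewrite /act_vector mulrBr mulrA -pv.
    have := TE j; rewrite v2 => ->; by rewrite addrK.
  rewrite pairA psi1 mulr0 addr0 /act_scalar mulrBr mulrA -pv -v1 pairT.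
  by rewrite addrK.
have pv := key t v2; split.
  apply/funext => j; rewrite TE pv v2 /act_vector.
  by ring.
rewrite pairT pv; move: v1; rewrite pairA psi1 mulr0 addr0 /act_scalar => ->.
by ring.
Qed.

(** The two coordinates that enter the action are invariant under it. *)
Lemma pairing_act_functional psi y phi : transvection_data psi y ->
  forall a, pairing y.1 (fun i => phi i + a * psi ((('X^i : {poly F}) : ell F), 0)) =
    pairing y.1 phi.
Proof.
move=> [psiL _ py1 _ _] a.
by rewrite pairingDr -linear_form_ell// py1 mulr0 addr0.
Qed.

Lemma form_act_vector psi y w : transvection_data psi y ->
  forall a, psi (0, (fun j => w j - a * y.2 j) : ell_dual F) = psi (0, w : ell_dual F).
Proof.
move=> [psiL _ _ py2 _] a.
rewrite (_ : (0, _) = (- a) *: (0, y.2) + (0, w : ell_dual F) :> hspace F).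
  by rewrite psiL py2 mulr0 add0r.
congr (_, _); first by rewrite /= scaler0 addr0.
apply/funext => j; rewrite addrC.
by rewrite [RHS](_ : _ = - a * y.2 j + w j)// mulNr.
Qed.

End standard_neighbours.
(** * Automorphisms that fix the given point *)

Section stabilizer_action.
Variables (F : finFieldType) (L : Gr0 F).
Implicit Types (psi : hspace F -> F) (x y v : hspace F).

Lemma dim_quot_preimage (g g' : hspace F -> hspace F) (A B : set (hspace F)) n :
  lin g -> cancel g g' -> cancel g' g -> lsubspace A ->
  dim_quot A B n -> dim_quot (g @^-1` A) (g @^-1` B) n.
Proof.
move=> gL gK g'K sA dAB.
have g'L : lin g'.
  by move=> a x y; apply: (can_inj gK); rewrite gL !g'K.
have <- : g' @` A = g @^-1` A.
  by apply/seteqP; split=> [_ [x Ax <-]|x Ax]; [rewrite /= g'K|exists (g x)].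
by apply: (dim_quot_image g'L sA) dAB => x Ax /=; rewrite g'K.
Qed.

Lemma lsubspace_preimage (g : hspace F -> hspace F) (A : set (hspace F)) :
  lin g -> lsubspace A -> lsubspace (g @^-1` A).
Proof.
move=> gL [A0 sA]; have g0 : g 0 = 0.
  by have := gL (-1) 0 0; rewrite scaler0 addr0 scaleN1r addNr.
by split=> [|a x y Ax Ay] /=; rewrite ?g0// gL; exact: sA.
Qed.

Lemma lsubspace_Gr0 (K : Gr0 F) : lsubspace (K : set (hspace F)).
Proof. by have [[sK _] _] := svalP K. Qed.

Lemma Sigma_of_set (K : set (hspace F)) : lsubspace K ->
  dim_quot (L : set _) (L `&` K) 1 -> dim_quot K (L `&` K) 1 ->
  exists K' : Sigma_set L, space_of K' = K.
Proof.
move=> sK dL dK; have gK := is_Gr0_adjacent (svalP L) sK dL dK.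
by exists (exist _ (exist _ K gK) (conj dL dK)).
Qed.

(** A bicontinuous automorphism fixing [L] acts on [Sigma_L] by measurable
    maps, since it permutes the open sets. *)
Lemma Sigma_automorphism (g g' : hspace F -> hspace F) : bicontinuous g g' ->
  (forall x, Gr0_set L (g x) <-> Gr0_set L x) ->
  exists T : Sigma_set L -> Sigma_set L,
    [/\ forall K, space_of (T K) = g @^-1` space_of K,
        measurable_fun setT (T : Sigma L -> Sigma L) &
        forall A, translate g A = T @^-1` A].
Proof.
move=> [gL gK g'K gc g'c] gLL.
have /choice[T TE] (K : Sigma_set L) : exists K' : Sigma_set L,
    space_of K' = g @^-1` space_of K.
  have sK : lsubspace (space_of K) by exact: lsubspace_Gr0.
  have LE : Gr0_set L = g @^-1` Gr0_set L by apply/seteqP; split=> x /gLL.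
  have [dL dK] := svalP K.
  apply: Sigma_of_set; first exact: lsubspace_preimage.
    rewrite LE -preimage_setI; apply: dim_quot_preimage gL gK g'K _ dL.
    exact: lsubspace_Gr0.
  rewrite LE -preimage_setI; exact: dim_quot_preimage gL gK g'K _ dK.
exists T; split=> //.
  apply: (@measurability _ _ (Sigma L) (Sigma L) setT T _ (Sigma_measurableE L)).
  move=> _ [_ [U oU <-] <-]; rewrite setTI.
  rewrite (_ : _ @^-1` _ = @hit F L (g' @^-1` U)).
    apply: measurable_hit; apply: lopen_preimage => //.
    by move=> a x y; apply: (can_inj gK); rewrite gL !g'K.
  apply/seteqP; split=> K [x [Kx Ux]].
    by exists (g x); rewrite /= gK; split=> //; move: Kx; rewrite TE.
  by exists (g' x); split=> //; rewrite TE /= g'K.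
move=> A; apply/seteqP; split=> [K [K' AK' KK']|K AK].
  rewrite /= (_ : T K = K')//; apply: space_of_inj; rewrite TE /space_of KK'.
  apply/seteqP; split=> [x [z Kz]|x Kx]; last by exists x.
  by move/(can_inj gK) => <-.
exists (T K) => //; rewrite -/(space_of (T K)) TE.
apply/seteqP; split=> [x Kx|_ [x Kx <-]//].
by exists (g' x); rewrite /= g'K.
Qed.

Definition fixing_transvection psi y := [/\ linear_form psi,
  exists n, forall v, tail n v -> psi v = 0, psi y = 0 &
  Gr0_set L y \/ forall x, Gr0_set L x -> psi x = 0].

Definition transvection_invariant (R : realType) (nu : probability (Sigma L) R) :=
  forall psi y, fixing_transvection psi y ->
  forall A : set (Sigma L), measurable A -> nu (translate (transvection psi y) A) = nu A.

Lemma bicontinuous_transvection psi y : linear_form psi -> psi y = 0 ->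
  (exists n, forall v, tail n v -> psi v = 0) ->
  bicontinuous (transvection psi y) (transvection (fun v => - psi v) y).
Proof.
move=> psiL py [n pn].
have npsiL : linear_form (fun v => - psi v).
  by move=> a u v; rewrite psiL opprD mulrN.
have tlin (chi : hspace F -> F) : linear_form chi -> lin (transvection chi y).
  move=> chiL a u v; rewrite /transvection chiL scalerDl scalerDr -scalerA.
  by rewrite addrACA.
have tcont (chi : hspace F -> F) : (forall v, tail n v -> chi v = 0) ->
    contin0 (transvection chi y).
  move=> chi0 m; exists (maxn m n) => x tx; rewrite /transvection chi0.
    by rewrite scale0r addr0; apply: tailS tx; exact: leq_maxl.
  by apply: tailS tx; exact: leq_maxr.
split=> //; [exact: tlin|exact: transvectionK| |exact: tcont|].
  move=> x; rewrite -[RHS](transvectionK (y := y) npsiL _ x); last by rewrite py oppr0.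
  by congr (transvection _ _ _); apply/funext => v; rewrite opprK.
by apply: tcont => v /pn ->; rewrite oppr0.
Qed.

Lemma fixing_transvection_stable psi y : fixing_transvection psi y ->
  forall x, Gr0_set L (transvection psi y x) <-> Gr0_set L x.
Proof.
move=> [psiL _ py Ly] x; have sL := lsubspace_Gr0 L; rewrite /transvection.
case: Ly => [Ly|L0]; last first.
  split=> Lx; last by rewrite L0// scale0r addr0.
  have : psi (x + psi x *: y) = 0 by exact: L0.
  rewrite linear_formD// linear_formZ// py mulr0 addr0 => px.
  by move: Lx; rewrite px scale0r addr0.
split=> [Lx|Lx]; last by apply: lsubspaceD => //; exact: lsubspaceZ.
by rewrite -[x](addrK (psi x *: y)); apply: lsubspaceB => //; exact: lsubspaceZ.
Qed.

Section coordinates.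
Variables f h : hspace F -> hspace F.
Hypothesis fh : bicontinuous f h.
Hypothesis fL : forall x, Gr0_set L x <-> (f x).2 = 0.

Let f_lin : lin f. Proof. by case: fh. Qed.
Let fK : cancel f h. Proof. by case: fh. Qed.
Let hK : cancel h f. Proof. by case: fh. Qed.
Let f_cont : contin0 f. Proof. by case: fh. Qed.
Let h_cont : contin0 h. Proof. by case: fh. Qed.
Let h_lin : lin h.
Proof. by move=> a x y; apply: (can_inj fK); rewrite f_lin !hK. Qed.

Let LE : Gr0_set L = f @^-1` @ell_space F.
Proof. by apply/seteqP; split=> x /fL. Qed.

Lemma transvection_data_coord psi y : fixing_transvection psi y ->
  transvection_data (psi \o h) (f y).
Proof.
move=> [psiL [n pn] py Ly].
have pL : linear_form (psi \o h) by move=> a u v; rewrite /= h_lin psiL.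
have p_split : psi (h ((f y).1, 0)) + psi (h (0, (f y).2)) = 0.
  by rewrite -[LHS](linear_form_split (psi := psi \o h) (f y) pL) /= fK.
have Lh (p : ell F) : Gr0_set L (h (p, 0)) by apply/fL; rewrite hK.
split=> //.
- by have [m hm] := h_cont n; exists m => v /hm/pn.
- case: Ly => [/fL y2|L0]; last exact: L0.
  by rewrite /= (_ : (_, _) = f y) ?fK// -y2; case: (f y).
- case: Ly => [/fL y2|L0].
    by rewrite y2; exact: (linear_form0 pL).
  by move: p_split; rewrite /= L0// add0r.
- by case: Ly => [/fL ->|L0]; [left|right=> p /=; exact: L0].
Qed.

End coordinates.
End stabilizer_action.
(** * An invariant random neighbour *)

Section random_neighbour.
Variables (F : finFieldType) (L : Gr0 F) (f h : hspace F -> hspace F).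
Hypothesis fh : bicontinuous f h.
Hypothesis fL : forall x, Gr0_set L x <-> (f x).2 = 0.

Notation fseq_space := (g_sigma_algebraType (@cylinders F)).
Implicit Types (phi w : nat -> F) (c t : F) (om : fseq F).

Let f_lin : lin f. Proof. by case: fh. Qed.
Let fK : cancel f h. Proof. by case: fh. Qed.
Let hK : cancel h f. Proof. by case: fh. Qed.
Let h_cont : contin0 h. Proof. by case: fh. Qed.
Let h_lin : lin h.
Proof. by move=> a x y; apply: (can_inj fK); rewrite f_lin !hK. Qed.

Let LE : Gr0_set L = f @^-1` @ell_space F.
Proof. by apply/seteqP; split=> x /fL. Qed.

Lemma neighbour_in_Sigma phi w c : nondegenerate phi w ->
  exists K : Sigma_set L, space_of K = f @^-1` neighbour phi w c.
Proof.
move=> nd; have [d1 d2] := dim_ell_neighbour c nd.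
apply: Sigma_of_set; first by apply: lsubspace_preimage => //; exact: lsubspace_neighbour.
  rewrite LE -preimage_setI; apply: dim_quot_preimage f_lin fK hK _ d1.
  exact: lsubspace_ell_space.
rewrite LE -preimage_setI; apply: dim_quot_preimage f_lin fK hK _ d2.
exact: lsubspace_neighbour.
Qed.

Lemma Sigma_neighbour (K : Sigma_set L) : exists phi w c,
  nondegenerate phi w /\ space_of K = f @^-1` neighbour phi w c.
Proof.
have sK : lsubspace (space_of K) by exact: lsubspace_Gr0.
have [dL dK] := svalP K.
have hLK : h @^-1` (Gr0_set L `&` space_of K) = @ell_space F `&` h @^-1` space_of K.
  by rewrite preimage_setI LE -comp_preimage; congr (_ `&` _);
    apply/seteqP; split=> x; rewrite /= hK.
have [|||phi [w [c [nd KE]]]] := @neighbour_adjacent F (h @^-1` space_of K).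
- exact: lsubspace_preimage.
- rewrite -hLK (_ : @ell_space F = h @^-1` Gr0_set L).
    by apply: dim_quot_preimage h_lin hK fK _ dL; exact: lsubspace_Gr0.
  by rewrite LE; apply/seteqP; split=> x; rewrite /= hK.
- by rewrite -hLK; exact: dim_quot_preimage h_lin hK fK _ dK.
exists phi, w, c; split=> //; rewrite -KE.
by apply/seteqP; split=> x; rewrite /= fK.
Qed.

(** A single sequence of elements of [F] encodes the functional, the vector and
    the scalar of a neighbour. *)
Definition functional_of om : nat -> F := fun i => om i.*2.+1.
Definition vector_of om : nat -> F := fun j => om j.*2.+2.
Definition scalar_of om : F := om 0%N.
Definition parameters phi w c : fseq F :=
  fun n => if n is m.+1 then if odd m then w m./2 else phi m./2 else c.

Definition generic om := nondegenerate (functional_of om) (vector_of om).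

Definition neighbour_point phi w c : Sigma_set L :=
  if pselect (nondegenerate phi w) is left nd then
    sval (cid (neighbour_in_Sigma c nd))
  else point.

Lemma neighbour_pointE phi w c : nondegenerate phi w ->
  space_of (neighbour_point phi w c) = f @^-1` neighbour phi w c.
Proof.
by rewrite /neighbour_point; case: pselect => // nd _; case: cid.
Qed.

Definition random_neighbour om : Sigma_set L :=
  neighbour_point (functional_of om) (vector_of om) (scalar_of om).

Lemma random_neighbourE om : generic om -> space_of (random_neighbour om) =
  f @^-1` neighbour (functional_of om) (vector_of om) (scalar_of om).
Proof. exact: neighbour_pointE. Qed.

Lemma measurable_pairing_eq (p : ell F) (a : fseq F -> F) :
  (forall b, measurable ([set om | a om = b] : set fseq_space)) ->
  measurable ([set om | pairing p (functional_of om) = a om] : set fseq_space).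
Proof.
move=> ma.
rewrite (_ : [set om | _] = \bigcup_(b : F)
   ([set om | pairing p (functional_of om) = b] `&` [set om | a om = b])); last first.
  by apply/seteqP; split=> [om e|om [b _ [/= -> ->]]//]; exists (a om).
apply: (@fin_bigcup_measurable _ fseq_space); first exact: finite_finset.
move=> b _; apply: (@measurableI _ fseq_space) => //.
apply: (@measurable_finite_type _ (size (p : {poly F})).*2) => om om' e /= <-.
apply: eq_bigr => i _; congr (_ * _); apply: e.
by rewrite -doubleS leq_double.
Qed.

(** Membership in an open set is decided by finitely many coordinates, though
    their number is not bounded. *)
Lemma measurable_vector_open (U : set (hspace F)) (p : ell F) t : lopen U ->
  measurable ([set om | U (p, (fun j => t * vector_of om j) : ell_dual F)] : set fseq_space).
Proof.
move=> oU; pose z om : hspace F := (p, (fun j => t * vector_of om j) : ell_dual F).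
rewrite (_ : [set om | _] = \bigcup_n [set om | forall y, tail n y -> U (z om + y)]).
  apply: (@bigcupT_measurable _ fseq_space) => n.
  apply: (@measurable_finite_type _ n.*2.+1) => om om' e /= Uom y ty.
  have -> : z om' + y = z om + (z om' - z om + y) by rewrite addrA [z om + _]addrC subrK.
  apply: Uom; apply: lsubspaceD => //; first exact: lsubspace_tail.
  split=> [|j jn]; first by rewrite /= subrr.
  rewrite [LHS](_ : _ = t * vector_of om' j - t * vector_of om j)//.
  by rewrite /vector_of (e j.*2.+2) ?subrr// -doubleS ltnS leq_double.
apply/seteqP; split=> [om /oU[n nU]|om [n _ nU]]; first by exists n.
by rewrite /= -/(z om) -[z om]addr0; apply: nU; case: (lsubspace_tail F n).
Qed.

Variable R : realType.
Variable mu : probability fseq_space R.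
Hypothesis mu_shift : forall (tau : fseq F) (A : set fseq_space), measurable A ->
  measurable (shift tau @^-1` A : set fseq_space) /\ mu (shift tau @^-1` A) = mu A.

Lemma generic_ae : measurable (generic : set fseq_space) /\ mu (~` generic) = 0%E.
Proof.
have [|m1 mu1] := measure_vanishing_terms mu_shift (s := fun i => i.*2.+1).
  by move=> i j []; exact: double_inj.
have [|m2 mu2] := measure_vanishing_terms mu_shift (s := fun i => i.*2.+2).
  by move=> i j []; exact: double_inj.
have gE : ~` generic = [set om : fseq F | forall i, om i.*2.+1 = 0] `|`
    [set om : fseq F | forall i, om i.*2.+2 = 0].
  apply/seteqP; split=> om.
    move=> /not_andP[] /forallNP n0; [left|right] => i;
    by apply/eqP/negPn/negP; exact: n0.
  move=> [] om0 [[i phii] [j wj]].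
    by move: phii; rewrite /functional_of om0 eqxx.
  by move: wj; rewrite /vector_of om0 eqxx.
have mg : measurable (~` generic : set fseq_space).
  by rewrite gE; exact: (@measurableU _ fseq_space).
split; first by rewrite -[generic]setCK; exact: measurableC.
rewrite gE; apply/eqP; rewrite eq_le measure_ge0 andbT.
by apply: (le_trans (measureU2 mu m1 m2)); rewrite [X in (X + _)%E]mu1 [X in (_ + X)%E]mu2 adde0.
Qed.

Lemma eq_measure_generic (A B : set fseq_space) : measurable A -> measurable B ->
  (forall om, generic om -> A om <-> B om) -> mu A = mu B.
Proof.
move=> mA mB AB; have [mg mu0] := generic_ae.
have split_generic (C : set fseq_space) : measurable C -> mu C = mu (C `&` generic).
  move=> mC; rewrite -[in LHS](setIT C) -(setvU generic) setIUr.
  rewrite measureU; last 3 first.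
  - by apply: (@measurableI _ fseq_space) => //; exact: measurableC.
  - exact: (@measurableI _ fseq_space).
  - by rewrite setIACA setICl setI0.
  rewrite [X in (X + _)%E](_ : _ = 0%E) ?add0e//.
  apply/eqP; rewrite eq_le measure_ge0 andbT -mu0.
  apply: le_measure; rewrite ?inE; last by move=> om [].
    by apply: (@measurableI _ fseq_space) => //; exact: measurableC.
  exact: measurableC.
rewrite (split_generic A)// (split_generic B)//; congr (mu _).
by apply/seteqP; split=> om [? g]; split=> //; apply/(AB om g).
Qed.

Lemma measurable_random_neighbour :
  measurable_fun setT (random_neighbour : fseq_space -> Sigma L).
Proof.
have [mg _] := generic_ae.
apply: (@measurability _ _ fseq_space (Sigma L) setT _ _ (Sigma_measurableE L)).
move=> _ [_ [U oU <-] <-]; rewrite setTI.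
pose U' := h @^-1` U.
have oU' : lopen U' by exact: lopen_preimage.
pose hits := \bigcup_(pt : {poly F} * F)
  ([set om | U' (pt.1 : ell F, (fun j => pt.2 * vector_of om j) : ell_dual F)] `&`
   [set om | pairing (pt.1 : ell F) (functional_of om) = pt.2 * scalar_of om]).
rewrite (_ : _ @^-1` _ = (generic `&` hits) `|`
   (if `[< hit U (point : Sigma_set L) >] then ~` generic else set0)).
  apply: (@measurableU _ fseq_space).
    apply: (@measurableI _ fseq_space) => //.
    apply: (@countable_bigcupT_measurable _ fseq_space); first exact: countableP.
    move=> [p t]; apply: (@measurableI _ fseq_space).
      exact: measurable_vector_open.
    apply: measurable_pairing_eq => b /=.
    apply: (@measurable_finite_type _ 1) => om om' e /= <-.
    by rewrite /scalar_of (e 0%N).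
  by case: ifP => _ //; exact: measurableC.
have hitE om : generic om -> hit U (random_neighbour om) <-> hits om.
  move=> g; rewrite /hit /= random_neighbourE//; split.
    move=> [x [[t [x2 x1]] Ux]]; exists ((f x).1 : {poly F}, t) => //; split=> //=.
    by rewrite /U' /= -x2 (_ : (_, _) = f x) ?fK//; case: (f x).
  move=> [[p t] _ [/= Ux e]]; exists (h (p, (fun j => t * vector_of om j) : ell_dual F)).
  by split=> //=; rewrite hK; exists t.
apply/seteqP; split=> om /=.
  have [g|ng] := pselect (generic om); first by move=> /(hitE _ g); left.
  rewrite /random_neighbour /neighbour_point; case: pselect => // _ hp; right.
  by case: asboolP.
move=> [[g /(hitE _ g)]//|]; case: asboolP => // hp ng.
by rewrite /random_neighbour /neighbour_point; case: pselect.
Qed.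

Lemma measurable_linear_form psi (b : F) : linear_form psi ->
  (exists n, forall v, tail n v -> psi v = 0) ->
  measurable ([set om | psi (0, vector_of om : ell_dual F) = b] : set fseq_space).
Proof.
move=> psiL [n pn]; apply: (@measurable_finite_type _ n.*2.+1) => om om' e /= <-.
apply/eqP; rewrite -subr_eq0 -mulN1r -linear_formZ// -linear_formD//.
apply/eqP/pn; split=> [|j jn]; first by rewrite /= scaler0 addr0.
rewrite [LHS](_ : _ = vector_of om' j + -1 * vector_of om j)//.
by rewrite mulN1r /vector_of (e j.*2.+2) ?subrr// -doubleS ltnS leq_double.
Qed.

(** A transvection acts on the parameters by a translation, which depends only on
    two linear functions [k] of the parameters. It preserves [k], so that the
    action is a translation on each of finitely many invariant pieces. *)
Lemma random_neighbour_invariant psi y (A : set (Sigma L)) :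
  fixing_transvection L psi y -> measurable A ->
  mu (random_neighbour @^-1` translate (transvection psi y) A) =
  mu (random_neighbour @^-1` A).
Proof.
move=> tpy mA; have [psiL pn py Ly] := tpy.
have bic := bicontinuous_transvection psiL py pn.
have [T [TE mT ->]] := Sigma_automorphism bic (fixing_transvection_stable tpy).
have td := transvection_data_coord fh fL tpy.
set psi' := psi \o h in td; set y' := f y in td.
have [psi'L psi'n _ _ _] := td.
pose k om : F * F := (pairing y'.1 (functional_of om), psi' (0, vector_of om : ell_dual F)).
pose tau (ab : F * F) : fseq F := parameters
  (fun i => ab.1 * psi' ((('X^i : {poly F}) : ell F), 0))
  (fun j => - ab.2 * y'.2 j) (- (ab.2 * ab.1)).
have fun_shift om ab : functional_of (shift (tau ab) om) =
    fun i => functional_of om i + ab.1 * psi' ((('X^i : {poly F}) : ell F), 0).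
  apply/funext => i; rewrite /functional_of /shift; congr (_ + _).
  by rewrite /= odd_double doubleK.
have vec_shift om ab : vector_of (shift (tau ab) om) =
    fun j => vector_of om j - ab.2 * y'.2 j.
  apply/funext => j; rewrite /vector_of /shift; congr (_ + _).
  by rewrite /= odd_double/= uphalf_double mulNr.
have k_shift ab om : k (shift (tau ab) om) = k om.
  rewrite /k fun_shift vec_shift (pairing_act_functional _ td).
  by rewrite (form_act_vector _ td).
have mk ab : measurable ([set om | k om = ab] : set fseq_space).
  case: ab => a b; rewrite (_ : [set om | _] =
    [set om | pairing y'.1 (functional_of om) = a] `&`
    [set om | psi' (0, vector_of om : ell_dual F) = b]).
    apply: (@measurableI _ fseq_space); last exact: measurable_linear_form.
    apply: measurable_pairing_eq => c /=; have [ac|ac] := pselect (a = c).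
      by rewrite (_ : [set om | _] = setT)//; apply/seteqP; split.
    by rewrite (_ : [set om | _] = set0)//; apply/seteqP; split.
  by apply/seteqP; split=> om; [case=> <- <-|move=> [/= pa pb]; rewrite /k pa pb].
have mAr : measurable (random_neighbour @^-1` A : set fseq_space).
  by rewrite -[X in measurable X]setTI; exact: measurable_random_neighbour.
rewrite -(measure_piecewise_shift mu_shift mk k_shift mAr).
apply: eq_measure_generic.
- rewrite -[X in measurable X]setTI -comp_preimage.
  exact: (measurableT_comp mT measurable_random_neighbour).
- rewrite (_ : [set om | _] = \bigcup_(ab : F * F)
    ([set om | k om = ab] `&` shift (tau ab) @^-1` (random_neighbour @^-1` A))).
    apply: (@fin_bigcup_measurable _ fseq_space); first exact: finite_finset.
    by move=> ab _; apply: (@measurableI _ fseq_space) => //; exact: (mu_shift _ mAr).1.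
  by apply/seteqP; split=> [om Aom|om [ab _ [/= <-]]//]; exists (k om).
move=> om g; set om' := shift (tau (k om)) om.
have g' : generic om'.
  have [[i phii] [j wj]] := g; split; apply: contrapT => /forallNP n0.
    have k1 : (k om).1 = 0.
      rewrite -(k_shift (k om)) /= /pairing big1// => l _.
      by apply/eqP; rewrite mulf_eq0; apply/orP; right; exact/negPn/negP/n0.
    by apply: (n0 i); rewrite fun_shift k1 mul0r addr0.
  have k2 : (k om).2 = 0.
    rewrite -(k_shift (k om)) /= (_ : (0, _) = 0) ?linear_form0//.
    by congr (_, _); apply/funext => l; apply/eqP/negPn/negP/n0.
  by apply: (n0 j); rewrite vec_shift k2 mul0r subr0.
rewrite /= (_ : T (random_neighbour om) = random_neighbour om')//.
apply: space_of_inj; rewrite TE !random_neighbourE//.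
have fT x : f (transvection psi y x) = transvection psi' y' (f x).
  by rewrite /transvection /psi' /= fK addrC f_lin addrC.
apply/seteqP; split=> x.
  rewrite /= fT => /(neighbour_transvection _ _ _ _ td).
  by rewrite fun_shift vec_shift.
rewrite /= fT fun_shift vec_shift => ?.
exact/(neighbour_transvection _ _ _ _ td).
Qed.

End random_neighbour.

Lemma exists_transvection_invariant (F : finFieldType) (R : realType) (L : Gr0 F) :
  exists nu : probability (Sigma L) R, transvection_invariant nu.
Proof.
have [f [h [fh fL]]] := straighten_Gr0 (svalP L).
have [mu mu_cyl] := exists_uniform_sequences F R.
have mu_shift := uniform_translation mu_cyl.
have [nu nuE] := pushforward_probability mu (measurable_random_neighbour fh fL mu_shift).
exists nu => psi y tpy A mA; rewrite !nuE.
exact: (random_neighbour_invariant fh fL mu_shift tpy mA).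
Qed.
(** * Uniqueness *)

Section uniqueness.
Variables (F : finFieldType) (L : Gr0 F) (f h : hspace F -> hspace F).
Hypothesis fh : bicontinuous f h.
Hypothesis fL : forall x, Gr0_set L x <-> (f x).2 = 0.
Implicit Types (phi w : nat -> F) (c t : F) (x y v : hspace F) (K : Sigma_set L).

Let f_lin : lin f. Proof. by case: fh. Qed.
Let fK : cancel f h. Proof. by case: fh. Qed.
Let hK : cancel h f. Proof. by case: fh. Qed.
Let f_cont : contin0 f. Proof. by case: fh. Qed.
Let h_cont : contin0 h. Proof. by case: fh. Qed.
Let h_lin : lin h.
Proof. by move=> a x y; apply: (can_inj fK); rewrite f_lin !hK. Qed.

Definition ball m x : set (hspace F) := [set v | tail m (f v - x)].

Definition slab m : set (hspace F) := [set x | (size (x.1 : {poly F}) <= m)%N].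

Lemma lopen_ball m x : lopen (ball m x).
Proof.
move=> v tv; have [n fn] := f_cont m; exists n => y /fn ty.
rewrite /ball /= -[v]scale1r f_lin scale1r addrAC.
by apply: lsubspaceD => //; exact: lsubspace_tail.
Qed.

Lemma slabD m x y t : slab m x -> slab m y -> slab m (x + t *: y).
Proof.
move=> /leq_sizeP sx /leq_sizeP sy; apply/leq_sizeP => i mi.
by rewrite [LHS]coefD coefZ sx// sy// mulr0 addr0.
Qed.

(** The restriction to level [m]: two subspaces are equivalent when their images
    in [V / tail m] have the same intersection with the finite space
    [slab m / tail m]. *)
Definition same_level m K K' :=
  forall x, slab m x -> hit (ball m x) K <-> hit (ball m x) K'.

(** Representatives of the classes of [slab m] modulo [tail m]. *)
Definition point_of m (a : 'rV[F]_m * 'rV[F]_m) : hspace F :=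
  ((rVpoly a.1 : {poly F}) : ell F, (fun j => (rVpoly a.2)`_j) : ell_dual F).

Definition pattern m K : {set 'rV[F]_m * 'rV[F]_m} :=
  [set a | `[< hit (ball m (point_of a)) K >]].

Let ball_eq m x y : tail m (x - y) -> ball m x = ball m y.
Proof.
move=> txy; have sT := lsubspace_tail F m.
apply/seteqP; split=> v /= tv.
  by rewrite /ball /= -[f v](subrK x) -addrA; exact: lsubspaceD.
rewrite /ball /= -[f v](subrK y) -addrA -[y - x]opprB.
by apply: lsubspaceB.
Qed.

Let slab_point m (a : 'rV[F]_m * 'rV[F]_m) : slab m (point_of a).
Proof. by rewrite /slab /= size_poly. Qed.

Let point_exists m x : slab m x -> exists a : 'rV[F]_m * 'rV[F]_m,
  ball m x = ball m (point_of a).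
Proof.
move=> sx; exists (poly_rV (x.1 : {poly F}), \row_j x.2 j); apply: ball_eq.
split=> [|j jm]; first by rewrite /= poly_rV_K// subrr.
rewrite [LHS](_ : _ = x.2 j - (rVpoly (\row_j x.2 (val j) : 'rV_m))`_j)//.
by rewrite coef_rVpoly insubT/= mxE subrr.
Qed.

Let patternP m K K' : pattern m K = pattern m K' <-> same_level m K K'.
Proof.
split=> [e x /point_exists[a ->]|e].
  have /setP/(_ a) := e; rewrite !inE => eb.
  by split=> /asboolP hb; apply/asboolP; [rewrite -eb|rewrite eb].
apply/setP => a; rewrite !inE; apply/asbool_equiv_eq.
by apply: e; exact: slab_point.
Qed.

Let measurable_pattern m p : measurable ([set K | pattern m K = p] : set (Sigma L)).
Proof.
rewrite (_ : [set K | _] = ~` \bigcup_(a : 'rV[F]_m * 'rV[F]_m)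
  (if a \in p then ~` hit (ball m (point_of a)) else hit (ball m (point_of a)))).
  apply: measurableC; apply: (@fin_bigcup_measurable _ (Sigma L)); first exact: finite_finset.
  move=> a _; case: ifP => _; last by apply: measurable_hit; exact: lopen_ball.
  by apply: measurableC; apply: measurable_hit; exact: lopen_ball.
apply/seteqP; split=> [K <- [a _]|K nK].
  by rewrite inE; case: asboolP => [Ka nKa|nKa Ka]; [exact: nKa|exact: nKa].
apply/setP => a; rewrite inE; apply/idP/idP => [/asboolP Ka|ap].
  by apply/negPn/negP => /negbTE ap; apply: nK; exists a; rewrite ?ap.
by apply/asboolP; apply: contrapT => Ka; apply: nK; exists a; rewrite ?ap.
Qed.

(** Both [L \ K] and [K \ L] are seen at level [m]. Then the functional and the
    vector of [K] are nonzero at that level, as pivoting requires; moreover the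
    condition increases with [m]. *)
Definition visible m : set (Sigma_set L) := [set K |
  (exists x, [/\ slab m x, x.2 = 0 & ~ hit (ball m x) K]) /\
  (exists x, [/\ slab m x, hit (ball m x) K & exists2 j, (j < m)%N & x.2 j != 0])].

Let visible_same_level m K K' : same_level m K K' -> visible m K -> visible m K'.
Proof.
move=> e [[x [sx x2 Kx]] [y [sy Ky y2]]]; split; [exists x|exists y]; split=> //.
  by move/e => /(_ sx).
exact/e.
Qed.

Let visible_mono m n : (m <= n)%N -> visible m `<=` visible n.
Proof.
move=> mn K [[x [sx x2 Kx]] [y [sy [v [Kv tv]] [j jm yj]]]].
split; first exists x; first split=> //.
- exact: leq_trans mn.
- by move=> [u [Ku tu]]; apply: Kx; exists u; split=> //; exact: tailS tu.
have e1 : (f v).1 = y.1.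
  by apply/eqP; rewrite -subr_eq0; apply/eqP; exact: (proj1 tv).
exists (f v); split.
- by rewrite /slab /= e1 (leq_trans _ mn).
- exists v; split=> //; rewrite /ball /= subrr.
  by case: (lsubspace_tail F n).
- exists j; first exact: leq_trans mn.
  have := proj2 tv j jm; rewrite [LHS](_ : _ = (f v).2 j - y.2 j)//.
  by move/eqP; rewrite subr_eq0 => /eqP ->.
Qed.

Let hit_neighbour m x K phi w c : space_of K = f @^-1` neighbour phi w c ->
  hit (ball m x) K <-> exists t, (forall j, (j < m)%N -> x.2 j = t * w j) /\
    pairing x.1 phi = t * c.
Proof.
move=> KE; rewrite /hit /= KE; split=> [[v [[t [v2 v1]] [tv1 tv2]]]|[t [x2 x1]]].
  exists t; split.
    move=> j jm; have := tv2 j jm; rewrite [LHS](_ : _ = (f v).2 j - x.2 j)//.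
    by rewrite v2 => /eqP; rewrite subr_eq0 => /eqP ->.
  rewrite -v1; congr (pairing _ _); apply/esym/eqP; rewrite -subr_eq0.
  exact/eqP.
exists (h (x.1, (fun j => t * w j) : ell_dual F)); split.
  by rewrite /= hK; exists t.
rewrite /ball /= hK; split=> [|j jm]; first by rewrite /= subrr.
by rewrite [LHS](_ : _ = t * w j - x.2 j)// x2// subrr.
Qed.

Let visible_nonzero m K phi w c : space_of K = f @^-1` neighbour phi w c ->
  visible m K ->
  (exists2 i, (i < m)%N & phi i != 0) /\ (exists2 j, (j < m)%N & w j != 0).
Proof.
move=> KE [[x [sx x2 Kx]] [y [sy Ky [j jm yj]]]]; split; last first.
  exists j => //; have [t [ty _]] := proj1 (hit_neighbour m y KE) Ky.
  by apply: contra_neq yj => wj; rewrite ty// wj mulr0.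
apply: contrapT => nphi; apply: Kx; apply/(hit_neighbour m x KE); exists 0; split.
  by move=> k _; rewrite x2 mul0r.
rewrite mul0r /pairing big1// => i _; apply/eqP; rewrite mulf_eq0; apply/orP; right.
by apply/negPn/negP => phii; apply: nphi; exists (val i) => //; exact: leq_trans (ltn_ord i) sx.
Qed.

Let visible_cover K : exists m, visible m K.
Proof.
have [phi [w [c [[[i phii] [j wj]] KE]]]] := Sigma_neighbour fh fL K.
exists (maxn i.+1 j.+1).
have im : (i < maxn i.+1 j.+1)%N by rewrite leq_max leqnn.
have jm : (j < maxn i.+1 j.+1)%N by rewrite leq_max leqnn orbT.
split.
  exists (('X^i : {poly F}) : ell F, 0); split=> //; first by rewrite /slab /= size_polyXn.
  move=> /(hit_neighbour _ _ KE)[t [/= /(_ j jm)/esym/eqP]].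
  rewrite mulf_eq0 (negbTE wj) orbF => /eqP ->.
  by rewrite mul0r pairingXn => /eqP; rewrite (negbTE phii).
exists ((c / phi i) *: ('X^i : {poly F}) : ell F, (w : ell_dual F)); split.
- by rewrite /slab /= (leq_trans (size_scale_leq _ _))// size_polyXn.
- apply/(hit_neighbour _ _ KE); exists 1; split; first by move=> k _; rewrite mul1r.
  by rewrite /= pairingZ pairingXn divfK// mul1r.
- by exists j.
Qed.

Definition level_determined m (A : set (Sigma_set L)) :=
  forall K K', same_level m K K' -> A K -> A K'.

Definition visible_pattern m (A : set (Sigma_set L)) (p : {set 'rV[F]_m * 'rV[F]_m}) : bool :=
  `[< exists K, [/\ A K, visible m K & pattern m K = p] >].

Definition delta : nat -> F := fun k => (k == 0%N)%:R.

Variable R : realType.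

Section one_measure.
Variable nu : probability (Sigma L) R.
Hypothesis nu_inv : transvection_invariant nu.

Definition level_class m K : set (Sigma L) := [set K' | same_level m K K'].

Lemma measurable_level_class m K : measurable (level_class m K).
Proof.
rewrite (_ : level_class m K = [set K' | pattern m K' = pattern m K]).
  exact: measurable_pattern.
by apply/seteqP; split=> K' /=; [move/patternP => ->|move=> e; apply/patternP].
Qed.

Definition mass m phi w c : \bar R := nu (level_class m (neighbour_point fh fL phi w c)).

Lemma mass_fin_num m phi w c : mass m phi w c \is a fin_num.
Proof. by apply: fin_num_measure; exact: measurable_level_class. Qed.

Let mass_eq m K phi w c : nondegenerate phi w ->
  space_of K = f @^-1` neighbour phi w c -> nu (level_class m K) = mass m phi w c.
Proof.
move=> nd KE; rewrite /mass; congr (nu (level_class m _)).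
by apply: space_of_inj; rewrite neighbour_pointE.
Qed.

(* A transvection that acts on [slab m / tail m] permutes the classes of level [m],
   hence preserves their measures. *)
Let mass_act m psi y phi w c : transvection_data psi y ->
  (forall v, tail m v -> psi v = 0) -> slab m y ->
  nondegenerate phi w -> nondegenerate (act_functional psi y phi) (act_vector psi y w) ->
  mass m phi w c = mass m (act_functional psi y phi) (act_vector psi y w)
    (act_scalar psi y phi w c).
Proof.
move=> td pm sy nd nd'; have [psiL _ py1 py2 yp] := td.
have psiy : psi y = 0 by rewrite (linear_form_split y psiL) py1 py2 addr0.
pose psi' := psi \o f; pose y' := h y.
have tp : fixing_transvection L psi' y'.
  split.
  - by move=> a u v; rewrite /psi' /= f_lin psiL.
  - by have [n fn] := f_cont m; exists n => v /fn/pm.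
  - by rewrite /psi' /y' /= hK.
  - case: yp => [y2|p1]; [left|right].
      by apply/fL; rewrite /y' hK.
    by move=> x /fL x2; rewrite /psi' /= (linear_form_split _ psiL) x2 p1 add0r;
       exact: (linear_form0 psiL).
have [psi'L psi'n py' _] := tp.
have [T [TE mT trE]] :=
  Sigma_automorphism (bicontinuous_transvection psi'L py' psi'n) (fixing_transvection_stable tp).
have fT v : f (transvection psi' y' v) = transvection psi y (f v).
  by rewrite /transvection /psi' /y' /= addrC f_lin hK addrC.
have hitT K x : hit (ball m x) (T K) <-> hit (ball m (transvection psi y x)) K.
  split=> [[v []]|[v [Kv]]].
    rewrite TE => Kv tv; exists (transvection psi' y' v); split=> //.
    have pv : psi (f v) = psi x.
      apply/eqP; rewrite -subr_eq0 -mulN1r -linear_formZ// -linear_formD// scaleN1r.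
      exact/eqP/pm.
    by rewrite /ball /= fT /transvection pv opprD addrACA subrr addr0.
  pose g' := transvection (fun v => - psi' v) y'.
  have gK u : transvection psi' y' (g' u) = u.
    rewrite -[LHS]/((transvection psi' y') (g' u)).
    by have [_ _ + _ _] := bicontinuous_transvection psi'L py' psi'n; apply.
  move=> tv; exists (g' v); split; first by rewrite TE /= gK.
  have pv : psi (f v) = psi x.
    have e : psi (f v - transvection psi y x) = 0 by exact: pm.
    move: e; rewrite /transvection -scaleN1r linear_formD// linear_formZ//.
    rewrite linear_formD// linear_formZ// psiy mulr0 addr0 mulN1r => /eqP.
    by rewrite subr_eq0 => /eqP.
  rewrite /ball /= (_ : f (g' v) = f v - psi x *: y).
    by move: tv; rewrite /ball /= /transvection opprD addrA addrAC.
  rewrite /g' /transvection /psi' /= addrC f_lin /y' hK pv.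
  by rewrite scaleNr addrC.
have slT x : slab m x -> slab m (transvection psi y x) by move=> sx; exact: slabD.
have same_levelT K K' : same_level m (T K) (T K') <-> same_level m K K'.
  split=> e x sx; last first.
    have h1 := hitT K x; have h2 := hitT K' x; have h3 := e _ (slT _ sx).
    exact: iff_trans h1 (iff_trans h3 (iff_sym h2)).
  pose x' := x + (- psi x) *: y.
  have sx' : slab m x' by exact: slabD.
  have -> : x = transvection psi y x'.
    rewrite /transvection /x' linear_formD// linear_formZ// psiy mulr0 addr0.
    by rewrite scaleNr subrK.
  have h1 := hitT K x'; have h2 := hitT K' x'; have h3 := e _ sx'.
  exact: iff_trans (iff_sym h1) (iff_trans h3 h2).
set K := neighbour_point fh fL phi w c.
have -> : mass m phi w c = nu (level_class m (T K)).
  rewrite -(nu_inv tp (measurable_level_class m (T K))) trE; congr (nu _).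
  by apply/seteqP; split=> K' /same_levelT.
apply: mass_eq => //; rewrite TE neighbour_pointE//.
apply/seteqP; split=> v.
  by rewrite /= fT => /(neighbour_transvection _ _ _ _ td).
by move=> Nv; rewrite /= fT; apply/(neighbour_transvection _ _ _ _ td).
Qed.

Let mass_scale_functional m phi w c t : nondegenerate phi w -> t != 0 ->
  mass m phi w c = mass m (fun i => t * phi i) w (t * c).
Proof.
move=> nd t0; have [[i phii] wn] := nd; apply: mass_eq.
  by split=> //; exists i; rewrite mulf_neq0.
by rewrite neighbour_pointE// neighbour_scale_functional.
Qed.

Let mass_scale_vector m phi w c t : nondegenerate phi w -> t != 0 ->
  mass m phi w c = mass m phi (fun i => t * w i) (t * c).
Proof.
move=> nd t0; have [phin [i wi]] := nd; apply: mass_eq.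
  by split=> //; exists i; rewrite mulf_neq0.
by rewrite neighbour_pointE// neighbour_scale_vector.
Qed.

(* With a pivot [phi i != 0] at level [m], the transvections along [e_i] change
   the other values of [phi] arbitrarily. *)
Let mass_functional m phi phi' w c i : (i < m)%N -> phi i != 0 -> phi' i = phi i ->
  (exists j, w j != 0) -> mass m phi w c = mass m phi' w c.
Proof.
move=> im phii phi'i wn.
pose chi k := (phi' k - phi k) / phi i.
pose psi v := pairing v.1 chi.
pose y : hspace F := (('X^i : {poly F}) : ell F, 0).
have psiL : linear_form psi by move=> a u v; exact: pairing_lin.
have td : transvection_data psi y.
  split=> //.
  - by exists 0%N => v [v1 _]; rewrite /psi v1 pairing0.
  - by rewrite /psi /= pairingXn /chi phi'i subrr mul0r.
  - by rewrite /psi pairing0.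
  - by left.
have e1 : act_functional psi y phi = phi'.
  apply/funext => k; rewrite /act_functional /psi /= !pairingXn /chi mulrC divfK//.
  by rewrite addrC subrK.
have e2 : act_vector psi y w = w.
  by apply/funext => k; rewrite /act_vector /= mulr0 subr0.
have e3 : act_scalar psi y phi w c = c.
  by rewrite /act_scalar /psi pairing0 mul0r subr0.
have := @mass_act m psi y phi w c td; rewrite e1 e2 e3; apply.
- by move=> v [v1 _]; rewrite /psi v1 pairing0.
- by rewrite /slab /= size_polyXn.
- by split=> //; exists i.
- by split=> //; exists i; rewrite phi'i.
Qed.

(* With a pivot [w j != 0], the vector is changed arbitrarily outside [j]; as [phi]
   is nonzero, adding to [y] a multiple of [e_i] adjusts the scalar as well. *)
Let mass_vector m phi w w' c c' i j : (i < m)%N -> (j < m)%N ->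
  phi i != 0 -> w j != 0 -> w' j = w j -> mass m phi w c = mass m phi w' c'.
Proof.
move=> im jm phii wj w'j.
pose psi v : F := v.2 j.
pose y : hspace F := (((c - c') / (w j * phi i)) *: ('X^i : {poly F}) : ell F,
  (fun k => (w k - w' k) / w j) : ell_dual F).
have psiL : linear_form psi by [].
have psitail v : tail m v -> psi v = 0 by move=> [_]; apply.
have td : transvection_data psi y.
  split=> //; [by exists m| |by right].
  by rewrite /psi /= w'j subrr mul0r.
have e1 : act_functional psi y phi = phi.
  by apply/funext => k; rewrite /act_functional /psi /= mulr0 addr0.
have e2 : act_vector psi y w = w'.
  by apply/funext => k; rewrite /act_vector /psi /= mulrC divfK// subKr.
have e3 : act_scalar psi y phi w c = c'.
  rewrite /act_scalar /psi /= pairingZ pairingXn.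
  by field; rewrite phii wj.
have := @mass_act m psi y phi w c td; rewrite e1 e2 e3; apply=> //.
- by rewrite /slab /= (leq_trans (size_scale_leq _ _))// size_polyXn.
- by split; [exists i|exists j].
- by split; [exists i|exists j; rewrite w'j].
Qed.

(* Pivoting brings every functional and vector that are nonzero at level [m] to
   the first basis vectors; when the pivot is already the first coordinate, it is
   normalised by rescaling the parameters. *)
Let mass_delta m phi w c i j : (i < m)%N -> (j < m)%N -> phi i != 0 -> w j != 0 ->
  mass m phi w c = mass m delta delta 0.
Proof.
move=> im jm phii wj.
have m0 : (0 < m)%N by exact: leq_ltn_trans im.
have d0 : delta 0%N = 1 by rewrite /delta eqxx.
have d0n : delta 0%N != 0 by rewrite d0 oner_eq0.
have wn : exists j, w j != 0 by exists j.
have [c1 ->] : exists c1, mass m phi w c = mass m delta w c1.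
  have [i0|i0] := eqVneq i 0%N.
    rewrite i0 in phii; exists ((phi 0%N)^-1 * c).
    rewrite (@mass_scale_functional m phi w c (phi 0%N)^-1) ?invr_eq0//.
      apply: (@mass_functional _ _ _ _ _ 0%N) => //.
        by rewrite mulVf ?oner_eq0.
      by rewrite d0 mulVf.
    by split=> //; exists 0%N.
  exists c; rewrite (@mass_functional m phi (fun k => if k == 0%N then 1 else phi k) w c i)//.
    by apply: (@mass_functional _ _ _ _ _ 0%N) => //; rewrite eqxx oner_eq0.
  by rewrite (negbTE i0).
have [j0|j0] := eqVneq j 0%N.
  rewrite j0 in wj.
  rewrite (@mass_scale_vector m delta w c1 (w 0%N)^-1) ?invr_eq0//.
    apply: (@mass_vector _ _ _ _ _ _ 0%N 0%N) => //.
      by rewrite mulVf ?oner_eq0.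
    by rewrite d0 mulVf.
  by split=> //; exists 0%N.
rewrite (@mass_vector m delta w (fun k => if k == 0%N then 1 else w k) c1 0 0%N j)//.
  by apply: (@mass_vector _ _ _ _ _ _ 0%N 0%N) => //; rewrite eqxx oner_eq0.
by rewrite (negbTE j0).
Qed.

(** All classes that are visible at level [m] have the same mass, so measuring
    sets of level [m] amounts to counting classes. *)
Lemma measure_by_counting m (A : set (Sigma L)) : measurable A -> level_determined m A ->
  measurable (A `&` visible m : set (Sigma L)) /\
  nu (A `&` visible m) = ((#|[pred p | @visible_pattern m A p]|%:R)%:E * mass m delta delta 0%R)%E.
Proof.
move=> mA Am.
have pieceE p : A `&` visible m `&` [set K | pattern m K = p] =
    if visible_pattern A p then [set K | pattern m K = p] else set0.
  rewrite /visible_pattern; case: asboolP => [[K [AK vK Kp]]|np]; last first.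
    by apply/seteqP; split=> // K [[AK vK] Kp]; apply: np; exists K.
  apply/seteqP; split=> K'; first by case.
  rewrite /= -{1}Kp => /esym/patternP e; split; last by rewrite -Kp; exact/esym/patternP.
  by split; [exact: Am e AK|exact: visible_same_level e vK].
have mAv : measurable (A `&` visible m : set (Sigma L)).
  rewrite (_ : _ `&` _ = \bigcup_p (A `&` visible m `&` [set K | pattern m K = p])).
    apply: (@fin_bigcup_measurable _ (Sigma L)); first exact: finite_finset.
    by move=> p _; rewrite pieceE; case: ifP => _ //; exact: measurable_pattern.
  by apply/seteqP; split=> [K AK|K [p _ []]//]; exists (pattern m K).
split=> //.
rewrite (@measure_finite_partition _ (Sigma L) R nu _ (pattern m))//; last first.
  exact: measurable_pattern.
rewrite (eq_bigr (fun p => if visible_pattern A p then mass m delta delta 0 else 0%E)).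
  rewrite -big_mkcond/= sumr_const.
  by rewrite mule_natl.
move=> p _; rewrite pieceE /visible_pattern; case: asboolP => [[K [AK vK Kp]]|_]; last first.
  exact: measure0.
have [phi [w [c [nd KE]]]] := Sigma_neighbour fh fL K.
have [[i im phii] [j jm wj]] := visible_nonzero KE vK.
rewrite -(mass_delta c im jm phii wj) -(mass_eq m nd KE); congr (nu _).
apply/seteqP; split=> K' /=; first by rewrite -Kp => /esym/patternP.
by move=> /patternP <-.
Qed.

End one_measure.

(* These sets form a pi-system, and they generate since so do the balls. *)
Let finite_level : set (set (Sigma_set L)) := [set A | measurable (A : set (Sigma L)) /\
  exists n, forall m, (n <= m)%N -> level_determined m A].

Let finite_level_setI : setI_closed finite_level.
Proof.
move=> A B [mA [n nA]] [mB [k kB]]; split; first exact: (@measurableI _ (Sigma L)).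
exists (maxn n k) => m; rewrite geq_max => /andP[nm km] K K' e [AK BK].
by split; [exact: nA e AK|exact: kB e BK].
Qed.

Let finite_level_ball n x : finite_level (hit (ball n x)).
Proof.
split; first by apply: measurable_hit; exact: lopen_ball.
exists (maxn n (size (x.1 : {poly F}))) => m; rewrite geq_max => /andP[nm xm] K K' e.
move=> [v [Kv tv]].
have sv : slab m (f v).
  rewrite /slab /= (_ : (f v).1 = x.1)//.
  by apply/eqP; rewrite -subr_eq0; apply/eqP; exact: (proj1 tv).
have [v' [Kv' tv']] : hit (ball m (f v)) K'.
  apply/(e _ sv); exists v; split=> //; rewrite /ball /= subrr.
  by case: (lsubspace_tail F m).
exists v'; split=> //; rewrite /ball /= -[f v'](subrK (f v)) -addrA.
by apply: lsubspaceD => //; [exact: lsubspace_tail|exact: tailS tv'].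
Qed.

Let measurable_finite_level : @measurable _ (Sigma L) = <<s finite_level >>.
Proof.
apply/seteqP; split; last first.
  by apply: smallest_sub; [exact: sigma_algebra_measurable|move=> A []].
rewrite Sigma_measurableE; apply: smallest_sub; first exact: smallest_sigma_algebra.
move=> _ [U oU <-].
pose x_of (e : {poly F} * {poly F}) : hspace F :=
  (e.1 : ell F, (fun j => e.2`_j) : ell_dual F).
rewrite (_ : hit U = \bigcup_(e : nat * ({poly F} * {poly F}))
  (if `[< ball e.1 (x_of e.2) `<=` U >] then hit (ball e.1 (x_of e.2)) else set0)).
  apply: (@countable_bigcupT_measurable _ (g_sigma_algebraType finite_level)).
    exact: countableP.
  by move=> e; case: ifP => _ //; apply: sub_sigma_algebra; exact: finite_level_ball.
apply/seteqP; split=> [K [x [Kx Ux]]|K [e _]]; last first.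
  by case: asboolP => // sub [x [Kx /sub Ux]]; exists x.
have [n nU] : exists n, forall v, tail n v -> U (h (f x + v)).
  have := lopen_preimage h_lin h_cont oU => /(_ (f x)); rewrite /= fK => /(_ Ux)[n nU].
  by exists n => v /nU.
pose e : nat * ({poly F} * {poly F}) := (n, ((f x).1 : {poly F}, \poly_(j < n) (f x).2 j)).
have te : tail n (f x - x_of e.2).
  split=> [|j jn]; first by rewrite /= subrr.
  by rewrite [LHS](_ : _ = (f x).2 j - (\poly_(j < n) (f x).2 j)`_j)// coef_poly jn subrr.
exists e => //; case: asboolP => [_|[]]; first by exists x.
move=> v tv; rewrite -[v]fK (_ : f v = f x + (f v - f x)); last by rewrite addrC subrK.
apply: nU; rewrite (_ : f v - f x = (f v - x_of e.2) - (f x - x_of e.2)).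
  by apply: lsubspaceB => //; exact: lsubspace_tail.
by rewrite opprB addrA subrK.
Qed.

(** By counting, [nu (A `&` visible m) / nu (visible m)] is the same for both
    measures when [A] has finite level, and the sets [visible m] increase to the
    whole space. *)
Lemma transvection_invariant_unique (nu nu' : probability (Sigma L) R) :
  transvection_invariant nu -> transvection_invariant nu' ->
  forall A : set (Sigma L), measurable A -> nu A = nu' A.
Proof.
move=> inv inv'.
have mT m : level_determined m setT by [].
have vis_cvg (P : probability (Sigma L) R) (A : set (Sigma L)) n : transvection_invariant P ->
    measurable A -> (forall m, (n <= m)%N -> level_determined m A) ->
    fine (P (A `&` visible (m + n)%N)) @[m --> \oo] --> fine (P A).
  move=> invP mA nA.
  have mAv m : measurable (A `&` visible (m + n)%N : set (Sigma L)).
    by have [] := measure_by_counting invP mA (nA (m + n)%N (leq_addl _ _)).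
  have AE : \bigcup_m (A `&` visible (m + n)%N) = A.
    apply/seteqP; split=> [K [m _ []]//|K AK]; have [m vK] := visible_cover K.
    by exists m => //; split=> //; apply: visible_mono vK; exact: leq_addr.
  apply: fine_cvg; rewrite fineK; last exact: fin_num_measure.
  rewrite -[in X in _ --> X]AE.
  apply: nondecreasing_cvg_mu => //; first by rewrite AE.
  move=> k m km; apply/subsetPset; apply: setIS; apply: visible_mono.
  by rewrite leq_add2r.
apply: (@measure_unique _ R (Sigma L) finite_level (fun=> setT) measurable_finite_level
  finite_level_setI _ _ nu nu') => //.
- by move=> _; split; [exact: measurableT|exists 0%N].
- by rewrite bigcup_const//; exists 0%N.
- move=> A [mA [n nA]].
  have c1 := vis_cvg nu A n inv mA nA; have c2 := vis_cvg nu' A n inv' mA nA.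
  have d1 := vis_cvg nu setT n inv measurableT (fun m _ => @mT m).
  have d2 := vis_cvg nu' setT n inv' measurableT (fun m _ => @mT m).
  have fA : fine (nu A) * fine (nu' setT) = fine (nu' A) * fine (nu setT).
    pose a (P : probability (Sigma L) R) (B : set (Sigma L)) m : R :=
      fine (P (B `&` visible (m + n)%N)).
    suff e : a nu A \* a nu' setT = a nu' A \* a nu setT.
      have l1 : (a nu A \* a nu' setT) m @[m --> \oo] -->
        fine (nu A) * fine (nu' setT) by exact: cvgM c1 d2.
      have l2 : (a nu' A \* a nu setT) m @[m --> \oo] -->
        fine (nu' A) * fine (nu setT) by exact: cvgM c2 d1.
      by rewrite e in l1; exact: (cvg_unique (@norm_hausdorff _ R^o) l1 l2).
    apply/funext => m; rewrite /a /=.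
    have nm : (n <= m + n)%N by exact: leq_addl.
    rewrite (measure_by_counting inv mA (nA _ nm)).2.
    rewrite (measure_by_counting inv' mA (nA _ nm)).2.
    rewrite (measure_by_counting inv measurableT (mT _)).2.
    rewrite (measure_by_counting inv' measurableT (mT _)).2.
    by rewrite !fineM ?mass_fin_num//=; ring.
  move: fA; rewrite [in fine (nu' setT)]probability_setT [in fine (nu setT)]probability_setT /= !mulr1 => e.
  by rewrite -[LHS]fineK ?fin_num_measure// -[RHS]fineK ?fin_num_measure// e.
- by move=> _; apply: (le_lt_trans (probability_le1 nu measurableT)); exact: ltry.
Qed.

End uniqueness.
(** * From transvections to the stabilizer *)

Section conclusion.
Variables (F : finFieldType) (L : Gr0 F).
Implicit Types (psi : hspace F -> F) (y v : hspace F).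

(** The block [a] of a transvection is a rank one perturbation of the identity
    of [ell]; it is invertible, or its kernel and its cokernel are lines. *)
Lemma theta_transvection psi y : linear_form psi ->
  theta_is (transvection psi y) 0.
Proof.
move=> psiL; pose beta (u : ell F) : F := psi (u, 0).
have betaL (a : F) (u v : ell F) : beta (a *: u + v) = a * beta u + beta v.
  rewrite /beta -psiL; congr (psi _); congr (_, _).
  by rewrite /= scaler0 addr0.
have aE (u : ell F) : block_a (transvection psi y) u = u + beta u *: y.1 by [].
have betaB (u : ell F) (c : F) : beta (u - c *: y.1) = beta u - c * beta y.1.
  by rewrite addrC -scaleNr betaL mulNr addrC.
have betaD (u : ell F) (c : F) : beta (u + c *: y.1) = beta u + c * beta y.1.
  by rewrite addrC betaL addrC.
have beta0 : beta 0 = 0 by exact: (linear_form0 psiL).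
have [by1|by1] := eqVneq (1 + beta y.1) 0.
  have {}by1 : beta y.1 = - 1.
    by apply/eqP; rewrite -subr_eq0 opprK addrC by1.
  exists 1%N, 1%N; split=> //.
    have -> : range (block_a (transvection psi y)) = [set u | beta u = 0].
      apply/seteqP; split=> [_ [u _ <-]|u /= u0].
        by rewrite /= aE betaD by1 mulrN1 subrr.
      by exists u => //; rewrite aE u0 scale0r addr0.
    apply: (dim_quot1 (u := y.1) (phi := fun u => - beta u)) => // u.
      by rewrite /= betaB by1 mulrN1 !opprK subrr.
    by move=> c _ /eqP; rewrite /= betaB by1 mulrN1 opprK addr_eq0 => /eqP ->; rewrite opprK.
  apply: (dim_quot1 (u := y.1) (phi := fun u => - beta u)).
  - by rewrite /= aE by1 scaleN1r subrr.
  - by move=> u; rewrite /= aE scaleNr opprK.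
  - move=> u c _ /= /eqP; rewrite subr_eq0 => /eqP ->.
    have := betaB 0 (- c); rewrite scaleNr opprK add0r beta0 sub0r by1 => ->.
    by rewrite mulrN1 opprK opprK.
exists 0%N, 0%N; split; last by [].
  rewrite (_ : range _ = setT); first exact: dim_quot_refl.
  apply/seteqP; split=> // u _; exists (u - (beta u / (1 + beta y.1)) *: y.1) => //.
  have e : - (beta u / (1 + beta y.1)) +
      (beta u - beta u / (1 + beta y.1) * beta y.1) = 0 by field.
  by rewrite aE betaB -addrA -scaleNr -scalerDl e scale0r addr0.
rewrite (_ : [set u | _] = [set 0]); first exact: dim_quot_refl.
apply/seteqP; split=> u /=; last by move=> ->; rewrite aE beta0 scale0r addr0.
rewrite aE => e; have := congr1 beta e; rewrite betaD beta0 -[X in X + _]mulr1 -mulrDr.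
move/eqP; rewrite mulf_eq0 (negbTE by1) orbF => /eqP bu.
by move: e; rewrite bu scale0r addr0.
Qed.

Lemma transvection_in_stabilizer psi y : fixing_transvection L psi y ->
  exists2 g : {linear hspace F -> hspace F}, stabilizer L g &
    (g : hspace F -> hspace F) = transvection psi y.
Proof.
move=> tp; have [psiL pn py _] := tp.
have [tL tK t'K tc t'c] := bicontinuous_transvection psiL py pn.
pose tlin := GRing.isLinear.Build F (hspace F) (hspace F) *:%R (transvection psi y) tL.
pose g : {linear hspace F -> hspace F} := HB.pack (transvection psi y) tlin.
exists g => //; split; first split; first split.
- exact/contin0P.
- exists (transvection (fun v => - psi v) y); split=> //.
  by apply/contin0P => //; apply: (can2_linear (f := g)).
- exact: theta_transvection.
have st := fixing_transvection_stable tp.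
apply/seteqP; split=> [_ [v Lv <-]|v Lv]; first exact: (proj2 (st v) Lv).
exists (transvection (fun v => - psi v) y v); last exact: t'K.
by apply: (proj1 (st _)); rewrite t'K.
Qed.

(** The stabilizer of [L] normalises the set of transvections that fix [L]. *)
Lemma fixing_transvection_conj psi y (g g' : hspace F -> hspace F) :
  bicontinuous g g' -> (forall x, Gr0_set L (g x) <-> Gr0_set L x) ->
  fixing_transvection L psi y -> fixing_transvection L (psi \o g') (g y).
Proof.
move=> [gL gK g'K gc g'c] gLL [psiL [n pn] py Ly]; split.
- move=> a u v; rewrite /= -psiL; congr (psi _).
  by apply: (can_inj gK); rewrite gL !g'K.
- by have [m mg] := g'c n; exists m => v /mg/pn.
- by rewrite /= gK.
- case: Ly => [Ly|L0]; [left; exact/gLL|right=> x Lx].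
  by apply: L0; apply/gLL; rewrite g'K.
Qed.

(** The image of an invariant measure under [g] is again invariant under the
    normal subgroup generated by the transvections, hence it is the same. *)
Lemma transvection_invariant_stabilizer (R : realType) (nu : probability (Sigma L) R) :
  transvection_invariant nu -> stabilizer_invariant nu.
Proof.
move=> inv g [[[gcont [g' [g'cont gK g'K]]] _] gLim] A mA.
have gL : lin g by move=> a x z; rewrite linearP.
have g'L : lin g' by move=> a x z; apply: (can_inj gK); rewrite gL !g'K.
have bic : bicontinuous g g' by split=> //; exact/contin0P.
have gLL x : Gr0_set L (g x) <-> Gr0_set L x.
  split=> [|Lx]; first by rewrite -{1}gLim => -[z Lz /(can_inj gK) <-].
  by rewrite -gLim; exists x.
have [T [TE mT ->]] := Sigma_automorphism bic gLL.
have [nu' nu'E] := pushforward_probability nu mT.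
rewrite -nu'E.
have [f [h [fh fL]]] := straighten_Gr0 (svalP L).
apply: (transvection_invariant_unique fh fL _ inv mA) => psi y tp B mB.
have tp' := fixing_transvection_conj bic gLL tp.
have act (chi : hspace F -> F) z : fixing_transvection L chi z ->
    exists S : Sigma_set L -> Sigma_set L, (forall K, space_of (S K) =
      transvection chi z @^-1` space_of K) /\
      forall A, translate (transvection chi z) A = S @^-1` A.
  move=> t; have [chiL cn cz _] := t.
  have [S [SE _ tS]] := Sigma_automorphism (bicontinuous_transvection chiL cz cn)
    (fixing_transvection_stable t).
  by exists S.
have [S [SE tS]] := act _ _ tp; have [S' [SE' tS']] := act _ _ tp'.
rewrite !nu'E tS.
have mTB : measurable (T @^-1` B : set (Sigma L)) by rewrite -[X in measurable X]setTI; exact: mT.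
rewrite -(inv _ _ tp' _ mTB) tS'; congr (nu _).
suff e K : S (T K) = T (S' K) by apply/seteqP; split=> K; rewrite /= e.
apply: space_of_inj; rewrite SE !TE SE'.
have e x : g (transvection psi y x) = transvection (psi \o g') (g y) (g x).
  by rewrite /transvection /= gK addrC gL addrC.
by apply/seteqP; split=> x; rewrite /= e.
Qed.

End conclusion.

(* A [probability] is a function on all subsets, constrained only on the
   measurable ones, so equality of measures is equality on measurable sets. *)
Theorem proposition1p2 (F : finFieldType) (R : realType) (L : Gr0 F) :
  exists nu : probability (Sigma L) R,
    stabilizer_invariant nu /\
    forall nu' : probability (Sigma L) R, stabilizer_invariant nu' ->
      forall A : set (Sigma L), measurable A -> nu' A = nu A.
Proof.
have [nu inv] := exists_transvection_invariant R L.
exists nu; split; first exact: transvection_invariant_stabilizer.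
have [f [h [fh fL]]] := straighten_Gr0 (svalP L).
move=> nu' inv'; apply: (transvection_invariant_unique fh fL _ inv) => psi y tp A mA.
have [g Lg <-] := transvection_in_stabilizer tp.
exact: inv'.
Qed.
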